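(* Let $c\in\mathbb{C}$ and let $n\geq 1$ be an integer. Let $f(z)$ be a nonconstant entire function of finite order. If $f(z)$, $\Delta_c^{n}f(z)$ and $\Delta_c^{n+1}f(z)$ share $0$ CM, then there exists a nonzero constant $C\in\mathbb{C}$ such that $\Delta_c^{n+1}f(z)\equiv C\,\Delta_c^{n}f(z)$.
   Context: Difference operators: $\Delta_c f(z)=f(z+c)-f(z)$ and $\Delta_c^{n}f(z)=\Delta_c^{n-1}(\Delta_c f(z))$ for $n\geq 2$ (with $\Delta_c^1=\Delta_c$). $T(r,f)$ denotes the Nevanlinna characteristic of a meromorphic function $f$ on $\mathbb{C}$, and the order of growth of $f$ is $\rho(f)=\limsup_{r\to\infty}\frac{\log^+ T(r,f)}{\log r}$; $f$ has finite order if $\rho(f)<\infty$. Two functions $F$ and $G$ share $0$ CM (counting multiplicity) if $F$ and $G$ have the same zeros with the same multiplicities. Three functions share $0$ CM if any two of them do. *)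

(* Defs.v *)
From Stdlib Require Import Reals.
From Coquelicot Require Import Coquelicot.

Open Scope R_scope.

Definition entire (f : C -> C) : Prop :=
  forall z : C, @ex_derive C_AbsRing C_NormedModule f z.

Definition nonconstant (f : C -> C) : Prop :=
  ~ exists a : C, forall z : C, f z = a.

Definition Delta (c : C) (f : C -> C) : C -> C :=
  fun z => (f (z + c) - f z)%C.

Fixpoint Delta_n (c : C) (n : nat) (f : C -> C) : C -> C :=
  match n with
  | O => f
  | S m => Delta_n c m (Delta c f)
  end.

(* [ln 0 = 0] in the standard library, so [log_plus 0 = 0] as usual. *)
Definition log_plus (x : R) : R := Rmax 0 (ln x).

(* Proximity function m(r,f) = (1/2pi) int_0^{2pi} log^+ |f(r e^{it})| dt. *)
Definition proximity (f : C -> C) (r : R) : R :=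
  / (2 * PI) *
  RInt (fun t => log_plus (Cmod (f (r * cos t, r * sin t)))) 0 (2 * PI).

(* T(r,f) = m(r,f) + N(r,f), for [f] entire only: as [f] has no poles, the
   integrated counting function N(r,f) of the poles of [f] is zero. *)
Definition nevanlinna_T (f : C -> C) (r : R) : R := proximity f r.

(* limsup of [h] at infinity, as the infimum over r0 of sup_{r > r0} h(r). *)
Definition LimSup_p_infty (h : R -> R) : Rbar :=
  Rbar_glb (fun y : Rbar => exists r0 : R,
    y = Lub_Rbar (fun x : R => exists r : R, r0 < r /\ x = h r)).

Definition order_of_growth (f : C -> C) : Rbar :=
  LimSup_p_infty (fun r => log_plus (nevanlinna_T f r) / ln r).

Definition finite_order (f : C -> C) : Prop :=
  Rbar_lt (order_of_growth f) p_infty.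

(* For [F] holomorphic near [a]: [a] is a zero of [F] of multiplicity exactly
   [k] (with [k = 0] meaning F(a) <> 0).  If [F] vanishes identically near [a],
   no [k] qualifies. *)
Definition zero_mult (F : C -> C) (a : C) (k : nat) : Prop :=
  exists g : C -> C,
    locally a (fun z : C => @ex_derive C_AbsRing C_NormedModule g z) /\
    g a <> RtoC 0 /\
    locally a (fun z : C => F z = ((z - a) ^ k * g z)%C).

Definition share_0_CM (F G : C -> C) : Prop :=
  forall a : C,
    (F a = RtoC 0 <-> G a = RtoC 0) /\
    (forall k : nat, zero_mult F a k <-> zero_mult G a k).

Definition share_0_CM3 (F G H : C -> C) : Prop :=
  share_0_CM F G /\ share_0_CM F H /\ share_0_CM G H.

(* Main.v *)
(* Sharing 0 CM gives [Delta^n f = e^P f] and [Delta^(n+1) f = e^h Delta^n f] with [P], [h] entire, and finite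
   order makes them polynomials: Jensen's inequality bounds the proximity function of a quotient, the
   Poisson inequality turns it into a pointwise bound, and a function whose real part grows polynomially is a
   polynomial.  Substituting [f(z+jc) = e^(-P(z+jc)) prod_(i<j) (1 + e^h(z+ic)) Delta^n f(z)] in the binomial
   expansion of [Delta^n f] yields

     sum_(j<=n) (-1)^(n-j) C(n,j) e^(-P(z+jc)) prod_(i<j) (1 + e^h(z+ic)) = 1.

   Suppose [h] is not constant and let [al], [p] be the coefficients of [h], [P] in the larger of their degrees
   [D].  Along suitable rays one term of the identity dominates all others unless [p = n al]; if [D >= 2] the
   same happens, after multiplication by [e^P(z)], along rays with [Re (al z^D) < 0].  If [D = 1], these
   rays give [e^(pc) = 1], and the identity at [w] and [w - c], where [w] is a zero of [1 + e^h], gives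
   [e^(al c) = 1].  Then [f(z) = (1 + e^h(z))^k f(z - kc)] for all [k], so [f] vanishes to infinite order at [w]. *)
Require Import Defs.
From Stdlib Require Import Reals Lra Lia Classical ClassicalEpsilon FunctionalExtensionality.
From Coquelicot Require Import Coquelicot.

(** * Complex differentiability *)

(** A quotient of two functions of controlled growth has no direct pointwise bound, because the
    divisor may be small or zero. Its proximity function does have one: on average, zeros of the
    divisor [G] cost at most [- ln |G(0)|]. This is why growth is carried through a mean and then
    back to a pointwise estimate on a smaller disc.

    In the difference identity the term of index j expands into exponentials with leading
    coefficients [- p + m al], 0 <= m <= j. Real parts are affine in m, so in every direction the
    extremes are m = 0 and m = n; only [p = n al] lets the right-hand side 1 be balanced in all
    directions. After that, rays with [Re (al z^D) < 0] remove every [e^h], and the surviving terms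
    differ by exponentials of [P(z + jc) - P(z + kc)], of degree D - 1. For D >= 2 these are
    unbounded and separate the terms. For D = 1 they are constants, so no ray separates anything and
    the contradiction must come from periods and from a single zero of [1 + e^h]. *)

Definition Ccont (f : C -> C) (z : C) : Prop :=
  forall eps, 0 < eps -> exists delta, 0 < delta /\
    forall w, Cmod (w - z) < delta -> Cmod (f w - f z) < eps.

(* The two canonical uniform structures on [C] (absolute value and product) make [is_derive] awkward
   to compose, hence an epsilon-delta form; [ex_derive_Cder] relates the two. *)
Definition Cder (f : C -> C) (z l : C) : Prop :=
  forall eps, 0 < eps -> exists delta, 0 < delta /\
    forall w, Cmod (w - z) < delta ->
      Cmod (f w - f z - l * (w - z)) <= eps * Cmod (w - z).

Lemma Cmod_minus_sym (x y : C) : Cmod (x - y) = Cmod (y - x).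
Proof.
  replace (x - y)%C with (- (y - x))%C by ring. apply Cmod_opp.
Qed.

Lemma Cmod_self (x : C) : Cmod (x - x) = 0.
Proof. replace (x - x)%C with (RtoC 0) by ring. apply Cmod_0. Qed.

Lemma Cmod_triangle_minus (x y : C) : Cmod (x - y) <= Cmod x + Cmod y.
Proof. rewrite <- (Cmod_opp y). apply Cmod_triangle. Qed.

Lemma Cmod_triangle_rev (x y : C) : Cmod x - Cmod y <= Cmod (x - y).
Proof.
  generalize (Cmod_triangle (x - y) y). replace (x - y + y)%C with x by ring. lra.
Qed.

Lemma re_le_mod (z : C) : Rabs (fst z) <= Cmod z.
Proof. apply Rle_trans with (2 := Rmax_Cmod z). apply Rmax_l. Qed.

Lemma im_le_mod (z : C) : Rabs (snd z) <= Cmod z.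
Proof. apply Rle_trans with (2 := Rmax_Cmod z). apply Rmax_r. Qed.

Lemma Cmod_le_re_im (z : C) : Cmod z <= Rabs (fst z) + Rabs (snd z).
Proof.
  unfold Cmod. apply Rsqr_incr_0_var.
  - rewrite Rsqr_sqrt. 2: nra.
    unfold Rsqr. rewrite <- (pow2_abs (fst z)), <- (pow2_abs (snd z)).
    generalize (Rabs_pos (fst z)) (Rabs_pos (snd z)). nra.
  - generalize (Rabs_pos (fst z)) (Rabs_pos (snd z)). lra.
Qed.

Lemma Cmod_le_comp (z w : C) :
  Rabs (fst z) <= Rabs (fst w) -> Rabs (snd z) <= Rabs (snd w) -> Cmod z <= Cmod w.
Proof.
  intros H1 H2. unfold Cmod. apply sqrt_le_1_alt.
  apply Rsqr_le_abs_1 in H1. apply Rsqr_le_abs_1 in H2. unfold Rsqr in *. simpl. lra.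
Qed.

Lemma Ccont_const (a z : C) : Ccont (fun _ => a) z.
Proof.
  intros eps He. exists 1. split. lra. intros w _. now rewrite Cmod_self.
Qed.

Lemma Ccont_id (z : C) : Ccont (fun w => w) z.
Proof. intros eps He. exists eps. split; auto. Qed.

Lemma Ccont_plus (f g : C -> C) z : Ccont f z -> Ccont g z -> Ccont (fun w => f w + g w)%C z.
Proof.
  intros Hf Hg eps He.
  destruct (Hf (eps/2)) as [d1 [Hd1 H1]]. lra.
  destruct (Hg (eps/2)) as [d2 [Hd2 H2]]. lra.
  exists (Rmin d1 d2). split. now apply Rmin_glb_lt.
  intros w Hw.
  replace (f w + g w - (f z + g z))%C with ((f w - f z) + (g w - g z))%C by ring.
  eapply Rle_lt_trans. apply Cmod_triangle.
  specialize (H1 w (Rlt_le_trans _ _ _ Hw (Rmin_l _ _))).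
  specialize (H2 w (Rlt_le_trans _ _ _ Hw (Rmin_r _ _))). lra.
Qed.

Lemma Ccont_mult (f g : C -> C) z : Ccont f z -> Ccont g z -> Ccont (fun w => f w * g w)%C z.
Proof.
  intros Hf Hg eps He.
  set (A := Cmod (f z) + 1). set (B := Cmod (g z) + 1).
  assert (HA : 1 <= A) by (unfold A; generalize (Cmod_ge_0 (f z)); lra).
  assert (HB : 1 <= B) by (unfold B; generalize (Cmod_ge_0 (g z)); lra).
  destruct (Hf (Rmin 1 (eps / (2 * B)))) as [d1 [Hd1 H1]].
  { apply Rmin_glb_lt. lra. apply Rdiv_lt_0_compat; lra. }
  destruct (Hg (eps / (2 * A))) as [d2 [Hd2 H2]].
  { apply Rdiv_lt_0_compat; lra. }
  exists (Rmin d1 d2). split. now apply Rmin_glb_lt.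
  intros w Hw.
  specialize (H1 w (Rlt_le_trans _ _ _ Hw (Rmin_l _ _))).
  specialize (H2 w (Rlt_le_trans _ _ _ Hw (Rmin_r _ _))).
  replace (f w * g w - f z * g z)%C with (f w * (g w - g z) + (f w - f z) * g z)%C by ring.
  eapply Rle_lt_trans. apply Cmod_triangle. rewrite !Cmod_mult.
  assert (Hfw : Cmod (f w) <= A).
  { unfold A. generalize (Cmod_triangle_rev (f w) (f z)).
    generalize (Rmin_l 1 (eps / (2 * B))). lra. }
  assert (E2 : Cmod (f w) * Cmod (g w - g z) <= A * (eps / (2 * A))).
  { apply Rmult_le_compat; try apply Cmod_ge_0; lra. }
  assert (E1 : Cmod (f w - f z) * Cmod (g z) < (eps / (2 * B)) * B).
  { apply Rle_lt_trans with (Cmod (f w - f z) * B).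
    apply Rmult_le_compat_l. apply Cmod_ge_0. unfold B; lra.
    apply Rmult_lt_compat_r. lra. generalize (Rmin_r 1 (eps / (2 * B))). lra. }
  replace (A * (eps / (2 * A))) with (eps / 2) in E2 by (field; lra).
  replace (eps / (2 * B) * B) with (eps / 2) in E1 by (field; lra).
  lra.
Qed.

Lemma Ccont_minus (f g : C -> C) z : Ccont f z -> Ccont g z -> Ccont (fun w => f w - g w)%C z.
Proof.
  intros Hf Hg eps He.
  destruct (Ccont_plus f (fun w => RtoC (-1) * g w)%C z Hf (Ccont_mult _ _ _ (Ccont_const _ z) Hg) eps He)
    as [d [Hd K]].
  exists d. split; auto. intros w Hw.
  replace (f w - g w - (f z - g z))%C with (f w + RtoC (-1) * g w - (f z + RtoC (-1) * g z))%C by ring.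
  now apply K.
Qed.

Lemma Ccont_comp (f g : C -> C) z : Ccont g z -> Ccont f (g z) -> Ccont (fun w => f (g w)) z.
Proof.
  intros Hg Hf eps He. destruct (Hf eps He) as [d [Hd H]].
  destruct (Hg d Hd) as [d' [Hd' H']]. exists d'. split; auto.
Qed.

Lemma Ccont_inv (z : C) : z <> RtoC 0 -> Ccont Cinv z.
Proof.
  intros Hz eps He.
  assert (P : 0 < Cmod z) by now apply Cmod_gt_0.
  exists (Rmin (Cmod z / 2) (eps * (Cmod z * Cmod z) / 4)). split.
  { apply Rmin_glb_lt. lra. apply Rdiv_lt_0_compat. apply Rmult_lt_0_compat; nra. lra. }
  intros w Hw.
  assert (H1 := Rlt_le_trans _ _ _ Hw (Rmin_l _ _)).
  assert (H2 := Rlt_le_trans _ _ _ Hw (Rmin_r _ _)).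
  assert (Hwm : Cmod z / 2 < Cmod w).
  { generalize (Cmod_triangle_rev z w). rewrite Cmod_minus_sym. lra. }
  assert (w <> RtoC 0). { apply Cmod_gt_0. lra. }
  replace (/ w - / z)%C with ((z - w) * / (w * z))%C by (field; auto).
  rewrite Cmod_mult, Cmod_inv, Cmod_mult, Cmod_minus_sym. 2: now apply Cmult_neq_0.
  apply Rmult_lt_reg_r with (Cmod w * Cmod z). nra.
  rewrite Rmult_assoc, Rinv_l. 2: nra. rewrite Rmult_1_r.
  assert (E1 : Cmod z / 2 * Cmod z < Cmod w * Cmod z) by (apply Rmult_lt_compat_r; lra).
  assert (E2 : eps * (Cmod z / 2 * Cmod z) < eps * (Cmod w * Cmod z)) by (apply Rmult_lt_compat_l; lra).
  nra.
Qed.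

(** Caratheodory's form of differentiability: the slope extends continuously to [z]. The sum,
    product and chain rules then reduce to continuity of slopes. *)
Lemma Cder_slope (f : C -> C) z l :
  Cder f z l <-> exists phi, Ccont phi z /\ phi z = l /\
    forall w, (f w - f z = phi w * (w - z))%C.
Proof.
  split.
  - intros H.
    exists (fun w => if Ceq_dec w z then l else ((f w - f z) / (w - z))%C). split; [|split].
    + intros eps He. destruct (H (eps/2)) as [d [Hd Hw]]. lra.
      exists d. split; auto. intros w Hwd.
      destruct (Ceq_dec z z) as [_|N]; [|now elim N].
      destruct (Ceq_dec w z) as [E|N]. now rewrite Cmod_self.
      assert (w - z <> RtoC 0)%C by now apply Cminus_eq_contra.
      replace ((f w - f z) / (w - z) - l)%C with ((f w - f z - l * (w - z)) / (w - z))%C by (field; auto).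
      rewrite Cmod_div by auto.
      assert (0 < Cmod (w - z)) by now apply Cmod_gt_0.
      apply Rle_lt_trans with (eps/2). 2: lra.
      apply Rmult_le_reg_r with (Cmod (w - z)); auto.
      unfold Rdiv at 1. rewrite Rmult_assoc, Rinv_l by lra. rewrite Rmult_1_r. now apply Hw.
    + destruct (Ceq_dec z z) as [_|N]; [auto|now elim N].
    + intros w. destruct (Ceq_dec w z) as [E|N]. rewrite E. ring.
      field. now apply Cminus_eq_contra.
  - intros [phi [Hc [El Hw]]] eps He.
    destruct (Hc eps He) as [d [Hd H]]. exists d. split; auto.
    intros w Hwd. rewrite Hw, <- El.
    replace (phi w * (w - z) - phi z * (w - z))%C with ((phi w - phi z) * (w - z))%C by ring.
    rewrite Cmod_mult. apply Rmult_le_compat_r. apply Cmod_ge_0. left. now apply H.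
Qed.

Lemma Cder_cont f z l : Cder f z l -> Ccont f z.
Proof.
  intros H. apply Cder_slope in H. destruct H as [phi [Hc [El Hw]]].
  assert (H : Ccont (fun w => f z + phi w * (w + - z))%C z).
  { apply Ccont_plus. apply Ccont_const. apply Ccont_mult; auto.
    apply Ccont_plus. apply Ccont_id. apply Ccont_const. }
  intros eps He. destruct (H eps He) as [d [Hd K]]. exists d. split; auto.
  intros w Hwd. specialize (K w Hwd). simpl in K.
  replace (f w - f z)%C with (f z + phi w * (w + - z) - (f z + phi z * (z + - z)))%C; auto.
  rewrite Hw. ring.
Qed.

Lemma Cder_const a z : Cder (fun _ => a) z (RtoC 0).
Proof.
  intros eps He. exists 1. split. lra. intros w _.
  replace (a - a - 0 * (w - z))%C with (RtoC 0) by ring. rewrite Cmod_0.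
  apply Rmult_le_pos. lra. apply Cmod_ge_0.
Qed.

Lemma Cder_id z : Cder (fun w => w) z (RtoC 1).
Proof.
  intros eps He. exists 1. split. lra. intros w _.
  replace (w - z - 1 * (w - z))%C with (RtoC 0) by ring. rewrite Cmod_0.
  apply Rmult_le_pos. lra. apply Cmod_ge_0.
Qed.

Lemma Cder_plus f g z a b : Cder f z a -> Cder g z b -> Cder (fun w => f w + g w)%C z (a + b)%C.
Proof.
  intros Hf Hg. apply Cder_slope in Hf. apply Cder_slope in Hg. apply Cder_slope.
  destruct Hf as [p [Hp [<- Ep]]]. destruct Hg as [q [Hq [<- Eq]]].
  exists (fun w => p w + q w)%C. split; [|split; [easy|]].
  - now apply Ccont_plus.
  - intros w. replace (f w + g w - (f z + g z))%C with ((f w - f z) + (g w - g z))%C by ring.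
    rewrite Ep, Eq. ring.
Qed.

Lemma Cder_mult f g z a b : Cder f z a -> Cder g z b ->
  Cder (fun w => f w * g w)%C z (a * g z + f z * b)%C.
Proof.
  intros Hf Hg. assert (Cg := Cder_cont _ _ _ Hg).
  apply Cder_slope in Hf. apply Cder_slope in Hg. apply Cder_slope.
  destruct Hf as [p [Hp [<- Ep]]]. destruct Hg as [q [Hq [<- Eq]]].
  exists (fun w => p w * g w + f z * q w)%C. split; [|split; [easy|]].
  - apply Ccont_plus; apply Ccont_mult; auto. apply Ccont_const.
  - intros w. replace (f w * g w - f z * g z)%C with ((f w - f z) * g w + f z * (g w - g z))%C by ring.
    rewrite Ep, Eq. ring.
Qed.

Lemma Cder_comp f g z a b : Cder g z b -> Cder f (g z) a ->
  Cder (fun w => f (g w)) z (a * b)%C.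
Proof.
  intros Hg Hf. assert (Cg := Cder_cont _ _ _ Hg).
  apply Cder_slope in Hf. apply Cder_slope in Hg. apply Cder_slope.
  destruct Hf as [p [Hp [<- Ep]]]. destruct Hg as [q [Hq [<- Eq]]].
  exists (fun w => p (g w) * q w)%C. split; [|split; [easy|]].
  - apply Ccont_mult; auto. apply (Ccont_comp p g); auto.
  - intros w. rewrite Ep, Eq. ring.
Qed.

Lemma Cder_inv z : z <> RtoC 0 -> Cder Cinv z (- / (z * z))%C.
Proof.
  intros Hz eps He.
  assert (P : 0 < Cmod z) by now apply Cmod_gt_0.
  destruct (Ccont_inv z Hz (eps * Cmod z)) as [d [Hd H]]. now apply Rmult_lt_0_compat.
  exists (Rmin d (Cmod z)). split. now apply Rmin_glb_lt.
  intros w Hw.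
  assert (H1 := H w (Rlt_le_trans _ _ _ Hw (Rmin_l _ _))).
  assert (H2 := Rlt_le_trans _ _ _ Hw (Rmin_r _ _)).
  assert (w <> RtoC 0).
  { intros E. rewrite E in H2. rewrite Cmod_minus_sym in H2.
    replace (z - 0)%C with z in H2 by ring. lra. }
  replace (/ w - / z - - / (z * z) * (w - z))%C with (- (/ w - / z) * / z * (w - z))%C by (field; auto).
  rewrite !Cmod_mult, Cmod_opp, Cmod_inv by auto.
  apply Rmult_le_compat_r. apply Cmod_ge_0.
  apply Rmult_le_reg_r with (Cmod z); auto. rewrite Rmult_assoc, Rinv_l; lra.
Qed.

Lemma Cder_ext_loc f g z l : (exists d, 0 < d /\ forall w, Cmod (w - z) < d -> f w = g w) ->
  Cder f z l -> Cder g z l.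
Proof.
  intros [d [Hd E]] H eps He. destruct (H eps He) as [d' [Hd' K]].
  exists (Rmin d d'). split. now apply Rmin_glb_lt.
  intros w Hw. rewrite <- (E w), <- (E z).
  - apply K. generalize (Rmin_r d d'). lra.
  - now rewrite Cmod_self.
  - generalize (Rmin_l d d'). lra.
Qed.

Lemma Cder_eq f z l l' : Cder f z l -> l = l' -> Cder f z l'.
Proof. now intros H <-. Qed.

Lemma Cder_ext f g z l : (forall w, f w = g w) -> Cder f z l -> Cder g z l.
Proof. intros E. apply Cder_ext_loc. exists 1. split. lra. auto. Qed.

Lemma Cder_opp f z a : Cder f z a -> Cder (fun w => - f w)%C z (- a)%C.
Proof.
  intros H. apply Cder_ext with (fun w => RtoC (-1) * f w)%C.
  - intros w. ring.
  - apply Cder_eq with (1 := Cder_mult _ _ _ _ _ (Cder_const (RtoC (-1)) z) H). ring.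
Qed.

Lemma Cder_minus f g z a b : Cder f z a -> Cder g z b -> Cder (fun w => f w - g w)%C z (a - b)%C.
Proof. intros Hf Hg. apply Cder_plus; auto. now apply Cder_opp. Qed.

Lemma Cder_scal k f z a : Cder f z a -> Cder (fun w => k * f w)%C z (k * a)%C.
Proof.
  intros H. apply Cder_eq with (1 := Cder_mult _ _ _ _ _ (Cder_const k z) H). ring.
Qed.

Lemma Cder_shift f z a b : Cder f (z + b)%C a -> Cder (fun w => f (w + b)%C) z a.
Proof.
  intros H.
  assert (K : Cder (fun w => w + b)%C z (RtoC 1)).
  { apply Cder_eq with (1 := Cder_plus _ _ _ _ _ (Cder_id z) (Cder_const b z)). ring. }
  apply Cder_eq with (1 := Cder_comp f _ z a _ K H). ring.
Qed.

Lemma ex_derive_Cder (f : C -> C) (z : C) :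
  @ex_derive C_AbsRing C_NormedModule f z <-> exists l, Cder f z l.
Proof.
  split.
  - intros [l [_ H]]. exists l. intros eps He.
    assert (Hlim : is_filter_lim (@locally (AbsRing_UniformSpace C_AbsRing) z) z) by (intros P HP; exact HP).
    destruct (H z Hlim (mkposreal eps He)) as [d Hd]. exists (pos d). split. apply cond_pos.
    intros w Hw. specialize (Hd w Hw).
    change (Cmod (f w - f z - (w - z) * l) <= eps * Cmod (w - z)) in Hd.
    now rewrite (Cmult_comm l).
  - intros [l H]. exists l. split. apply is_linear_scal_l.
    intros x Hx eps.
    assert (E : x = z).
    { apply (is_filter_lim_locally_unique (K := C_AbsRing) (V := AbsRing_NormedModule C_AbsRing)) in Hx. now symmetry. }
    subst x. destruct (H eps (cond_pos eps)) as [d [Hd K]]. exists (mkposreal d Hd).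
    intros w Hw. change (Cmod (f w - f z - (w - z) * l) <= eps * Cmod (w - z)).
    rewrite (Cmult_comm _ l). now apply K.
Qed.

(** * Goursat's theorem *)

Lemma nested_point (a b : nat -> R) :
  (forall n, a n <= a (S n)) -> (forall n, b (S n) <= b n) -> (forall n, a n <= b n) ->
  exists x, forall n, a n <= x <= b n.
Proof.
  intros Ha Hb Hab.
  assert (Ma : forall n m, (n <= m)%nat -> a n <= a m).
  { intros n m H. induction H. lra. specialize (Ha m). lra. }
  assert (Mb : forall n m, (n <= m)%nat -> b m <= b n).
  { intros n m H. induction H. lra. specialize (Hb m). lra. }
  assert (Mab : forall n m, a n <= b m).
  { intros n m. destruct (Nat.le_ge_cases n m) as [L|L].
    - specialize (Ma _ _ L). specialize (Hab m). lra.
    - specialize (Mb _ _ L). specialize (Hab n). lra. }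
  destruct (completeness (fun x => exists n, x = a n)) as [x [Hub Hl]].
  - exists (b O). intros x [n ->]. apply Mab.
  - exists (a O). now exists O.
  - exists x. intros n. split.
    + apply Hub. now exists n.
    + apply Hl. intros y [m ->]. apply Mab.
Qed.

Lemma pow_half_small (A d : R) : 0 < d -> exists n, A * (/2)^n < d.
Proof.
  intros Hd.
  destruct (Rle_dec A 0) as [L|L].
  - exists O. simpl. lra.
  - destruct (pow_lt_1_zero (/2)) with (y := d / A) as [N HN].
    + rewrite Rabs_pos_eq; lra.
    + apply Rdiv_lt_0_compat; lra.
    + exists N. specialize (HN N (le_n N)). rewrite Rabs_pos_eq in HN.
      * apply Rmult_lt_compat_l with (r := A) in HN. 2: lra.
        replace (A * (d / A)) with d in HN by (field; lra). lra.
      * apply pow_le. lra.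
Qed.

(** Keeps a quarter on which [Q] fails. The last one is the default: if [Q] holds on the other three
    but fails on the whole, the splitting hypothesis of [rectangle_bisection] makes it fail
    there. *)
Definition quarter (Q : R -> R -> R -> R -> Prop) (s : R*R*(R*R)) : R*R*(R*R) :=
  let '((a,b),(c,d)) := s in
  let m := (a+b)/2 in let p := (c+d)/2 in
  if excluded_middle_informative (Q a m c p) then
  if excluded_middle_informative (Q m b c p) then
  if excluded_middle_informative (Q a m p d) then ((m,b),(p,d))
  else ((a,m),(p,d)) else ((m,b),(c,p)) else ((a,m),(c,p)).

(** Compactness in bisection form: a counterexample yields nested failing rectangles that shrink to
    a point, where the local hypothesis applies. Serves both boundedness on squares and Goursat's
    theorem. *)
Lemma rectangle_bisection (Q : R -> R -> R -> R -> Prop) a b c d :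
  a <= b -> c <= d ->
  (forall a b c d, a <= b -> c <= d ->
    Q a ((a+b)/2) c ((c+d)/2) -> Q ((a+b)/2) b c ((c+d)/2) ->
    Q a ((a+b)/2) ((c+d)/2) d -> Q ((a+b)/2) b ((c+d)/2) d -> Q a b c d) ->
  (forall x y, a <= x <= b -> c <= y <= d -> exists e, 0 < e /\
     forall a' b' c' d', a <= a' <= x -> x <= b' <= b -> c <= c' <= y -> y <= d' <= d ->
       b' - a' < e -> d' - c' < e -> Q a' b' c' d') ->
  Q a b c d.
Proof.
  intros Hab Hcd Hsplit Hloc. apply NNPP. intros HN.
  set (s := fun n => Nat.iter n (quarter Q) ((a,b),(c,d))).
  set (sa := fun n => fst (fst (s n))). set (sb := fun n => snd (fst (s n))).
  set (sc := fun n => fst (snd (s n))). set (sd := fun n => snd (snd (s n))).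
  assert (Es : forall n, s n = ((sa n, sb n), (sc n, sd n))).
  { intros n. unfold sa, sb, sc, sd. now destruct (s n) as [[? ?] [? ?]]. }
  assert (I : forall n, sa n <= sb n /\ sc n <= sd n /\ ~ Q (sa n) (sb n) (sc n) (sd n) /\
     sb n - sa n = (b - a) * (/2)^n /\ sd n - sc n = (d - c) * (/2)^n).
  { induction n.
    - unfold sa, sb, sc, sd. simpl. repeat split; auto; lra.
    - destruct IHn as [I1 [I2 [I3 [I4 I5]]]].
      assert (E : s (S n) = quarter Q (s n)) by reflexivity.
      rewrite (Es n) in E. unfold quarter in E. rewrite (Es (S n)) in E. simpl pow.
      destruct excluded_middle_informative as [q1|q1];
      [destruct excluded_middle_informative as [q2|q2];
      [destruct excluded_middle_informative as [q3|q3]|]|];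
      injection E; intros -> -> -> ->; repeat split; auto; try lra.
      }
  assert (J : forall n, sa n <= sa (S n) /\ sb (S n) <= sb n /\ sc n <= sc (S n) /\ sd (S n) <= sd n).
  { intros n. destruct (I n) as [I1 [I2 _]].
      assert (E : s (S n) = quarter Q (s n)) by reflexivity.
      rewrite (Es n) in E. unfold quarter in E. rewrite (Es (S n)) in E.
      destruct excluded_middle_informative as [q1|q1];
      [destruct excluded_middle_informative as [q2|q2];
      [destruct excluded_middle_informative as [q3|q3]|]|];
      injection E; intros -> -> -> ->; repeat split; auto; try lra. }
  destruct (nested_point sa sb) as [x Hx]; try (intros n; apply (J n) || apply (I n)).
  destruct (nested_point sc sd) as [y Hy]; try (intros n; apply (J n) || apply (I n)).
  assert (B : forall n, a <= sa n /\ sb n <= b /\ c <= sc n /\ sd n <= d).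
  { induction n. unfold sa, sb, sc, sd; simpl; lra. specialize (J n). lra. }
  destruct (Hloc x y) as [e [He HQ]].
  - generalize (B O) (Hx O). lra.
  - generalize (B O) (Hy O). lra.
  - destruct (pow_half_small ((b - a) + (d - c)) e He) as [n Hn].
    destruct (I n) as [I1 [I2 [I3 [I4 I5]]]]. apply I3.
    assert (0 < (/2)^n) by (apply pow_lt; lra).
    generalize (B n) (Hx n) (Hy n). intros. apply HQ; try lra; nra.
Qed.

Lemma continuous_bounded_square (f : C -> C) (S : R) : (forall z, Ccont f z) -> 0 <= S ->
  exists M, forall z, Rabs (fst z) <= S -> Rabs (snd z) <= S -> Cmod (f z) <= M.
Proof.
  intros Hf HS.
  destruct (rectangle_bisection (fun a b c d => exists M, forall x y, a <= x <= b -> c <= y <= d ->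
    Cmod (f (x,y)) <= M) (-S) S (-S) S) as [M HM]; try lra.
  - intros a b c d H1 H2 [M1 K1] [M2 K2] [M3 K3] [M4 K4].
    exists (Rmax (Rmax M1 M2) (Rmax M3 M4)). intros x y Hx Hy.
    destruct (Rle_dec x ((a+b)/2)); destruct (Rle_dec y ((c+d)/2)).
    + apply Rle_trans with M1. apply K1; lra. apply Rle_trans with (Rmax M1 M2); apply Rmax_l.
    + apply Rle_trans with M3. apply K3; lra. apply Rle_trans with (Rmax M3 M4). apply Rmax_l. apply Rmax_r.
    + apply Rle_trans with M2. apply K2; lra. apply Rle_trans with (Rmax M1 M2). apply Rmax_r. apply Rmax_l.
    + apply Rle_trans with M4. apply K4; lra. apply Rle_trans with (Rmax M3 M4); apply Rmax_r.
  - intros x y _ _. destruct (Hf (x,y) 1) as [d [Hd K]]. lra.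
    exists (d/2). split. lra. intros a' b' c' d' Ha Hb Hc Hd' H1 H2.
    exists (Cmod (f (x,y)) + 1). intros u v Hu Hv.
    assert (Cmod ((u,v) - (x,y)) < d).
    { eapply Rle_lt_trans. apply Cmod_le_re_im. simpl.
      assert (Rabs (u + - x) < d/2) by (apply Rabs_def1; lra).
      assert (Rabs (v + - y) < d/2) by (apply Rabs_def1; lra). lra. }
    specialize (K _ H). generalize (Cmod_triangle_rev (f (u,v)) (f (x,y))). lra.
  - exists M. intros [x y] Hx Hy. simpl in *. apply HM; apply Rabs_le_between; auto.
Qed.

Lemma continuous_bounded_disc (f : C -> C) (S : R) : (forall z, Ccont f z) ->
  exists M, 0 < M /\ forall z, Cmod z <= S -> Cmod (f z) <= M.
Proof.
  intros Hf. destruct (continuous_bounded_square f (Rabs S) Hf (Rabs_pos _)) as [M HM].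
  exists (Rmax 1 M). split. generalize (Rmax_l 1 M); lra.
  intros z Hz. apply Rle_trans with M. 2: apply Rmax_r.
  apply HM; eapply Rle_trans; try apply re_le_mod; try apply im_le_mod; generalize (Rle_abs S); lra.
Qed.

(** * Integrals of complex-valued functions of a real variable *)

Definition cts (k : R -> C) (t : R) : Prop :=
  continuous (fun s => fst (k s)) t /\ continuous (fun s => snd (k s)) t.

Definition CInt (k : R -> C) (a b : R) : C :=
  (RInt (fun t => fst (k t)) a b, RInt (fun t => snd (k t)) a b).

Definition Rder (k : R -> C) (t : R) (l : C) : Prop :=
  is_derive (fun s => fst (k s)) t (fst l) /\ is_derive (fun s => snd (k s)) t (snd l).

Lemma continuous_eps (f : R -> R) x : continuous f x <->
  forall eps, 0 < eps -> exists d, 0 < d /\ forall y, Rabs (y - x) < d -> Rabs (f y - f x) < eps.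
Proof.
  split.
  - intros H eps He.
    destruct (proj1 (filterlim_locally f (f x)) H (mkposreal eps He)) as [d Hd].
    exists d. split. apply cond_pos. intros y Hy. apply (Hd y Hy).
  - intros H. apply filterlim_locally. intros eps.
    destruct (H eps (cond_pos eps)) as [d [Hd K]]. exists (mkposreal d Hd). intros y Hy. now apply K.
Qed.

Lemma cts_comp (F : C -> C) (k : R -> C) t : Ccont F (k t) -> cts k t -> cts (fun s => F (k s)) t.
Proof.
  intros HF [H1 H2].
  assert (K : forall eps, 0 < eps -> exists d, 0 < d /\ forall s, Rabs (s - t) < d ->
    Cmod (F (k s) - F (k t)) < eps).
  { intros eps He. destruct (HF eps He) as [d [Hd K]].
    destruct (proj1 (continuous_eps _ _) H1 (d/2)) as [d1 [Hd1 K1]]. lra.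
    destruct (proj1 (continuous_eps _ _) H2 (d/2)) as [d2 [Hd2 K2]]. lra.
    exists (Rmin d1 d2). split. now apply Rmin_glb_lt. intros s Hs. apply K.
    specialize (K1 s ltac:(generalize (Rmin_l d1 d2); lra)).
    specialize (K2 s ltac:(generalize (Rmin_r d1 d2); lra)).
    eapply Rle_lt_trans. apply Cmod_le_re_im. simpl. unfold Rminus in *. lra. }
  split; apply continuous_eps; intros eps He; destruct (K eps He) as [d [Hd K']];
    exists d; split; auto; intros s Hs; specialize (K' s Hs); eapply Rle_lt_trans; try exact K'.
  - apply (re_le_mod (F (k s) - F (k t))).
  - apply (im_le_mod (F (k s) - F (k t))).
Qed.

Lemma cts_const a t : cts (fun _ => a) t.
Proof. split; apply continuous_const. Qed.

Lemma cts_plus k h t : cts k t -> cts h t -> cts (fun s => k s + h s)%C t.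
Proof. intros [A B] [D E]. split; simpl; now apply (continuous_plus (V := R_NormedModule)). Qed.

Lemma cts_mult k h t : cts k t -> cts h t -> cts (fun s => k s * h s)%C t.
Proof.
  intros [A B] [D E]. split; simpl.
  - apply (continuous_minus (V := R_NormedModule)); now apply (continuous_mult (K := R_AbsRing)).
  - apply (continuous_plus (V := R_NormedModule)); now apply (continuous_mult (K := R_AbsRing)).
Qed.

Lemma cts_minus k h t : cts k t -> cts h t -> cts (fun s => k s - h s)%C t.
Proof. intros [A B] [D E]. split; simpl; now apply (continuous_minus (V := R_NormedModule)). Qed.

Lemma cts_conj k t : cts k t -> cts (fun t => Cconj (k t)) t.
Proof. intros [A B]. split; simpl; auto. now apply (continuous_opp (V := R_NormedModule)). Qed.

Lemma cts_Cmod k t : cts k t -> continuous (fun s => Cmod (k s)) t.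
Proof.
  intros [A B]. unfold Cmod. apply continuous_comp. 2: apply continuous_sqrt.
  apply (continuous_plus (V := R_NormedModule)); simpl.
  - apply (continuous_mult (K := R_AbsRing)); auto.
    apply (continuous_mult (K := R_AbsRing)); auto. apply continuous_const.
  - apply (continuous_mult (K := R_AbsRing)); auto.
    apply (continuous_mult (K := R_AbsRing)); auto. apply continuous_const.
Qed.

Lemma ex_RInt_cont (f : R -> R) a b : (forall t, continuous f t) -> ex_RInt f a b.
Proof. intros H. apply (ex_RInt_continuous (V := R_CompleteNormedModule)). auto. Qed.

Lemma cts_ex k a b : (forall t, cts k t) ->
  ex_RInt (fun t => fst (k t)) a b /\ ex_RInt (fun t => snd (k t)) a b.
Proof. intros H. split; apply ex_RInt_cont; intros t; apply (H t). Qed.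

Lemma CInt_plus k h a b : (forall t, cts k t) -> (forall t, cts h t) ->
  CInt (fun t => k t + h t)%C a b = (CInt k a b + CInt h a b)%C.
Proof.
  intros Hk Hh. destruct (cts_ex k a b Hk). destruct (cts_ex h a b Hh).
  unfold CInt, Cplus. simpl. f_equal; now apply (RInt_plus (V := R_CompleteNormedModule)).
Qed.

Lemma CInt_scal (l : C) k a b : (forall t, cts k t) ->
  CInt (fun t => l * k t)%C a b = (l * CInt k a b)%C.
Proof.
  intros Hk. destruct (cts_ex k a b Hk) as [E1 E2].
  unfold CInt, Cmult. simpl.
  assert (S1 : forall m, RInt (fun t => m * fst (k t)) a b = m * RInt (fun t => fst (k t)) a b).
  { intros m. now apply (RInt_scal (V := R_CompleteNormedModule)). }
  assert (S2 : forall m, RInt (fun t => m * snd (k t)) a b = m * RInt (fun t => snd (k t)) a b).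
  { intros m. now apply (RInt_scal (V := R_CompleteNormedModule)). }
  assert (X1 : forall m, ex_RInt (fun t => m * fst (k t)) a b).
  { intros m. now apply (ex_RInt_scal (V := R_NormedModule)). }
  assert (X2 : forall m, ex_RInt (fun t => m * snd (k t)) a b).
  { intros m. now apply (ex_RInt_scal (V := R_NormedModule)). }
  f_equal.
  - rewrite <- S1, <- S2. now apply (RInt_minus (V := R_CompleteNormedModule)).
  - rewrite <- S1, <- S2. now apply (RInt_plus (V := R_CompleteNormedModule)).
Qed.

Lemma CInt_minus k h a b : (forall t, cts k t) -> (forall t, cts h t) ->
  CInt (fun t => k t - h t)%C a b = (CInt k a b - CInt h a b)%C.
Proof.
  intros Hk Hh. destruct (cts_ex k a b Hk). destruct (cts_ex h a b Hh).
  unfold CInt, Cminus, Cplus, Copp. simpl. f_equal; now apply (RInt_minus (V := R_CompleteNormedModule)).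
Qed.

Lemma CInt_Chasles k a b c : (forall t, cts k t) ->
  CInt k a c = (CInt k a b + CInt k b c)%C.
Proof.
  intros Hk. destruct (cts_ex k a b Hk). destruct (cts_ex k b c Hk).
  unfold CInt, Cplus. simpl. f_equal; symmetry; now apply (RInt_Chasles (V := R_CompleteNormedModule)).
Qed.

Lemma CInt_swap k a b : (forall t, cts k t) -> CInt k a b = (- CInt k b a)%C.
Proof.
  intros Hk. destruct (cts_ex k a b Hk). destruct (cts_ex k b a Hk).
  unfold CInt, Copp. simpl.
  f_equal; symmetry; now apply (opp_RInt_swap (V := R_CompleteNormedModule)).
Qed.

Lemma CInt_ext k h a b : (forall t, k t = h t) -> CInt k a b = CInt h a b.
Proof. intros E. replace h with k; auto. now apply functional_extensionality. Qed.

Lemma CInt_const v a b : CInt (fun _ => v) a b = (RtoC (b - a) * v)%C.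
Proof.
  unfold CInt, Cmult, RtoC. simpl. rewrite !RInt_const. unfold scal; simpl; unfold mult; simpl.
  f_equal; ring.
Qed.

(** With [v] the integral, [|v|^2] is the integral of the real part of [Cconj v * k t], so
    monotonicity of the real integral applies. *)
Lemma CInt_bound_le k a b M : (forall t, cts k t) -> a <= b ->
  (forall t, a <= t <= b -> Cmod (k t) <= M) -> Cmod (CInt k a b) <= M * (b - a).
Proof.
  intros Hk Hab HM. set (v := CInt k a b).
  assert (E : Cmod v * Cmod v = RInt (fun t => fst (Cconj v * k t)%C) a b).
  { change (RInt (fun t => fst (Cconj v * k t)%C) a b) with (fst (CInt (fun t => Cconj v * k t)%C a b)).
    rewrite CInt_scal by auto. fold v.
    replace (Cmod v * Cmod v) with (Cmod v ^ 2) by ring. rewrite Cmod2_alt. unfold Re, Im. simpl. ring. }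
  destruct (Req_dec (Cmod v) 0) as [Z|N].
  { rewrite Z. apply Rmult_le_pos. 2: lra. apply Rle_trans with (Cmod (k a)). apply Cmod_ge_0. apply HM. lra. }
  assert (P : 0 < Cmod v) by (generalize (Cmod_ge_0 v); lra).
  apply Rmult_le_reg_l with (Cmod v); auto. rewrite E.
  replace (Cmod v * (M * (b - a))) with (RInt (fun _ => Cmod v * M) a b).
  2: { rewrite RInt_const. unfold scal; simpl; unfold mult; simpl. ring. }
  assert (Hc : forall t, cts (fun t => Cconj v * k t)%C t).
  { intros t. apply cts_mult; auto. apply cts_const. }
  apply RInt_le; auto.
  - apply ex_RInt_cont. intros t. apply (Hc t).
  - apply ex_RInt_const.
  - intros t Ht. apply Rle_trans with (1 := Rle_abs _).
    apply Rle_trans with (1 := re_le_mod _). rewrite Cmod_mult, Cmod_conj.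
    apply Rmult_le_compat_l. lra. apply HM. lra.
Qed.

Lemma CInt_bound k a b M : (forall t, cts k t) ->
  (forall t, Rmin a b <= t <= Rmax a b -> Cmod (k t) <= M) -> Cmod (CInt k a b) <= M * Rabs (b - a).
Proof.
  intros Hk HM. destruct (Rle_dec a b) as [L|L].
  - rewrite Rabs_pos_eq by lra. apply CInt_bound_le; auto. intros t Ht. apply HM.
    rewrite Rmin_left, Rmax_right; lra.
  - rewrite CInt_swap by auto. rewrite Cmod_opp, Rabs_minus_sym, Rabs_pos_eq by lra.
    apply CInt_bound_le; auto. lra. intros t Ht. apply HM.
    rewrite Rmin_right, Rmax_left; lra.
Qed.

Lemma CInt_FTC Phi k a b : (forall t, Rder Phi t (k t)) -> (forall t, cts k t) ->
  CInt k a b = (Phi b - Phi a)%C.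
Proof.
  intros Hd Hk. unfold CInt, Cminus, Cplus, Copp. simpl. f_equal.
  - apply is_RInt_unique. apply (is_RInt_derive (fun t => fst (Phi t)) (fun t => fst (k t))).
    intros t _; exact (proj1 (Hd t)). intros t _; exact (proj1 (Hk t)).
  - apply is_RInt_unique. apply (is_RInt_derive (fun t => snd (Phi t)) (fun t => snd (k t))).
    intros t _; exact (proj2 (Hd t)). intros t _; exact (proj2 (Hk t)).
Qed.

Lemma Rder_eps (k : R -> C) t l :
  (forall eps, 0 < eps -> exists d, 0 < d /\ forall s, Rabs (s - t) < d ->
    Cmod (k s - k t - l * RtoC (s - t)) <= eps * Rabs (s - t)) -> Rder k t l.
Proof.
  intros H. split; (split; [apply (is_linear_scal_l (K := R_AbsRing))|]);
    intros x Hx eps;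
    apply (is_filter_lim_locally_unique (K := R_AbsRing) (V := AbsRing_NormedModule R_AbsRing)) in Hx;
    subst x; destruct (H eps (cond_pos eps)) as [d [Hd K]]; exists (mkposreal d Hd); intros s Hs;
    specialize (K s Hs); (eapply Rle_trans; [|exact K]).
  - apply Rle_trans with (2 := re_le_mod _). simpl. right. unfold norm, minus, plus, opp, scal; simpl.
    unfold abs, mult; simpl. f_equal. ring.
  - apply Rle_trans with (2 := im_le_mod _). simpl. right. unfold norm, minus, plus, opp, scal; simpl.
    unfold abs, mult; simpl. f_equal. ring.
Qed.

Lemma Cder_line Phi z v t l : Cder Phi (z + RtoC t * v)%C l ->
  Rder (fun s => Phi (z + RtoC s * v)%C) t (l * v)%C.
Proof.
  intros H. apply Rder_eps. intros eps He.
  set (V := Cmod v + 1). assert (HV : 1 <= V) by (unfold V; generalize (Cmod_ge_0 v); lra).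
  destruct (H (eps / V)) as [d [Hd K]]. apply Rdiv_lt_0_compat; lra.
  exists (d / V). split. apply Rdiv_lt_0_compat; lra. intros s Hs.
  specialize (K (z + RtoC s * v)%C).
  replace (z + RtoC s * v - (z + RtoC t * v))%C with (RtoC (s - t) * v)%C in K.
  2: { rewrite RtoC_minus. ring. }
  assert (E : Cmod (RtoC (s - t) * v) <= Rabs (s - t) * V).
  { rewrite Cmod_mult, Cmod_R. apply Rmult_le_compat_l. apply Rabs_pos. unfold V; lra. }
  assert (E' : Rabs (s - t) * V < d).
  { apply Rmult_lt_compat_r with (r := V) in Hs. 2: lra. unfold Rdiv in Hs. rewrite Rmult_assoc, Rinv_l in Hs; lra. }
  specialize (K ltac:(lra)).
  replace (l * v * RtoC (s - t))%C with (l * (RtoC (s - t) * v))%C by ring.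
  eapply Rle_trans. exact K.
  apply Rle_trans with (eps / V * (Rabs (s - t) * V)).
  - apply Rmult_le_compat_l; auto. left. apply Rdiv_lt_0_compat; lra.
  - right. field. lra.
Qed.

Lemma Ccont_pair_h (G : C -> C) y : (forall z, Ccont G z) -> forall t, cts (fun s => G (s, y)) t.
Proof.
  intros HG t. apply (cts_comp G (fun s => (s, y))); auto. split; simpl. apply continuous_id. apply continuous_const.
Qed.

Lemma Ccont_pair_v (G : C -> C) x : (forall z, Ccont G z) -> forall t, cts (fun s => G (x, s)) t.
Proof.
  intros HG t. apply (cts_comp G (fun s => (x, s))); auto. split; simpl. apply continuous_const. apply continuous_id.
Qed.

(** The contour integral of [G] around the rectangle, counterclockwise. *)
Definition rect_int (G : C -> C) (a b c d : R) : C :=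
  (CInt (fun s => G (s, c)) a b - CInt (fun s => G (s, d)) a b
   + Ci * (CInt (fun s => G (b, s)) c d - CInt (fun s => G (a, s)) c d))%C.

Lemma rect_int_minus (G H : C -> C) a b c d : (forall z, Ccont G z) -> (forall z, Ccont H z) ->
  rect_int (fun z => G z - H z)%C a b c d = (rect_int G a b c d - rect_int H a b c d)%C.
Proof.
  intros HG HH. unfold rect_int.
  assert (Kh : forall y, CInt (fun s => G (s, y) - H (s, y))%C a b =
    (CInt (fun s => G (s, y)) a b - CInt (fun s => H (s, y)) a b)%C).
  { intros y. exact (CInt_minus _ _ a b (Ccont_pair_h G y HG) (Ccont_pair_h H y HH)). }
  assert (Kv : forall x, CInt (fun s => G (x, s) - H (x, s))%C c d =
    (CInt (fun s => G (x, s)) c d - CInt (fun s => H (x, s)) c d)%C).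
  { intros x. exact (CInt_minus _ _ c d (Ccont_pair_v G x HG) (Ccont_pair_v H x HH)). }
  rewrite (Kh c), (Kh d), (Kv a), (Kv b). ring.
Qed.

Lemma rect_int_affine (u v : C) a b c d : rect_int (fun z => u + v * z)%C a b c d = RtoC 0.
Proof.
  unfold rect_int.
  assert (H : forall y, CInt (fun s => u + v * (s, y))%C a b =
     (RtoC (b - a) * (u + v * (Ci * RtoC y)) + v * RtoC ((b*b - a*a)/2))%C).
  { intros y. rewrite (CInt_FTC (fun s => RtoC s * (u + v * (Ci * RtoC y)) + v * RtoC (s*s/2))%C).
    - rewrite !RtoC_minus. replace ((b*b-a*a)/2) with (b*b/2 - a*a/2) by field. rewrite RtoC_minus. ring.
    - intros t. destruct u as [u1 u2], v as [v1 v2]. split; simpl; auto_derive; auto; field.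
    - intros t. apply cts_plus. apply cts_const. apply cts_mult. apply cts_const.
      split; simpl. apply continuous_id. apply continuous_const. }
  assert (K : forall x, CInt (fun s => u + v * (x, s))%C c d =
     (RtoC (d - c) * (u + v * RtoC x) + v * Ci * RtoC ((d*d - c*c)/2))%C).
  { intros x. rewrite (CInt_FTC (fun s => RtoC s * (u + v * RtoC x) + v * Ci * RtoC (s*s/2))%C).
    - rewrite !RtoC_minus. replace ((d*d-c*c)/2) with (d*d/2 - c*c/2) by field. rewrite RtoC_minus. ring.
    - intros t. destruct u as [u1 u2], v as [v1 v2]. split; simpl; auto_derive; auto; field.
    - intros t. apply cts_plus. apply cts_const. apply cts_mult. apply cts_const.
      split; simpl. apply continuous_const. apply continuous_id. }
  rewrite !H, !K, !RtoC_minus. ring.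
Qed.

Lemma rect_int_bound (G : C -> C) a b c d M : (forall z, Ccont G z) -> a <= b -> c <= d ->
  (forall x y, a <= x <= b -> c <= y <= d -> Cmod (G (x,y)) <= M) ->
  Cmod (rect_int G a b c d) <= 2 * M * ((b - a) + (d - c)).
Proof.
  intros HG Hab Hcd HM. unfold rect_int.
  eapply Rle_trans. apply Cmod_triangle. rewrite Cmod_mult, Cmod_Ci, Rmult_1_l.
  assert (H1 : forall y, c <= y <= d -> Cmod (CInt (fun s => G (s, y)) a b) <= M * (b - a)).
  { intros y Hy. apply CInt_bound_le; auto. now apply Ccont_pair_h. }
  assert (H2 : forall x, a <= x <= b -> Cmod (CInt (fun s => G (x, s)) c d) <= M * (d - c)).
  { intros y Hy. apply CInt_bound_le; auto. now apply Ccont_pair_v. }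
  generalize (Cmod_triangle_minus (CInt (fun s => G (s, c)) a b) (CInt (fun s => G (s, d)) a b))
    (Cmod_triangle_minus (CInt (fun s => G (b, s)) c d) (CInt (fun s => G (a, s)) c d)).
  generalize (H1 c) (H1 d) (H2 a) (H2 b). lra.
Qed.

(** A bound quadratic in the half-perimeter survives bisection: each quarter has half of it, so four
    quarters add up to [eps * S^2] again. Differentiability is asked on a half-plane because
    [circle_mean] applies this to a function truncated beyond a vertical line. *)
Lemma goursat (G : C -> C) (x0 a b c d : R) : (forall z, Ccont G z) ->
  (forall z, fst z < x0 -> exists l, Cder G z l) -> a <= b -> b < x0 -> c <= d ->
  rect_int G a b c d = RtoC 0.
Proof.
  intros HG HD Hab Hb Hcd. apply Cmod_eq_0. apply Rle_antisym. 2: apply Cmod_ge_0.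
  set (S := (b - a) + (d - c)).
  assert (K : forall eps, 0 < eps -> Cmod (rect_int G a b c d) <= eps * S^2).
  { intros eps He. unfold S.
    apply (rectangle_bisection (fun a b c d => Cmod (rect_int G a b c d) <= eps * ((b-a)+(d-c))^2)); auto.
    - clear - HG. intros a b c d Hab Hcd Q1 Q2 Q3 Q4. set (m := (a+b)/2) in *. set (p := (c+d)/2) in *.
      replace (rect_int G a b c d) with
       (rect_int G a m c p + rect_int G m b c p + (rect_int G a m p d + rect_int G m b p d))%C.
      + eapply Rle_trans. apply Cmod_triangle.
        eapply Rle_trans. apply Rplus_le_compat; apply Cmod_triangle.
        apply Rle_trans with (4 * (eps * (((b-a)+(d-c))/2)^2)). 2: right; field.
        replace (m - a + (p - c)) with (((b-a)+(d-c))/2) in Q1 by (unfold m, p; field).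
        replace (b - m + (p - c)) with (((b-a)+(d-c))/2) in Q2 by (unfold m, p; field).
        replace (m - a + (d - p)) with (((b-a)+(d-c))/2) in Q3 by (unfold m, p; field).
        replace (b - m + (d - p)) with (((b-a)+(d-c))/2) in Q4 by (unfold m, p; field).
        lra.
      + unfold rect_int.
        rewrite (CInt_Chasles (fun s => G (s, c)) a m b) by now apply Ccont_pair_h.
        rewrite (CInt_Chasles (fun s => G (s, d)) a m b) by now apply Ccont_pair_h.
        rewrite (CInt_Chasles (fun s => G (b, s)) c p d) by now apply Ccont_pair_v.
        rewrite (CInt_Chasles (fun s => G (a, s)) c p d) by now apply Ccont_pair_v.
        ring.
    - intros x y Hx Hy. destruct (HD (x,y)) as [l Hl]. simpl; lra.
      destruct (Hl (eps/2)) as [e [He' K]]. lra.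
      exists (e/2). split. lra. intros a' b' c' d' Ha' Hb' Hc' Hd' Hba Hdc.
      set (T := (b' - a') + (d' - c')).
      assert (HA : forall z, Ccont (fun z => (G (x,y) - l * (x,y)) + l * z)%C z).
      { intros z. apply Ccont_plus. apply Ccont_const. apply Ccont_mult. apply Ccont_const. apply Ccont_id. }
      (* Affine maps have zero contour integral, so subtracting the tangent map leaves only the
         error of differentiability, at most [eps / 2 * T] on a rectangle of half-perimeter [T]. *)
      assert (E : rect_int G a' b' c' d' = rect_int (fun z => G z - ((G (x,y) - l * (x,y)) + l * z))%C a' b' c' d').
      { rewrite (rect_int_minus G (fun z => (G (x,y) - l * (x,y)) + l * z)%C), rect_int_affine by auto. ring. }
      rewrite E.
      eapply Rle_trans. apply rect_int_bound with (M := eps / 2 * T); try lra.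
      + intros z. now apply Ccont_minus.
      + intros u v Hu Hv.
        assert (L : Cmod ((u,v) - (x,y)) <= T).
        { eapply Rle_trans. apply Cmod_le_re_im. simpl. unfold T.
          apply Rplus_le_compat; apply Rabs_le; lra. }
        specialize (K (u,v) ltac:(unfold T in *; lra)).
        replace (G (u, v) - (G (x, y) - l * (x, y) + l * (u, v)))%C with (G (u,v) - G (x,y) - l * ((u,v) - (x,y)))%C by ring.
        eapply Rle_trans. exact K. apply Rmult_le_compat_l; lra.
      + fold T. right. field. }
  assert (HS : 0 <= S) by (unfold S; lra).
  apply le_epsilon. intros eps He. rewrite Rplus_0_l.
  eapply Rle_trans. apply (K (eps / (S^2 + 1))). apply Rdiv_lt_0_compat; nra.
  apply Rmult_le_reg_r with (S^2+1). nra.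
  replace (eps / (S ^ 2 + 1) * S ^ 2 * (S ^ 2 + 1)) with (eps * S^2) by (field; nra). nra.
Qed.

(** * The exponential and circle means *)

(** The corners are left unordered because the path defining a primitive may run left or
    downwards. *)
Lemma goursat_any (G : C -> C) (a b c d : R) : (forall z, exists l, Cder G z l) ->
  rect_int G a b c d = RtoC 0.
Proof.
  intros HD.
  assert (HG : forall z, Ccont G z). { intros z. destruct (HD z) as [l Hl]. now apply Cder_cont in Hl. }
  assert (K : forall a b c d, a <= b -> c <= d -> rect_int G a b c d = RtoC 0).
  { intros. apply (goursat G (b0 + 1)); auto; lra. }
  assert (Sx : forall a b c d, rect_int G a b c d = (- rect_int G b a c d)%C).
  { intros. unfold rect_int. rewrite (CInt_swap _ a0 b0), (CInt_swap _ a0 b0); try (now apply Ccont_pair_h). ring. }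
  assert (Sy : forall a b c d, rect_int G a b c d = (- rect_int G a b d c)%C).
  { intros. unfold rect_int. rewrite (CInt_swap _ c0 d0), (CInt_swap _ c0 d0); try (now apply Ccont_pair_v). ring. }
  destruct (Rle_dec a b); destruct (Rle_dec c d).
  - now apply K.
  - rewrite Sy, K by lra. ring.
  - rewrite Sx, K by lra. ring.
  - rewrite Sx, Sy, K by lra. ring.
Qed.

(** The primitive integrates along the real axis, then vertically. Goursat's theorem replaces the
    increment of this L-shaped path by one short horizontal and one short vertical step near the
    point. *)
Lemma entire_primitive (G : C -> C) : (forall z, exists l, Cder G z l) ->
  exists Phi, forall z, Cder Phi z (G z).
Proof.
  intros HD.
  assert (HG : forall z, Ccont G z). { intros z. destruct (HD z) as [l Hl]. now apply Cder_cont in Hl. }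
  exists (fun z => CInt (fun s => G (s, 0)) 0 (fst z) + Ci * CInt (fun t => G (fst z, t)) 0 (snd z))%C.
  intros [x y] eps He. destruct (HG (x,y) (eps/2)) as [d [Hd K]]. lra.
  exists d. split; auto. intros [x' y'] Hw. simpl fst; simpl snd.
  assert (Hh := Ccont_pair_h G). assert (Hv := Ccont_pair_v G).
  assert (E : (CInt (fun s => G (s, 0%R)) 0 x' + Ci * CInt (fun t => G (x', t)) 0 y' -
    (CInt (fun s => G (s, 0%R)) 0 x + Ci * CInt (fun t => G (x, t)) 0 y) - G (x,y) * ((x',y') - (x,y)))%C =
    (CInt (fun s => G (s, y) - G (x,y))%C x x' + Ci * CInt (fun t => G (x',t) - G (x,y))%C y y')%C).
  { rewrite !CInt_minus, !CInt_const; auto; try (intros; apply cts_const).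
    rewrite (CInt_Chasles (fun s => G (s, 0)) 0 x x') by auto.
    rewrite (CInt_Chasles (fun s => G (x', s)) 0 y y') by auto.
    generalize (goursat_any G x x' 0 y HD). unfold rect_int. intros E0.
    replace ((x',y') - (x,y))%C with (RtoC (x' - x) + Ci * RtoC (y' - y))%C.
    2:{ unfold Cminus, Cplus, Copp, Ci, Cmult, RtoC; simpl; f_equal; ring. }
    match type of E0 with (?p - ?q + Ci * (?r - ?s) = _)%C => set (P := p) in *; set (Q := q) in *; set (Rr := r) in *; set (Ss := s) in * end.
    apply Ceq_minus. ring_simplify. transitivity (P - Q + Ci * (Rr - Ss))%C. ring. exact E0. }
  rewrite E. clear E.
  assert (Hx : Rabs (x' - x) <= Cmod ((x',y') - (x,y))) by apply (re_le_mod ((x',y') - (x,y))).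
  assert (Hy : Rabs (y' - y) <= Cmod ((x',y') - (x,y))) by apply (im_le_mod ((x',y') - (x,y))).
  eapply Rle_trans. apply Cmod_triangle. rewrite Cmod_mult, Cmod_Ci, Rmult_1_l.
  assert (Hnear : forall u v, Rabs (u - x) <= Rabs (x' - x) -> Rabs (v - y) <= Rabs (y' - y) ->
    Cmod (G (u,v) - G (x,y)) <= eps / 2).
  { intros u v Hu Hv'. left. apply K. eapply Rle_lt_trans; [|exact Hw].
    apply Cmod_le_comp; simpl; auto. }
  assert (B1 : Cmod (CInt (fun s => G (s, y) - G (x,y))%C x x') <= eps/2 * Rabs (x' - x)).
  { apply CInt_bound.
    - intros t. apply cts_minus; auto. apply cts_const.
    - intros t Ht. apply Hnear. 2: replace (y - y) with 0 by ring; rewrite Rabs_R0; apply Rabs_pos.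
      revert Ht. unfold Rmin, Rmax. destruct (Rle_dec x x'); intros; unfold Rabs; repeat destruct Rcase_abs; lra. }
  assert (B2 : Cmod (CInt (fun s => G (x', s) - G (x,y))%C y y') <= eps/2 * Rabs (y' - y)).
  { apply CInt_bound.
    - intros t. apply cts_minus; auto. apply cts_const.
    - intros t Ht. apply Hnear. lra.
      revert Ht. unfold Rmin, Rmax. destruct (Rle_dec y y'); intros; unfold Rabs; repeat destruct Rcase_abs; lra. }
  nra.
Qed.

(** * The complex exponential and points of the unit circle *)

Definition Cexp (z : C) : C := (exp (fst z) * cos (snd z), exp (fst z) * sin (snd z)).
Definition cis (t : R) : C := (cos t, sin t).

Lemma Cexp_plus z w : Cexp (z + w) = (Cexp z * Cexp w)%C.
Proof.
  destruct z as [a b], w as [c d]. unfold Cexp, Cplus, Cmult; simpl.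
  rewrite exp_plus, cos_plus, sin_plus. f_equal; ring.
Qed.

Lemma Cexp_0 : Cexp 0 = RtoC 1.
Proof. unfold Cexp, RtoC; simpl. rewrite exp_0, cos_0, sin_0. f_equal; ring. Qed.

Lemma Cmod_cis t : Cmod (cis t) = 1.
Proof.
  unfold Cmod, cis; simpl. replace (cos t * (cos t * 1) + sin t * (sin t * 1)) with 1. apply sqrt_1.
  generalize (sin2_cos2 t). unfold Rsqr. lra.
Qed.

Lemma Cexp_polar z : Cexp z = (RtoC (exp (fst z)) * cis (snd z))%C.
Proof. unfold Cexp, cis, Cmult, RtoC; simpl. f_equal; ring. Qed.

Lemma Cmod_Cexp z : Cmod (Cexp z) = exp (fst z).
Proof.
  rewrite Cexp_polar, Cmod_mult, Cmod_cis, Cmod_R, Rabs_pos_eq. ring. left; apply exp_pos.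
Qed.

Lemma Cexp_neq_0 z : Cexp z <> RtoC 0.
Proof. apply Cmod_gt_0. rewrite Cmod_Cexp. apply exp_pos. Qed.

Lemma Cexp_opp z : (Cexp (- z) * Cexp z)%C = RtoC 1.
Proof. rewrite <- Cexp_plus. replace (- z + z)%C with (RtoC 0) by ring. apply Cexp_0. Qed.

Lemma cis_plus s t : cis (s + t) = (cis s * cis t)%C.
Proof. unfold cis, Cmult; simpl. rewrite cos_plus, sin_plus. f_equal; ring. Qed.

Lemma cis_0 : cis 0 = RtoC 1.
Proof. unfold cis, RtoC. now rewrite cos_0, sin_0. Qed.

Lemma cis_2PI t : cis (t + 2 * PI) = cis t.
Proof.
  unfold cis. rewrite cos_plus, sin_plus, cos_2PI, sin_2PI. f_equal; ring.
Qed.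

Lemma cts_cis t : cts cis t.
Proof. split; simpl. apply continuous_cos. apply continuous_sin. Qed.

Lemma is_derive_eps (f : R -> R) x l : is_derive f x l -> forall eps, 0 < eps ->
  exists d, 0 < d /\ forall y, Rabs (y - x) < d -> Rabs (f y - f x - l * (y - x)) <= eps * Rabs (y - x).
Proof.
  intros [_ H] eps He.
  assert (Hlim : is_filter_lim (@locally (AbsRing_UniformSpace R_AbsRing) x) x) by (intros P HP; exact HP).
  destruct (H x Hlim (mkposreal eps He)) as [d Hd]. exists d. split. apply cond_pos. intros y Hy.
  specialize (Hd y Hy). unfold norm, minus, plus, opp, scal in Hd; simpl in Hd. unfold abs, mult in Hd; simpl in Hd.
  replace (f y - f x - l * (y - x)) with (f y + - f x + - ((y + - x) * l)) by ring. exact Hd.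
Qed.

(** The derivative at 0 comes from the real functions [exp], [cos] and [sin]; the functional
    equation carries it to every [z]. *)
Lemma Cder_Cexp z : Cder Cexp z (Cexp z).
Proof.
  assert (H0 : Cder Cexp (RtoC 0) (RtoC 1)).
  { intros eps He.
    destruct (is_derive_eps exp 0 1) with (eps := eps/8) as [d1 [Hd1 K1]].
    { apply is_derive_Reals. rewrite <- exp_0 at 1. apply derivable_pt_lim_exp. } lra.
    destruct (is_derive_eps cos 0 0) with (eps := eps/8) as [d2 [Hd2 K2]].
    { apply is_derive_Reals. replace 0 with (- sin 0) at 2. apply derivable_pt_lim_cos. rewrite sin_0; ring. } lra.
    destruct (is_derive_eps sin 0 1) with (eps := eps/8) as [d3 [Hd3 K3]].
    { apply is_derive_Reals. rewrite <- cos_0 at 1. apply derivable_pt_lim_sin. } lra.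
    exists (Rmin (Rmin d1 d2) (Rmin d3 (Rmin 1 (eps/8)))). split.
    { repeat apply Rmin_glb_lt; lra. }
    intros [x y] Hw. replace ((x,y) - 0)%C with (x,y) in * by (unfold RtoC, Cminus, Cplus, Copp; simpl; f_equal; ring).
    assert (Hx := re_le_mod (x,y)). assert (Hy := im_le_mod (x,y)). simpl in Hx, Hy. set (m := Cmod (x,y)) in *.
    assert (M1 := Rmin_l (Rmin d1 d2) (Rmin d3 (Rmin 1 (eps/8)))).
    assert (M2 := Rmin_r (Rmin d1 d2) (Rmin d3 (Rmin 1 (eps/8)))).
    assert (M3 := Rmin_l d1 d2). assert (M4 := Rmin_r d1 d2).
    assert (M5 := Rmin_l d3 (Rmin 1 (eps/8))). assert (M6 := Rmin_r d3 (Rmin 1 (eps/8))).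
    assert (M7 := Rmin_l 1 (eps/8)). assert (M8 := Rmin_r 1 (eps/8)).
    specialize (K1 x). specialize (K2 y). specialize (K3 y).
    rewrite Rminus_0_r in K1, K2, K3. rewrite exp_0 in K1. rewrite cos_0 in K2. rewrite sin_0 in K3.
    specialize (K1 ltac:(lra)). specialize (K2 ltac:(lra)). specialize (K3 ltac:(lra)).
    rewrite Cexp_0.
    (* The summands are the error of [exp], the errors of [cos] and [sin], and the second-order
       cross term [x * y]. *)
    replace (Cexp (x,y) - 1 - 1 * (x,y))%C with
      (RtoC (exp x - 1 - 1 * x) * cis y + (RtoC (1 + x) * ((cos y - 1 - 0 * y)%R, (sin y - 0 - 1 * y)%R) + RtoC (x * y) * Ci))%C.
    2:{ unfold Cexp, cis, Cmult, Cminus, Cplus, Copp, Ci, RtoC; simpl; f_equal; ring. }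
    eapply Rle_trans. apply Cmod_triangle. rewrite Cmod_mult, Cmod_cis, Cmod_R.
    eapply Rle_trans. apply Rplus_le_compat_l. apply Cmod_triangle. rewrite !Cmod_mult, !Cmod_R, Cmod_Ci.
    assert (T : Cmod (cos y - 1 - 0 * y, sin y - 0 - 1 * y) <= eps/8 * m + eps/8*m).
    { eapply Rle_trans. apply Cmod_le_re_im. simpl fst; simpl snd. apply Rplus_le_compat; nra. }
    assert (T1 : Rabs (1 + x) <= 2). { apply Rabs_le. apply Rabs_le_between in Hx. lra. }
    rewrite Rabs_mult.
    assert (T2 : Rabs (1 + x) * Cmod (cos y - 1 - 0 * y, sin y - 0 - 1 * y) <= 2 * (eps/8 * m + eps/8*m)).
    { apply Rmult_le_compat; auto. apply Rabs_pos. apply Cmod_ge_0. }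
    assert (T3 : Rabs x * Rabs y <= eps/8 * m).
    { apply Rmult_le_compat; try apply Rabs_pos; lra. }
    assert (T4 : eps/8 * Rabs x <= eps/8 * m) by (apply Rmult_le_compat_l; lra).
    assert (0 <= eps * m) by (apply Rmult_le_pos; [lra|apply Cmod_ge_0]).
    rewrite !Rmult_1_r. replace (1 * m) with m by ring. lra. }
  apply Cder_ext with (fun w => Cexp z * Cexp (w - z))%C.
  { intros w. rewrite <- Cexp_plus. f_equal. ring. }
  apply Cder_eq with (Cexp z * 1)%C. 2: ring.
  apply Cder_scal. apply (Cder_shift Cexp z 1%C (-z)%C).
  replace (z + - z)%C with (RtoC 0) by ring. auto.
Qed.

Lemma Cder_Cexp_comp f z l : Cder f z l -> Cder (fun w => Cexp (f w)) z (Cexp (f z) * l)%C.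
Proof. intros H. apply Cder_comp; auto. apply Cder_Cexp. Qed.

(* In the coordinate [w = log z] circles become vertical segments and Goursat's theorem on
   [s,s'] x [0,2pi] says that the mean does not depend on the radius; let the radius tend to 0.  Truncating
   [Re w] at [b] only serves to have a function continuous on the whole plane. *)
Lemma circle_mean (F : C -> C) (rho r : R) : 0 < r < rho ->
  (forall z, Cmod z < rho -> Ccont F z) ->
  (forall z, z <> RtoC 0 -> Cmod z < rho -> exists l, Cder F z l) ->
  CInt (fun t => F (RtoC r * cis t)%C) 0 (2*PI) = (RtoC (2*PI) * F 0)%C.
Proof.
  intros [Hr Hrho] HC HD.
  (* Strictly between [ln r] and [ln rho]: the truncated map stays in the disc of radius [rho] and
     still reaches the circle of radius [r]. *)
  set (b := (ln r + ln rho) / 2).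
  assert (Hln : ln r < ln rho) by now apply ln_increasing.
  set (clip := fun z : C => (Rmin (fst z) b, snd z) : C).
  set (G := fun z => F (Cexp (clip z))).
  assert (Hin : forall x, Rmin x b < ln rho). { intros x. generalize (Rmin_r x b). unfold b. lra. }
  assert (Hmod : forall z, Cmod (Cexp (clip z)) < rho).
  { intros z. rewrite Cmod_Cexp. simpl. rewrite <- (exp_ln rho) by lra. now apply exp_increasing. }
  assert (Cclip : forall z, Ccont clip z).
  { intros [x y] eps He. exists (eps/2). split. lra. intros [u v] Hw.
    assert (Hx := re_le_mod ((u,v) - (x,y))). assert (Hy := im_le_mod ((u,v) - (x,y))). simpl in Hx, Hy.
    eapply Rle_lt_trans. apply Cmod_le_re_im. simpl.
    assert (Rabs (Rmin u b + - Rmin x b) <= Rabs (u + - x)).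
    { unfold Rmin, Rabs. repeat (destruct Rle_dec || destruct Rcase_abs); lra. }
    lra. }
  assert (GC : forall z, Ccont G z).
  { intros z. unfold G. apply (Ccont_comp F (fun z => Cexp (clip z))); auto.
    apply (Ccont_comp Cexp clip); auto. apply (Cder_cont _ _ _ (Cder_Cexp _)). }
  assert (Eclip : forall z, fst z < b -> clip z = z).
  { intros [x y] Hx. unfold clip; simpl in *. now rewrite Rmin_left by lra. }
  assert (GD : forall z, fst z < b -> exists l, Cder G z l).
  { intros z Hz. destruct (HD (Cexp z)) as [l Hl].
    - apply Cexp_neq_0.
    - rewrite <- (Eclip z Hz). apply Hmod.
    - exists (l * Cexp z)%C. apply Cder_ext_loc with (fun w => F (Cexp w)).
      + exists (b - fst z). split. lra. intros w Hw. unfold G. rewrite Eclip; auto.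
        generalize (re_le_mod (w - z)). simpl. intros. generalize (Rle_abs (fst w + - fst z)). lra.
      + apply Cder_comp; auto. apply Cder_Cexp. }
  assert (P0 : 0 < 2 * PI) by (generalize PI_RGT_0; lra).
  set (J := fun s => CInt (fun t => G (s, t)) 0 (2*PI)).
  assert (EJ : forall s s', s <= s' -> s' < b -> J s = J s').
  { intros s s' L L'. generalize (goursat G b s s' 0 (2*PI) GC GD L L' ltac:(lra)). unfold rect_int.
    (* The two horizontal edges cancel because the exponential has period [2 pi i]. *)
    rewrite (CInt_ext (fun s0 => G (s0, 2 * PI)) (fun s0 => G (s0, 0))).
    2:{ intros t. unfold G. f_equal. rewrite !Cexp_polar. simpl. f_equal. rewrite <- (Rplus_0_l (2*PI)). apply cis_2PI. }
    fold (J s) (J s'). intros E. apply Ceq_minus.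
    transitivity (Ci * (CInt (fun s0 : R => G (s0, 0%R)) s s' - CInt (fun s0 : R => G (s0, 0%R)) s s' + Ci * (J s' - J s)))%C.
    - replace (Ci * (CInt (fun s0 : R => G (s0, 0%R)) s s' - CInt (fun s0 : R => G (s0, 0%R)) s s' + Ci * (J s' - J s)))%C
        with ((Ci*Ci)*(J s' - J s))%C by ring.
      replace (Ci*Ci)%C with (RtoC (-1)). ring. unfold Ci, Cmult, RtoC; simpl; f_equal; ring.
    - rewrite E. ring. }
  assert (EF : forall s t, s < b -> G (s, t) = F (RtoC (exp s) * cis t)%C).
  { intros s t Hs. unfold G. rewrite Eclip by auto. now rewrite Cexp_polar. }
  assert (HJr : CInt (fun t => F (RtoC r * cis t)%C) 0 (2*PI) = J (ln r)).
  { unfold J. apply CInt_ext. intros t. rewrite EF, exp_ln; auto. unfold b. lra. }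
  rewrite HJr. apply Ceq_minus. apply Cmod_eq_0. apply Rle_antisym. 2: apply Cmod_ge_0.
  apply le_epsilon. intros eps He. rewrite Rplus_0_l.
  destruct (HC (RtoC 0)) with (eps := eps / (2*PI)) as [d [Hd K]]. rewrite Cmod_0; lra. apply Rdiv_lt_0_compat; lra.
  set (s := Rmin (ln r) (ln (d/2))).
  rewrite <- (EJ s). 2: apply Rmin_l. 2: unfold b; lra.
  assert (Hs : s < b). { generalize (Rmin_l (ln r) (ln (d/2))). unfold s, b. lra. }
  replace (J s - RtoC (2*PI) * F 0)%C with (CInt (fun t => G (s,t) - F 0)%C 0 (2*PI)).
  - eapply Rle_trans. apply CInt_bound_le with (M := eps / (2*PI)).
    + intros t. apply cts_minus. now apply Ccont_pair_v. apply cts_const.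
    + lra.
    + intros t _. left. rewrite EF by auto. apply K.
      replace (RtoC (exp s) * cis t - 0)%C with (RtoC (exp s) * cis t)%C by ring.
      rewrite Cmod_mult, Cmod_cis, Cmod_R, Rabs_pos_eq by (left; apply exp_pos).
      rewrite Rmult_1_r. apply Rle_lt_trans with (d/2). 2: lra.
      replace (d/2) with (exp (ln (d/2))) by (apply exp_ln; lra). unfold s.
      destruct (Rmin_r (ln r) (ln (d/2))) as [L|L]. left; now apply exp_increasing. right. now rewrite L.
    + right. field. lra.
  - rewrite CInt_minus, CInt_const. 2: now apply Ccont_pair_v. 2: intros; apply cts_const.
    now rewrite Rminus_0_r.
Qed.

(** * Regularity, division and logarithms of entire functions *)

Definition derivative_of (F F' : C -> C) : Prop := forall z, Cder F z (F' z).
Definition Entire (F : C -> C) : Prop := exists F', derivative_of F F'.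

Lemma choose_fun {X Y : Type} (P : X -> Y -> Prop) : (forall x, exists y, P x y) ->
  exists f : X -> Y, forall x, P x (f x).
Proof.
  intros H. exists (fun x => proj1_sig (constructive_indefinite_description _ (H x))).
  intros x. apply (proj2_sig (constructive_indefinite_description _ (H x))).
Qed.

Lemma Entire_pointwise F : (forall z, exists l, Cder F z l) -> Entire F.
Proof. intros H. destruct (choose_fun _ H) as [F' HF]. now exists F'. Qed.

Lemma Entire_cont F z : Entire F -> Ccont F z.
Proof. intros [F' H]. apply (Cder_cont _ _ _ (H z)). Qed.

Lemma Entire_const a : Entire (fun _ => a).
Proof. exists (fun _ => RtoC 0). intros z. apply Cder_const. Qed.

Lemma Entire_id : Entire (fun z => z).
Proof. exists (fun _ => RtoC 1). intros z. apply Cder_id. Qed.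

Lemma Entire_plus F G : Entire F -> Entire G -> Entire (fun z => F z + G z)%C.
Proof. intros [f Hf] [g Hg]. exists (fun z => f z + g z)%C. intros z. now apply Cder_plus. Qed.

Lemma Entire_minus F G : Entire F -> Entire G -> Entire (fun z => F z - G z)%C.
Proof. intros [f Hf] [g Hg]. exists (fun z => f z - g z)%C. intros z. now apply Cder_minus. Qed.

Lemma Entire_mult F G : Entire F -> Entire G -> Entire (fun z => F z * G z)%C.
Proof. intros [f Hf] [g Hg]. exists (fun z => f z * G z + F z * g z)%C. intros z. now apply Cder_mult. Qed.

Lemma Entire_opp F : Entire F -> Entire (fun z => - F z)%C.
Proof. intros [f Hf]. exists (fun z => - f z)%C. intros z. now apply Cder_opp. Qed.

Lemma Entire_comp F G : Entire F -> Entire G -> Entire (fun z => F (G z))%C.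
Proof. intros [f Hf] [g Hg]. exists (fun z => f (G z) * g z)%C. intros z. now apply Cder_comp. Qed.

Lemma Entire_shift F a : Entire F -> Entire (fun z => F (z + a))%C.
Proof. intros H. apply (Entire_comp F (fun z => z + a)%C); auto. apply Entire_plus. apply Entire_id. apply Entire_const. Qed.

Lemma Entire_exp F : Entire F -> Entire (fun z => Cexp (F z)).
Proof. intros H. apply (Entire_comp Cexp F); auto. exists Cexp. exact Cder_Cexp. Qed.

Lemma Entire_inv F : Entire F -> (forall z, F z <> RtoC 0) -> Entire (fun z => / F z)%C.
Proof.
  intros [f Hf] HN. exists (fun z => - / (F z * F z) * f z)%C. intros z.
  apply (Cder_comp Cinv F); auto. now apply Cder_inv.
Qed.

Lemma Entire_pow n a : Entire (fun z => (z - a)^n)%C.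
Proof.
  induction n. apply (Entire_const (RtoC 1)).
  apply (Entire_mult (fun z => z - a)%C (fun z => (z-a)^n)%C); auto.
  apply Entire_minus. apply Entire_id. apply Entire_const.
Qed.

Lemma Entire_ext F G : (forall z, F z = G z) -> Entire F -> Entire G.
Proof. intros E. replace G with F; auto. now apply functional_extensionality. Qed.

(** The mean value theorem fails for complex values; [F] is projected onto the direction of its own
    increment and the real theorem is applied to the projection. *)
Lemma mean_value_inequality (F F' : C -> C) z v L :
  (forall t, 0 <= t <= 1 -> Cder F (z + RtoC t * v)%C (F' (z + RtoC t * v)%C)) ->
  (forall t, 0 <= t <= 1 -> Cmod (F' (z + RtoC t * v)%C) <= L) ->
  Cmod (F (z + v)%C - F z) <= L * Cmod v.
Proof.
  intros HD HL. set (v0 := (F (z + v)%C - F z)%C).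
  set (g := fun t => fst (Cconj v0 * F (z + RtoC t * v))%C).
  assert (Hg : forall x, 0 <= x <= 1 -> is_derive g x (fst (Cconj v0 * (F' (z + RtoC x * v) * v)))%C).
  { intros x Hx. destruct (Cder_line F z v x _ (HD x Hx)) as [D1 D2]. unfold g. simpl.
    apply (is_derive_minus (V := R_NormedModule)); now apply is_derive_scal. }
  destruct (MVT_gen g 0 1 (fun t => fst (Cconj v0 * (F' (z + RtoC t * v) * v)))%C) as [c [Hc E]].
  - intros x Hx. rewrite Rmin_left, Rmax_right in Hx by lra. apply Hg. lra.
  - intros x Hx. rewrite Rmin_left, Rmax_right in Hx by lra.
    apply continuity_pt_filterlim.
    apply (ex_derive_continuous (K := R_AbsRing) (V := R_NormedModule) g). eexists. now apply Hg.
  - rewrite Rmin_left, Rmax_right in Hc by lra.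
    assert (E2 : g 1 - g 0 = Cmod v0 * Cmod v0).
    { unfold g. replace (z + 1 * v)%C with (z + v)%C by ring. replace (z + 0 * v)%C with z by ring.
      replace (Cmod v0 * Cmod v0) with (Cmod v0 ^ 2) by ring. rewrite Cmod2_alt. unfold v0, Re, Im. simpl. ring. }
    rewrite E2 in E. destruct (Req_dec (Cmod v0) 0) as [Z|N].
    + rewrite Z. apply Rmult_le_pos. 2: apply Cmod_ge_0. apply Rle_trans with (2 := HL c Hc). apply Cmod_ge_0.
    + assert (P : 0 < Cmod v0) by (generalize (Cmod_ge_0 v0); lra).
      apply Rmult_le_reg_l with (Cmod v0); auto. rewrite E. rewrite Rminus_0_r, Rmult_1_r.
      apply Rle_trans with (1 := Rle_abs _). apply Rle_trans with (1 := re_le_mod _).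
      rewrite !Cmod_mult, Cmod_conj. apply Rmult_le_compat_l. lra.
      apply Rmult_le_compat_r. apply Cmod_ge_0. now apply HL.
Qed.

Lemma segment_in_disc z w S t : Cmod z <= S -> Cmod w <= S -> 0 <= t <= 1 ->
  Cmod (z + RtoC t * (w - z)) <= S.
Proof.
  intros Hz Hw Ht. replace (z + RtoC t * (w - z))%C with (RtoC (1 - t) * z + RtoC t * w)%C by (rewrite RtoC_minus; ring).
  eapply Rle_trans. apply Cmod_triangle. rewrite !Cmod_mult, !Cmod_R, !Rabs_pos_eq by lra. nra.
Qed.

Lemma mean_value_disc (F F' : C -> C) S L : derivative_of F F' -> (forall z, Cmod z <= S -> Cmod (F' z) <= L) ->
  forall z w, Cmod z <= S -> Cmod w <= S -> Cmod (F w - F z) <= L * Cmod (w - z).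
Proof.
  intros HD HL z w Hz Hw. replace (F w) with (F (z + (w - z))%C) by (f_equal; ring).
  apply (mean_value_inequality F F'); intros t Ht. apply HD. apply HL. now apply segment_in_disc.
Qed.

Lemma cis_opp t : cis (- t) = (/ cis t)%C.
Proof.
  assert (E : (cis t * cis (- t))%C = RtoC 1). { rewrite <- cis_plus, Rplus_opp_r. apply cis_0. }
  assert (N : cis t <> RtoC 0). { apply Cmod_gt_0. rewrite Cmod_cis. lra. }
  transitivity (/ cis t * (cis t * cis (- t)))%C. field; auto. rewrite E. field; auto.
Qed.

Lemma cts_circle F z r t : (forall z, Ccont F z) -> cts (fun t => F (z + RtoC r * cis t)%C) t.
Proof.
  intros HF. apply (cts_comp F (fun t => z + RtoC r * cis t)%C); auto.
  apply cts_plus. apply cts_const. apply cts_mult. apply cts_const. apply cts_cis.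
Qed.

Lemma cts_cis_opp t : cts (fun t => cis (- t)) t.
Proof.
  replace (fun t => cis (- t)) with (fun t => Cconj (cis t)).
  - apply cts_conj. apply cts_cis.
  - apply functional_extensionality. intros s. unfold cis, Cconj. simpl. now rewrite cos_neg, sin_neg.
Qed.

Lemma circle_mean_at F z r : Entire F -> 0 < r ->
  CInt (fun t => F (z + RtoC r * cis t)%C) 0 (2*PI) = (RtoC (2*PI) * F z)%C.
Proof.
  intros HF Hr.
  assert (HS : Entire (fun w => F (z + w))%C).
  { apply Entire_ext with (fun w => F (w + z)%C). intros w; f_equal; ring. now apply Entire_shift. }
  rewrite (circle_mean (fun w => F (z + w))%C (r+1) r); try lra.
  - replace (z + 0)%C with z by ring. auto.
  - intros w _. now apply Entire_cont.
  - intros w _ _. destruct HS as [f Hf]. eexists. apply Hf.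
Qed.

(** Cauchy's formula for the derivative: [F' z] is the value at the centre of the difference
    quotient extended by continuity. The quotient is a priori only continuous at the centre, which
    is the case [circle_mean] covers. *)
Lemma circle_derivative F F' z r : derivative_of F F' -> 0 < r ->
  CInt (fun t => (F (z + RtoC r * cis t) - F z) * cis (- t))%C 0 (2*PI) = (RtoC (2*PI) * (RtoC r * F' z))%C.
Proof.
  intros HD Hr.
  set (F1 := fun w => if Ceq_dec w 0 then F' z else ((F (z + w) - F z) / w)%C).
  assert (Hr' : RtoC r <> RtoC 0). { intros E. apply RtoC_inj in E. lra. }
  transitivity (RtoC r * CInt (fun t => F1 (RtoC r * cis t)%C) 0 (2*PI))%C.
  - assert (HF1 : forall t, F1 (RtoC r * cis t)%C = ((F (z + RtoC r * cis t) - F z) * cis (- t) / RtoC r)%C).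
    { intros t. unfold F1. assert (N : cis t <> RtoC 0). { apply Cmod_gt_0. rewrite Cmod_cis. lra. }
      destruct Ceq_dec as [E|_].
      - elim (Cmult_neq_0 (RtoC r) (cis t)); auto.
      - rewrite cis_opp. field; auto. }
    rewrite <- CInt_scal.
    + apply CInt_ext. intros t. rewrite HF1. field. auto.
    + intros t. replace (fun t => F1 (RtoC r * cis t)%C) with (fun t => ((F (z + RtoC r * cis t) - F z) * cis (- t) / RtoC r)%C).
      2:{ apply functional_extensionality. intros s. now rewrite HF1. }
      unfold Cdiv. apply cts_mult. apply cts_mult. apply cts_minus. apply cts_circle.
      intros; apply Entire_cont; now exists F'. apply cts_const. apply cts_cis_opp. apply cts_const.
  - assert (HD1 : forall w, w <> RtoC 0 -> exists l, Cder F1 w l).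
    { intros w N. eexists. apply Cder_ext_loc with (fun w => (F (w + z) - F z) * / w)%C.
      - exists (Cmod w). split. now apply Cmod_gt_0. intros u Hu. unfold F1. destruct Ceq_dec as [E|_].
        + exfalso. rewrite E, Cmod_minus_sym in Hu. replace (w - 0)%C with w in Hu by ring. lra.
        + unfold Cdiv. now rewrite (Cplus_comm u z).
      - apply Cder_mult. apply Cder_minus. apply Cder_shift. apply HD. apply Cder_const. now apply Cder_inv. }
  - rewrite (circle_mean F1 (r+1) r).
    + unfold F1. destruct Ceq_dec as [_|N]. ring. now elim N.
    + lra.
    + intros w _. destruct (Ceq_dec w 0) as [->|N].
      * intros eps He. destruct (HD z (eps/2)) as [d [Hd K]]. lra. exists d. split; auto.
        intros w Hw. unfold F1. destruct (Ceq_dec 0 0) as [_|N]; [|now elim N].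
        destruct (Ceq_dec w 0) as [E|N]. now rewrite Cmod_self.
        replace (w - 0)%C with w in Hw by ring.
        specialize (K (z + w)%C). replace (z + w - z)%C with w in K by ring. specialize (K Hw).
        assert (P : 0 < Cmod w) by now apply Cmod_gt_0.
        replace ((F (z + w) - F z) / w - F' z)%C with ((F (z + w) - F z - F' z * w) / w)%C by (field; auto).
        rewrite Cmod_div by auto. apply Rle_lt_trans with (eps/2). 2: lra.
        apply Rmult_le_reg_r with (Cmod w); auto. unfold Rdiv at 1. rewrite Rmult_assoc, Rinv_l; lra.
      * destruct (HD1 w N) as [l Hl]. now apply Cder_cont in Hl.
    + intros w N _. now apply HD1.
Qed.

Lemma cauchy_estimate F F' z r M : derivative_of F F' -> 0 < r ->
  (forall t, Cmod (F (z + RtoC r * cis t)%C - F z) <= M) -> r * Cmod (F' z) <= M.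
Proof.
  intros HD Hr HM.
  assert (P : 0 < 2 * PI) by (generalize PI_RGT_0; lra).
  assert (B : Cmod (CInt (fun t => (F (z + RtoC r * cis t) - F z) * cis (- t))%C 0 (2*PI)) <= M * (2*PI - 0)).
  { apply CInt_bound_le; try lra.
    - intros t. apply cts_mult. apply cts_minus. apply cts_circle. intros; apply Entire_cont; now exists F'.
      apply cts_const. apply cts_cis_opp.
    - intros t _. rewrite Cmod_mult, Cmod_cis, Rmult_1_r. apply HM. }
  rewrite (circle_derivative F F') in B by auto.
  rewrite !Cmod_mult, !Cmod_R, !Rabs_pos_eq in B by lra. nra.
Qed.

Lemma Entire_bounded_disc F S : Entire F -> exists M, 0 < M /\ forall z, Cmod z <= S -> Cmod (F z) <= M.
Proof. intros H. apply continuous_bounded_disc. intros z. now apply Entire_cont. Qed.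

Lemma Cmod_circle z r t : 0 <= r -> Cmod (z + RtoC r * cis t) <= Cmod z + r.
Proof.
  intros Hr. eapply Rle_trans. apply Cmod_triangle. rewrite Cmod_mult, Cmod_cis, Cmod_R, Rabs_pos_eq; lra.
Qed.

Lemma deriv_bounded_disc F F' S : derivative_of F F' ->
  exists M, 0 < M /\ forall z, Cmod z <= S -> Cmod (F' z) <= M.
Proof.
  intros HD. destruct (Entire_bounded_disc F (S+1)) as [M [HM K]]. now exists F'.
  exists (M + M). split. lra. intros z Hz.
  replace (Cmod (F' z)) with (1 * Cmod (F' z)) by ring.
  apply cauchy_estimate with (1 := HD). lra. intros t.
  eapply Rle_trans. apply Cmod_triangle_minus. apply Rplus_le_compat; apply K.
  apply Rle_trans with (1 := Cmod_circle z 1 t ltac:(lra)). lra. lra.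
Qed.

(** [F'] is a circle integral of increments of [F]. When the centre moves, both the point on the
    circle and the centre contribute a change controlled by the bound on [F'], whence [L + L]. *)
Lemma deriv_lipschitz F F' S : derivative_of F F' ->
  exists L, 0 < L /\ forall z w, Cmod z <= S -> Cmod w <= S -> Cmod (F' w - F' z) <= L * Cmod (w - z).
Proof.
  intros HD. destruct (deriv_bounded_disc F F' (S+1) HD) as [L [HL K]].
  assert (P : 0 < 2 * PI) by (generalize PI_RGT_0; lra).
  exists (L + L). split. lra. intros z w Hz Hw.
  assert (HFc : forall z, Ccont F z). { intros u. apply Entire_cont; now exists F'. }
  assert (Hk : forall z t, cts (fun t => (F (z + RtoC 1 * cis t) - F z) * cis (- t))%C t).
  { intros u t. apply cts_mult. apply cts_minus. now apply cts_circle. apply cts_const. apply cts_cis_opp. }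
  assert (B : Cmod (CInt (fun t => (F (w + RtoC 1 * cis t) - F w) * cis (- t) - (F (z + RtoC 1 * cis t) - F z) * cis (- t))%C 0 (2*PI))
     <= ((L + L) * Cmod (w - z)) * (2*PI - 0)).
  { apply CInt_bound_le; try lra.
    - intros t. apply (cts_minus _ _ t (Hk w t) (Hk z t)).
    - intros t _.
      replace ((F (w + 1 * cis t) - F w) * cis (- t) - (F (z + 1 * cis t) - F z) * cis (- t))%C with
        ((F (w + 1 * cis t) - F (z + 1 * cis t) - (F w - F z)) * cis (- t))%C by ring.
      rewrite Cmod_mult, Cmod_cis, Rmult_1_r. eapply Rle_trans. apply Cmod_triangle_minus.
      rewrite Rmult_plus_distr_r. apply Rplus_le_compat.
      + replace (w - z)%C with (w + 1 * cis t - (z + 1 * cis t))%C by ring.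
        apply (mean_value_disc F F' (S+1)); auto.
        apply Rle_trans with (1 := Cmod_circle z 1 t ltac:(lra)); lra.
        apply Rle_trans with (1 := Cmod_circle w 1 t ltac:(lra)); lra.
      + apply (mean_value_disc F F' (S+1)); auto; lra. }
  rewrite CInt_minus, !(circle_derivative F F') in B; auto; try lra.
  replace (RtoC (2 * PI) * (1 * F' w) - RtoC (2 * PI) * (1 * F' z))%C with (RtoC (2 * PI) * (F' w - F' z))%C in B.
  2: ring.
  rewrite Cmod_mult, Cmod_R, Rabs_pos_eq in B by lra. nra.
Qed.

Lemma second_order F F' S : derivative_of F F' ->
  exists L, 0 < L /\ forall z w, Cmod z <= S -> Cmod w <= S ->
    Cmod (F w - F z - F' z * (w - z)) <= L * Cmod (w - z) ^ 2.
Proof.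
  intros HD. destruct (deriv_lipschitz F F' S HD) as [L [HL K]].
  exists L. split; auto. intros z w Hz Hw.
  replace (F w - F z - F' z * (w - z))%C with
    ((fun u => F u - F' z * u) (z + (w - z)) - (fun u => F u - F' z * u) z)%C.
  2:{ replace (z + (w - z))%C with w by ring. ring. }
  replace (L * Cmod (w - z)^2) with (L * Cmod (w - z) * Cmod (w - z)) by ring.
  apply (mean_value_inequality (fun u => F u - F' z * u)%C (fun u => F' u - F' z)%C).
  - intros t Ht. apply Cder_minus. apply HD.
    apply Cder_eq with (1 := Cder_scal (F' z) _ _ _ (Cder_id _)). ring.
  - intros t Ht. eapply Rle_trans. apply K; auto. now apply segment_in_disc.
    apply Rmult_le_compat_l. lra.
    replace (z + t * (w - z) - z)%C with (RtoC t * (w - z))%C by ring.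
    rewrite Cmod_mult, Cmod_R, Rabs_pos_eq by lra. generalize (Cmod_ge_0 (w - z)). nra.
Qed.

(** Differentiation of the circle formula under the integral sign. The guess [D2] is that formula
    with [F'] in place of [F], and [second_order] bounds the error of the integrand uniformly. *)
Lemma deriv_Entire F F' : derivative_of F F' -> Entire F'.
Proof.
  intros HD. assert (P : 0 < 2 * PI) by (generalize PI_RGT_0; lra).
  assert (HFc : forall z, Ccont F z). { intros u. apply Entire_cont; now exists F'. }
  assert (HF'c : forall z, Ccont F' z).
  { intros z eps He. destruct (deriv_lipschitz F F' (Cmod z + 1) HD) as [L [HL K]].
    exists (Rmin 1 (eps / L)). split. apply Rmin_glb_lt. lra. now apply Rdiv_lt_0_compat.
    intros w Hw. assert (H1 := Rmin_l 1 (eps / L)). assert (H2 := Rmin_r 1 (eps / L)).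
    eapply Rle_lt_trans. apply K. lra. generalize (Cmod_triangle_rev w z). lra.
    apply Rlt_le_trans with (L * (eps / L)). apply Rmult_lt_compat_l; lra. right; field; lra. }
  apply Entire_pointwise. intros z.
  set (D2 := (CInt (fun t => (F' (z + RtoC 1 * cis t) - F' z) * cis (- t))%C 0 (2*PI) / RtoC (2*PI))%C).
  exists D2. intros eps He.
  destruct (second_order F F' (Cmod z + 2) HD) as [L [HL K]].
  exists (Rmin 1 (eps / (2 * L))). split. apply Rmin_glb_lt. lra. apply Rdiv_lt_0_compat; lra.
  intros w Hw. assert (H1 := Rmin_l 1 (eps / (2*L))). assert (H2 := Rmin_r 1 (eps / (2*L))).
  assert (Hwz : Cmod w <= Cmod z + 1). { generalize (Cmod_triangle_rev w z). lra. }
  assert (Hk : forall z t, cts (fun t => (F (z + RtoC 1 * cis t) - F z) * cis (- t))%C t).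
  { intros u t. apply cts_mult. apply cts_minus. now apply cts_circle. apply cts_const. apply cts_cis_opp. }
  assert (Hk' : forall t, cts (fun t => (w - z) * ((F' (z + RtoC 1 * cis t) - F' z) * cis (- t)))%C t).
  { intros t. apply cts_mult. apply cts_const. apply cts_mult. apply cts_minus. now apply cts_circle. apply cts_const. apply cts_cis_opp. }
  set (m := Cmod (w - z)) in *. assert (Hm : 0 <= m) by apply Cmod_ge_0.
  assert (B : Cmod (CInt (fun t => (F (w + RtoC 1 * cis t) - F w) * cis (- t) - (F (z + RtoC 1 * cis t) - F z) * cis (- t)
      - (w - z) * ((F' (z + RtoC 1 * cis t) - F' z) * cis (- t)))%C 0 (2*PI))
     <= (L * m^2 + L * m^2) * (2*PI - 0)).
  { apply CInt_bound_le; try lra.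
    - intros t. apply cts_minus; auto. apply (cts_minus _ _ t (Hk w t) (Hk z t)).
    - intros t _.
      replace ((F (w + 1 * cis t) - F w) * cis (- t) - (F (z + 1 * cis t) - F z) * cis (- t)
       - (w - z) * ((F' (z + RtoC 1 * cis t) - F' z) * cis (- t)))%C with
        ((F (w + 1 * cis t) - F (z + 1 * cis t) - F' (z + 1 * cis t) * (w + 1 * cis t - (z + 1 * cis t))
        - (F w - F z - F' z * (w - z))) * cis (- t))%C by ring.
      rewrite Cmod_mult, Cmod_cis, Rmult_1_r. eapply Rle_trans. apply Cmod_triangle_minus.
      apply Rplus_le_compat.
      + eapply Rle_trans. apply K.
        apply Rle_trans with (1 := Cmod_circle z 1 t ltac:(lra)); lra.
        apply Rle_trans with (1 := Cmod_circle w 1 t ltac:(lra)); lra.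
        replace (w + 1 * cis t - (z + 1 * cis t))%C with (w - z)%C by ring. fold m. lra.
      + apply K; lra. }
  rewrite !CInt_minus, !(circle_derivative F F'), CInt_scal in B; auto; try lra.
  2:{ intros t. apply cts_mult. apply cts_minus. now apply cts_circle. apply cts_const. apply cts_cis_opp. }
  2:{ intros t. apply (cts_minus _ _ t (Hk w t) (Hk z t)). }
  assert (N2 : RtoC (2*PI) <> RtoC 0). { intros E. apply RtoC_inj in E. lra. }
  match type of B with Cmod ?u <= _ => replace u with (RtoC (2*PI) * (F' w - F' z - D2 * (w - z)))%C in B end.
  2:{ unfold D2. field. auto. }
  rewrite Cmod_mult, Cmod_R, Rabs_pos_eq in B by lra. fold m.
  assert (B2 : Cmod (F' w - F' z - D2 * (w - z)) <= (2 * L * m) * m) by nra.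
  apply Rle_trans with (1 := B2). apply Rmult_le_compat_r; auto.
  apply Rle_trans with (2 * L * (eps / (2 * L))). apply Rmult_le_compat_l; lra. right; field; lra.
Qed.

(** Removal of the singularity of [F z / (z - a)]: since [F'] is entire, the second-order Taylor
    polynomial of [F] at [a] is available and yields the derivative [F'' a / 2] of the quotient. *)
Lemma Entire_division F a : Entire F -> F a = RtoC 0 ->
  exists F1, Entire F1 /\ forall z, F z = ((z - a) * F1 z)%C.
Proof.
  intros [F' HD] Fa. destruct (deriv_Entire F F' HD) as [F'' HD2].
  set (F1 := fun z => if Ceq_dec z a then F' a else (F z / (z - a))%C).
  exists F1. split.
  2:{ intros z. unfold F1. destruct Ceq_dec as [->|N]. rewrite Fa; ring. field. now apply Cminus_eq_contra. }
  apply Entire_pointwise. intros z. destruct (Ceq_dec z a) as [->|N].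
  - exists (F'' a / 2)%C. intros eps He.
    destruct (second_order F' F'' (Cmod a + 1) HD2) as [L [HL K]].
    exists (Rmin 1 (eps / L)). split. apply Rmin_glb_lt. lra. apply Rdiv_lt_0_compat; lra.
    intros w Hw. assert (H1 := Rmin_l 1 (eps / L)). assert (H2 := Rmin_r 1 (eps / L)).
    assert (Hwz : Cmod w <= Cmod a + 1). { generalize (Cmod_triangle_rev w a). lra. }
    unfold F1. destruct (Ceq_dec a a) as [_|N]; [|now elim N].
    destruct (Ceq_dec w a) as [->|N].
    { replace (F' a - F' a - F'' a / 2 * (a - a))%C with (RtoC 0) by field.
      rewrite Cmod_0. apply Rmult_le_pos. lra. apply Cmod_ge_0. }
    assert (N' := Cminus_eq_contra _ _ N).
    assert (P : 0 < Cmod (w - a)) by now apply Cmod_gt_0.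
    set (Q := fun u => (F u - (F' a * (u - a) + F'' a / 2 * ((u - a) * (u - a))))%C).
    assert (B : Cmod (Q (a + (w - a))%C - Q a) <= (L * Cmod (w - a)^2) * Cmod (w - a)).
    { apply (mean_value_inequality Q (fun u => F' u - (F' a + F'' a * (u - a)))%C).
      - intros t Ht. set (u := (a + t * (w - a))%C). unfold Q. apply Cder_minus. apply HD.
        assert (Du : Cder (fun u => u - a)%C u (1 - 0)%C) by (apply Cder_minus; [apply Cder_id|apply Cder_const]).
        apply Cder_eq with (1 := Cder_plus _ _ _ _ _ (Cder_scal (F' a) _ _ _ Du)
           (Cder_scal (F'' a / 2)%C _ _ _ (Cder_mult _ _ _ _ _ Du Du))).
        field.
      - intros t Ht. set (u := (a + t * (w - a))%C).
        replace (F' u - (F' a + F'' a * (u - a)))%C with (F' u - F' a - F'' a * (u - a))%C by ring.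
        eapply Rle_trans. apply K. lra. apply segment_in_disc; lra.
        apply Rmult_le_compat_l. lra. apply pow_incr. split. apply Cmod_ge_0.
        unfold u. replace (a + t * (w - a) - a)%C with (RtoC t * (w - a))%C by ring.
        rewrite Cmod_mult, Cmod_R, Rabs_pos_eq by lra. nra. }
    replace (a + (w - a))%C with w in B by ring.
    replace (Q w - Q a)%C with ((F w / (w - a) - F' a - F'' a / 2 * (w - a)) * (w - a))%C in B.
    2:{ unfold Q. rewrite Fa. field. auto. }
    rewrite Cmod_mult in B. apply Rmult_le_reg_r in B; auto.
    apply Rle_trans with (1 := B). replace (L * Cmod (w - a)^2) with (L * Cmod (w - a) * Cmod (w - a)) by ring.
    apply Rmult_le_compat_r. lra. apply Rle_trans with (L * (eps / L)). apply Rmult_le_compat_l; lra. right; field; lra.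
  - eexists. apply Cder_ext_loc with (fun w => F w * / (w - a))%C.
    + exists (Cmod (z - a)). split. apply Cmod_gt_0. now apply Cminus_eq_contra.
      intros w Hw. unfold F1. destruct Ceq_dec as [->|_]. rewrite Cmod_minus_sym in Hw. lra. auto.
    + apply Cder_mult. apply HD. apply (Cder_comp Cinv (fun w => w - a)%C).
      apply Cder_minus. apply Cder_id. apply Cder_const. apply Cder_inv. now apply Cminus_eq_contra.
Qed.

Lemma zero_deriv_const F : derivative_of F (fun _ => RtoC 0) -> forall z w, F z = F w.
Proof.
  intros H z w. apply Ceq_minus. apply Cmod_eq_0. apply Rle_antisym. 2: apply Cmod_ge_0.
  eapply Rle_trans. apply (mean_value_disc F (fun _ => RtoC 0) (Cmod z + Cmod w) 0 H).
  intros; rewrite Cmod_0; lra. generalize (Cmod_ge_0 z); lra. generalize (Cmod_ge_0 w); lra. lra.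
Qed.

Lemma argument_exists (v : C) : v <> RtoC 0 -> exists t, v = (RtoC (Cmod v) * cis t)%C.
Proof.
  intros Hv. assert (P : 0 < Cmod v) by now apply Cmod_gt_0.
  destruct v as [x y]. set (r := Cmod (x,y)) in *.
  assert (E : x * x + y * y = r * r).
  { unfold r. replace (Cmod (x,y) * Cmod (x,y)) with (Cmod (x,y) ^ 2) by ring. rewrite Cmod2_alt. simpl. ring. }
  set (u := x / r).
  assert (Hu : -1 <= u <= 1).
  { assert (H := re_le_mod (x,y)). simpl in H. fold r in H. apply Rabs_le_between in H.
    unfold u. split; apply Rmult_le_reg_r with r; auto; unfold Rdiv; rewrite Rmult_assoc, Rinv_l; lra. }
  assert (Es : sin (acos u) = Rabs y / r).
  { rewrite sin_acos by lra. apply Rsqr_inj. apply sqrt_pos. apply Rmult_le_pos. apply Rabs_pos. left; now apply Rinv_0_lt_compat.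
    rewrite Rsqr_sqrt. 2: unfold Rsqr; nra. rewrite Rsqr_div', <- Rsqr_abs. unfold u. rewrite Rsqr_div'.
    unfold Rsqr. replace (y * y) with (r * r - x * x) by lra. field. lra. }
  destruct (Rle_dec 0 y) as [L|L].
  - exists (acos u). unfold cis, Cmult, RtoC; simpl. rewrite cos_acos by lra. rewrite Es, Rabs_pos_eq by lra.
    unfold u. f_equal; field; lra.
  - exists (- acos u). unfold cis, Cmult, RtoC; simpl. rewrite cos_neg, sin_neg, cos_acos by lra.
    rewrite Es, Rabs_left by lra. unfold u. f_equal; field; lra.
Qed.

Lemma Cexp_surjective v : v <> RtoC 0 -> exists z, v = Cexp z.
Proof.
  intros Hv. destruct (argument_exists v Hv) as [t Ht]. exists (ln (Cmod v), t).
  rewrite Cexp_polar. simpl. rewrite exp_ln; auto. now apply Cmod_gt_0.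
Qed.

(** A primitive of [E' / E] is a logarithm of [E] up to an additive constant, which is fixed at 0
    using that [Cexp] takes every nonzero value. *)
Lemma entire_log E : Entire E -> (forall z, E z <> RtoC 0) -> exists P, Entire P /\ forall z, E z = Cexp (P z).
Proof.
  intros HE HN. destruct (HE) as [E' HD]. assert (HE' := deriv_Entire _ _ HD).
  assert (HL : Entire (fun z => E' z * / E z)%C). { apply Entire_mult; auto. now apply Entire_inv. }
  destruct (entire_primitive (fun z => E' z * / E z)%C) as [P0 HP].
  { destruct HL as [l Hl]. intros z. eexists. apply Hl. }
  destruct (Cexp_surjective (E 0 * / Cexp (P0 0)))%C as [k Hk].
  { apply Cmult_neq_0; auto. intros H. assert (K := Cinv_r _ (Cexp_neq_0 (P0 0))). rewrite H in K.
    rewrite Cmult_0_r in K. apply RtoC_inj in K. lra. }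
  exists (fun z => P0 z + k)%C. split.
  { apply Entire_plus. eexists. exact HP. apply Entire_const. }
  assert (HQ : derivative_of (fun z => E z * Cexp (- P0 z))%C (fun _ => RtoC 0)).
  { intros z. apply Cder_eq with (1 := Cder_mult _ _ _ _ _ (HD z) (Cder_Cexp_comp _ _ _ (Cder_opp _ _ _ (HP z)))).
    field. apply HN. }
  intros z. rewrite Cexp_plus, <- Hk.
  assert (H := zero_deriv_const _ HQ z 0). simpl in H.
  assert (A : forall u, (Cexp (- u) = / Cexp u)%C).
  { intros u. assert (H1 := Cexp_opp u). assert (H2 := Cexp_neq_0 u).
    transitivity (Cexp (- u) * Cexp u * / Cexp u)%C. field; auto. rewrite H1. ring. }
  rewrite !A in H. rewrite <- H. field. apply Cexp_neq_0.
Qed.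

(** * Jensen and Poisson inequalities for the proximity function *)

(** Holds for all [x] because [ln] is 0 on nonpositive reals. Here [ln] is only evaluated on
    [[1, oo)], so continuity across zeros of a function is immediate. *)
Lemma log_plus_alt x : log_plus x = ln (Rmax 1 x).
Proof.
  unfold log_plus. destruct (Rle_dec x 1) as [L|L].
  - rewrite (Rmax_left 1 x L), ln_1. apply Rmax_left.
    destruct (Rle_dec x 0) as [L0|L0].
    + unfold ln. destruct (Rlt_dec 0 x). exfalso; lra. apply Rle_refl.
    + rewrite <- ln_1. apply ln_le; lra.
  - rewrite (Rmax_right 1 x) by lra. apply Rmax_right. rewrite <- ln_1. apply ln_le; lra.
Qed.

Lemma log_plus_ge_0 x : 0 <= log_plus x.
Proof. apply Rmax_l. Qed.

Lemma exp_log_plus x : exp (log_plus x) = Rmax 1 x.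
Proof. rewrite log_plus_alt. apply exp_ln. generalize (Rmax_l 1 x). lra. Qed.

Lemma log_plus_le_iff x B : 0 <= B -> (log_plus x <= B <-> x <= exp B).
Proof.
  intros HB. split.
  - intros H. apply Rle_trans with (Rmax 1 x). apply Rmax_r. rewrite <- exp_log_plus.
    destruct H as [H| ->]. left. now apply exp_increasing. lra.
  - intros H. rewrite log_plus_alt. rewrite <- (ln_exp B). apply ln_le.
    generalize (Rmax_l 1 x); lra. apply Rmax_lub; auto. rewrite <- exp_0.
    destruct HB as [H0| <-]. left. now apply exp_increasing. lra.
Qed.

Lemma continuous_log_plus k t : cts k t -> continuous (fun s => log_plus (Cmod (k s))) t.
Proof.
  intros H. apply continuous_ext with (fun s => ln (Rmax 1 (Cmod (k s)))).
  { intros s. now rewrite log_plus_alt. }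
  apply (continuous_comp (fun s => Rmax 1 (Cmod (k s))) ln).
  - apply continuous_eps. intros eps He.
    destruct (proj1 (continuous_eps _ _) (cts_Cmod _ _ H) eps He) as [d [Hd K]].
    exists d. split; auto. intros y Hy. specialize (K y Hy). simpl in K. revert K.
    unfold Rmax, Rabs. repeat (destruct Rle_dec || destruct Rcase_abs); lra.
  - apply (ex_derive_continuous (K := R_AbsRing) (V := R_NormedModule) ln).
    exists (/ Rmax 1 (Cmod (k t))). apply is_derive_Reals. apply derivable_pt_lim_ln.
    generalize (Rmax_l 1 (Cmod (k t))). lra.
Qed.

(** * Riemann sums on the circle and products over rotated roots of unity *)

Fixpoint Rsum (u : nat -> R) (n : nat) : R :=
  match n with O => 0 | S m => Rsum u m + u m end.

Fixpoint Cprod (h : nat -> C) (n : nat) : C :=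
  match n with O => RtoC 1 | S m => (Cprod h m * h m)%C end.

Lemma Cmod_Cprod_exp_le h u n : (forall k, Cmod (h k) <= exp (u k)) -> Cmod (Cprod h n) <= exp (Rsum u n).
Proof.
  intros H. induction n; simpl. rewrite Cmod_1, exp_0. lra.
  rewrite Cmod_mult, exp_plus. apply Rmult_le_compat; auto; apply Cmod_ge_0.
Qed.

Lemma periodic_integral (u : R -> R) (x : R) : (forall t, continuous u t) -> (forall t, u (t + 2 * PI) = u t) ->
  RInt u x (x + 2 * PI) = RInt u 0 (2 * PI).
Proof.
  intros Hc Hp. assert (HX : forall a b, ex_RInt u a b) by (intros; now apply ex_RInt_cont).
  assert (E : RInt u (0 + 2 * PI) (x + 2 * PI) = RInt u 0 x).
  { assert (L := RInt_comp_lin (V := R_CompleteNormedModule) u 1 (2 * PI) 0 x (HX _ _)).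
    rewrite Rmult_0_r, Rmult_1_l in L. rewrite <- L. symmetry.
    apply RInt_ext. intros t _. replace (1 * t + 2 * PI) with (t + 2 * PI) by ring. rewrite Hp.
    unfold scal; simpl; unfold mult; simpl. ring. }
  rewrite Rplus_0_l in E.
  assert (C1 := RInt_Chasles (V := R_CompleteNormedModule) u x 0 (x + 2 * PI) (HX _ _) (HX _ _)).
  assert (C2 := RInt_Chasles (V := R_CompleteNormedModule) u 0 (2 * PI) (x + 2 * PI) (HX _ _) (HX _ _)).
  assert (C3 := opp_RInt_swap (V := R_CompleteNormedModule) u x 0 (HX _ _)).
  unfold plus in C1, C2; simpl in C1, C2. unfold opp in C3; simpl in C3. lra.
Qed.

Lemma RInt_near_const (u : R -> R) (x d eps : R) : 0 <= d -> (forall t, continuous u t) ->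
  (forall t, x <= t <= x + d -> Rabs (u t - u x) <= eps) ->
  Rabs (d * u x - RInt u x (x + d)) <= eps * d.
Proof.
  intros Hd Hc K.
  assert (HX : ex_RInt u x (x + d)) by now apply ex_RInt_cont.
  assert (L : RInt u x (x+d) <= RInt (fun _ => u x + eps) x (x+d)).
  { apply RInt_le; auto. lra. apply ex_RInt_const. intros t Ht.
    specialize (K t ltac:(lra)). apply Rabs_le_between in K. lra. }
  assert (L' : RInt (fun _ => u x - eps) x (x+d) <= RInt u x (x+d)).
  { apply RInt_le; auto. lra. apply ex_RInt_const. intros t Ht.
    specialize (K t ltac:(lra)). apply Rabs_le_between in K. lra. }
  rewrite RInt_const in L, L'. unfold scal in L, L'; simpl in L, L'; unfold mult in L, L'; simpl in L, L'.
  apply Rabs_le. lra.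
Qed.

(** One [N] has to serve every starting point [x], since the rotation supplied by
    [roots_of_unity_max] depends on [N]. *)
Lemma riemann_sum_periodic (u : R -> R) (eps : R) : 0 < eps ->
  (forall t, continuous u t) -> (forall t, u (t + 2 * PI) = u t) ->
  exists N, (0 < N)%nat /\ forall x, 0 <= x <= 2 * PI ->
    Rabs (Rsum (fun k => u (x + INR k * (2 * PI / INR N))) N / INR N - RInt u 0 (2 * PI) / (2 * PI)) <= eps.
Proof.
  intros He Hc Hp. assert (P := PI_RGT_0).
  (* A starting point in [[0, 2 pi]] followed by one full turn stays in [[0, 4 pi]]. *)
  destruct (Heine_cor2 (f := u) (a := 0) (b := 4 * PI)) with (eps := mkposreal eps He) as [d Hd].
  { intros x _. apply continuity_pt_filterlim. apply Hc. }
  simpl in Hd.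
  destruct (nfloor_ex (2 * PI / d)) as [m Hm].
  { apply Rmult_le_pos. lra. left. apply Rinv_0_lt_compat. apply cond_pos. }
  exists (S m). split. lia. intros x Hx.
  set (N := INR (S m)). assert (HN : 0 < N) by (apply lt_0_INR; lia).
  set (dl := 2 * PI / N). assert (Hdl : 0 < dl) by (apply Rdiv_lt_0_compat; lra).
  assert (Hdd : dl < d).
  { unfold dl. destruct Hm as [_ Hm]. assert (HD := cond_pos d).
    apply Rmult_lt_reg_r with (N / d). apply Rdiv_lt_0_compat; auto.
    replace (2 * PI / N * (N / d)) with (2 * PI / d) by (field; lra).
    replace (d * (N / d)) with N by (field; lra).
    unfold N. rewrite S_INR. auto. }
  assert (EN : N * dl = 2 * PI) by (unfold dl; field; lra).
  assert (HX : forall a b, ex_RInt u a b) by (intros; now apply ex_RInt_cont).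
  assert (K : forall n, INR n <= N -> Rabs (dl * Rsum (fun k => u (x + INR k * dl)) n - RInt u x (x + INR n * dl)) <= eps * (INR n * dl)).
  { induction n; intros Hn.
    - simpl. rewrite Rmult_0_l, Rplus_0_r, RInt_point. unfold zero; simpl. rewrite Rmult_0_r, Rminus_0_r, Rabs_R0. lra.
    - rewrite S_INR in *. simpl Rsum. specialize (IHn ltac:(lra)).
      assert (C1 := RInt_Chasles (V := R_CompleteNormedModule) u x (x + INR n * dl) (x + (INR n + 1) * dl) (HX _ _) (HX _ _)).
      unfold plus in C1; simpl in C1. rewrite <- C1.
      assert (Hn0 := pos_INR n).
      assert (Q := RInt_near_const u (x + INR n * dl) dl eps ltac:(lra) Hc).
      replace (x + INR n * dl + dl) with (x + (INR n + 1) * dl) in Q by ring.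
      assert (B0 : 0 <= INR n * dl) by (apply Rmult_le_pos; lra).
      assert (B1 : (INR n + 1) * dl <= N * dl) by (apply Rmult_le_compat_r; lra).
      assert (Q' : Rabs (dl * u (x + INR n * dl) - RInt u (x + INR n * dl) (x + (INR n + 1) * dl)) <= eps * dl).
      { apply Q. intros t Ht. left. apply Hd; try lra. rewrite Rabs_pos_eq; lra. }
      apply Rabs_le_between in IHn. apply Rabs_le_between in Q'. apply Rabs_le. lra. }
  specialize (K (S m) ltac:(unfold N; lra)). fold N in K. rewrite EN, periodic_integral in K; auto.
  replace (Rsum (fun k => u (x + INR k * dl)) (S m) / N) with (dl * Rsum (fun k => u (x + INR k * dl)) (S m) / (2 * PI)).
  2:{ unfold dl. field. lra. }
  unfold Rdiv. rewrite <- Rmult_minus_distr_r, Rabs_mult, (Rabs_pos_eq (/ (2 * PI))).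
  2:{ left. apply Rinv_0_lt_compat. lra. }
  apply Rmult_le_reg_r with (2 * PI). lra. rewrite Rmult_assoc, Rinv_l by lra. lra.
Qed.

Lemma circle_max H : (forall w, Cmod w < 2 -> exists l, Cder H w l) ->
  exists t, 0 <= t <= 2 * PI /\ Cmod (H 0) <= Cmod (H (cis t)).
Proof.
  intros HD. assert (P := PI_RGT_0).
  assert (HC : forall w, Cmod w < 2 -> Ccont H w).
  { intros w Hw. destruct (HD w Hw) as [l Hl]. now apply Cder_cont in Hl. }
  assert (Hk : forall t, cts (fun t => H (cis t)) t).
  { intros t. apply (cts_comp H cis). apply HC. rewrite Cmod_cis. lra. apply cts_cis. }
  destruct (continuity_ab_maj (fun t => Cmod (H (cis t))) 0 (2 * PI)) as [t [Ht Hr]]. lra.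
  { intros t _. apply continuity_pt_filterlim. apply cts_Cmod. apply Hk. }
  exists t. split; auto.
  assert (E := circle_mean H 2 1 ltac:(lra) HC (fun w _ => HD w)).
  assert (B : Cmod (CInt (fun t => H (RtoC 1 * cis t)%C) 0 (2*PI)) <= Cmod (H (cis t)) * (2*PI - 0)).
  { rewrite (CInt_ext _ (fun t => H (cis t))). 2: intros; now rewrite Cmult_1_l.
    apply CInt_bound_le; auto. lra. }
  rewrite E, Cmod_mult, Cmod_R, Rabs_pos_eq in B by lra. nra.
Qed.

Lemma Cder_Cprod (h : nat -> C -> C) n w : (forall k, exists l, Cder (h k) w l) ->
  exists l, Cder (fun w => Cprod (fun k => h k w) n) w l.
Proof.
  intros H. induction n; simpl. exists (RtoC 0). apply Cder_const.
  destruct IHn as [a Ha]. destruct (H n) as [b Hb]. eexists. apply Cder_mult; eauto.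
Qed.

Lemma Cprod_ext h g n : (forall k, h k = g k) -> Cprod h n = Cprod g n.
Proof. intros E. induction n; simpl; auto. now rewrite IHn, E. Qed.

Lemma Cprod_const a n : Cprod (fun _ => a) n = (a ^ n)%C.
Proof. induction n; simpl; auto. rewrite IHn. ring. Qed.

(** The maximum principle for the product of the [N] rotated copies of [H], a function whose value
    at 0 is [H 0 ^ N]. *)
Lemma roots_of_unity_max H N : (forall w, Cmod w < 2 -> exists l, Cder H w l) ->
  exists t, 0 <= t <= 2 * PI /\
    Cmod (H 0) ^ N <= Cmod (Cprod (fun k => H (cis (t + INR k * (2 * PI / INR N)))) N).
Proof.
  intros HD.
  destruct (circle_max (fun w => Cprod (fun k => H (w * cis (INR k * (2 * PI / INR N)))%C) N)) as [t [Ht K]].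
  - intros w Hw. apply (Cder_Cprod (fun k w => H (w * cis (INR k * (2 * PI / INR N)))%C)). intros k.
    destruct (HD (w * cis (INR k * (2 * PI / INR N)))%C) as [l Hl].
    { rewrite Cmod_mult, Cmod_cis. lra. }
    eexists. apply (Cder_comp H (fun w => w * cis (INR k * (2 * PI / INR N)))%C); eauto.
    apply Cder_mult. apply Cder_id. apply Cder_const.
  - exists t. split; auto.
    rewrite (Cprod_ext _ (fun _ => H 0)), Cprod_const, Cmod_pow in K.
    2:{ intros k. f_equal. ring. }
    eapply Rle_trans. exact K. right. f_equal. apply Cprod_ext. intros k. now rewrite cis_plus.
Qed.

(* A Jensen-type inequality, obtained without integrating [log |H|]: the product of [H] over rotated
   roots of unity is bounded by its maximum on the circle. *)
Lemma jensen_log_plus H : (forall w, Cmod w < 2 -> exists l, Cder H w l) ->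
  log_plus (Cmod (H 0)) <= RInt (fun t => log_plus (Cmod (H (cis t)))) 0 (2 * PI) / (2 * PI).
Proof.
  intros HD. set (u := fun t => log_plus (Cmod (H (cis t)))).
  assert (P := PI_RGT_0).
  assert (Hu : forall t, continuous u t).
  { intros t. apply continuous_log_plus. apply (cts_comp H cis). 2: apply cts_cis.
    destruct (HD (cis t)) as [l Hl]. rewrite Cmod_cis; lra. now apply Cder_cont in Hl. }
  assert (Hp : forall t, u (t + 2 * PI) = u t) by (intros t; unfold u; now rewrite cis_2PI).
  assert (HI : 0 <= RInt u 0 (2 * PI) / (2 * PI)).
  { apply Rmult_le_pos. apply RInt_ge_0. lra. now apply ex_RInt_cont. intros; apply log_plus_ge_0.
    left. apply Rinv_0_lt_compat. lra. }
  apply le_epsilon. intros eps He.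
  destruct (riemann_sum_periodic u eps He Hu Hp) as [N [HN K]].
  destruct (roots_of_unity_max H N HD) as [t [Ht Q]].
  specialize (K t Ht). set (s := Rsum (fun k => u (t + INR k * (2 * PI / INR N))) N) in *.
  assert (HN' : 0 < INR N) by now apply lt_0_INR.
  assert (Q2 : Cmod (H 0) ^ N <= exp s).
  { eapply Rle_trans. exact Q. apply Cmod_Cprod_exp_le. intros k. unfold u. rewrite exp_log_plus. apply Rmax_r. }
  apply Rabs_le_between in K.
  apply Rle_trans with (s / INR N). 2: lra.
  assert (Hs : 0 <= s / INR N).
  { apply Rmult_le_pos. 2: left; now apply Rinv_0_lt_compat.
    unfold s. clear. generalize N at 2. induction N0; simpl. lra.
    assert (0 <= u (t + INR N0 * (2 * PI / INR N))) by apply log_plus_ge_0. lra. }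
  apply log_plus_le_iff; auto.
  destruct (Rle_dec (Cmod (H 0)) 0) as [L|L]. { apply Rle_trans with (1 := L). left; apply exp_pos. }
  rewrite <- (exp_ln (Cmod (H 0))) by lra.
  assert (E : ln (Cmod (H 0)) <= s / INR N).
  { apply Rmult_le_reg_r with (INR N); auto. unfold Rdiv. rewrite Rmult_assoc, Rinv_l, Rmult_1_r by lra.
    rewrite Rmult_comm, <- ln_pow by lra. rewrite <- (ln_exp s). apply ln_le; auto. apply pow_lt. lra. }
  destruct E as [E| ->]; [left; now apply exp_increasing|lra].
Qed.

(* The argument of [(e^it + a) / (1 + a e^it)]; its derivative is the Poisson kernel, at least 1/3 for
   [a <= 1/2]. *)
Definition theta (a t : R) : R := t - 2 * atan (a * sin t / (1 + a * cos t)).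

Lemma theta_den a t : 0 <= a <= 1/2 -> 0 < 1 + a * cos t.
Proof. intros Ha. generalize (COS_bound t). nra. Qed.

Lemma theta_den2 a t : 0 <= a <= 1/2 -> 0 < 1 + 2 * a * cos t + a * a.
Proof. intros Ha. generalize (COS_bound t). nra. Qed.

Lemma is_derive_theta a t : 0 <= a <= 1/2 ->
  is_derive (theta a) t ((1 - a * a) / (1 + 2 * a * cos t + a * a)).
Proof.
  intros Ha. assert (H1 := theta_den a t Ha). assert (H2 := theta_den2 a t Ha).
  unfold theta.
  assert (Hq : is_derive (fun t => a * sin t / (1 + a * cos t)) t
     ((a * cos t * (1 + a * cos t) + a * sin t * (a * sin t)) / (1 + a * cos t)^2)).
  { auto_derive. lra. field. lra. }
  assert (Hat : is_derive atan (a * sin t / (1 + a * cos t)) (/ (1 + (a * sin t / (1 + a * cos t))^2))).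
  { apply is_derive_Reals. apply derivable_pt_lim_atan. }
  assert (Hc := is_derive_comp atan _ t _ _ Hat Hq).
  assert (Hm := is_derive_minus (V := R_NormedModule) (fun t => t) _ t _ _ (is_derive_id t) (is_derive_scal _ _ 2 _ Hc)).
  replace ((1 - a * a) / (1 + 2 * a * cos t + a * a)) with
    (minus 1 (2 * scal ((a * cos t * (1 + a * cos t) + a * sin t * (a * sin t)) / (1 + a * cos t) ^ 2)
             (/ (1 + (a * sin t / (1 + a * cos t)) ^ 2)))). exact Hm.
  unfold minus, plus, opp, scal; simpl. unfold mult; simpl.
  assert (E : sin t * sin t = 1 - cos t * cos t). { generalize (sin2_cos2 t). unfold Rsqr. lra. }
  assert (E3 : (1 + a * cos t) * (1 + a * cos t) + (a * sin t) * (a * sin t) = 1 + 2 * a * cos t + a * a).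
  { replace (a * sin t * (a * sin t)) with (a * a * (sin t * sin t)) by ring. rewrite E. ring. }
  replace (a * cos t * (1 + a * cos t) + a * sin t * (a * sin t)) with (a * cos t + a * a).
  2:{ replace (a * sin t * (a * sin t)) with (a * a * (sin t * sin t)) by ring. rewrite E. ring. }
  replace (1 + a * sin t / (1 + a * cos t) * (a * sin t / (1 + a * cos t) * 1)) with
    ((1 + 2 * a * cos t + a * a) / ((1 + a * cos t) * (1 + a * cos t))).
  2:{ rewrite <- E3. field. lra. }
  field. lra.
Qed.

(** The numerator is [cis t] times the conjugate of the denominator [D], so the quotient is [cis t]
    turned back by twice the argument of [D]; that argument is an arctangent because [D] has
    positive real part. *)
Lemma cis_theta a t : 0 <= a <= 1/2 ->
  ((cis t + RtoC a) / (1 + RtoC a * cis t))%C = cis (theta a t).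
Proof.
  intros Ha. assert (H1 := theta_den a t Ha). set (x := 1 + a * cos t) in *. set (y := a * sin t).
  assert (Hxy : 0 < x * x + y * y) by nra.
  set (D := (x, y) : C).
  assert (ED : (1 + RtoC a * cis t)%C = D).
  { unfold D, x, y, cis, RtoC, Cmult, Cplus; simpl. f_equal; ring. }
  set (s := sqrt (x*x + y*y)). assert (Hs : 0 < s) by now apply sqrt_lt_R0.
  assert (Hss : s * s = x * x + y * y) by (apply sqrt_def; lra).
  assert (Eq : D = (RtoC s * cis (atan (y / x)))%C).
  { assert (Hsq : sqrt (1 + (y/x)²) = s / x).
    { apply Rsqr_inj. apply sqrt_pos. left; now apply Rdiv_lt_0_compat.
      rewrite Rsqr_sqrt. 2: unfold Rsqr; nra. unfold Rsqr.
      replace (s / x * (s / x)) with (s * s / (x * x)) by (field; lra). rewrite Hss. field. lra. }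
    unfold D, cis, Cmult, RtoC; simpl. rewrite cos_atan, sin_atan, Hsq. f_equal; field; lra. }
  assert (ND : D <> RtoC 0). { rewrite <- ED. intros E. rewrite ED in E. unfold D in E. injection E. lra. }
  rewrite ED.
  assert (En : (cis t + RtoC a)%C = (cis t * (RtoC s * cis (- atan (y/x))))%C).
  { replace (RtoC s * cis (- atan (y/x)))%C with (Cconj D).
    - unfold D, x, y, cis, Cconj, Cmult, Cplus, RtoC; simpl.
      assert (E : sin t * sin t = 1 - cos t * cos t). { generalize (sin2_cos2 t). unfold Rsqr. lra. }
      f_equal; ring_simplify.
      replace (a * sin t ^ 2) with (a * (sin t * sin t)) by ring. rewrite E. ring. ring.
    - rewrite Eq. unfold cis, Cconj, Cmult, RtoC; simpl. rewrite cos_neg, sin_neg. f_equal; ring. }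
  rewrite En, Eq. replace (theta a t) with (t + (- atan (y/x) + - atan (y/x))).
  2:{ unfold theta. fold x y. ring. }
  rewrite !cis_plus, (cis_opp (atan (y/x))).
  assert (N1 : RtoC s <> RtoC 0). { intros E. apply RtoC_inj in E. lra. }
  assert (N2 : cis (atan (y/x)) <> RtoC 0). { apply Cmod_gt_0. rewrite Cmod_cis. lra. }
  field. auto.
Qed.

(** After the substitution [s = al + theta a t] the integrals differ by the weight [dt], which is at
    least [(1 - a) / (1 + a)], hence the factor 3. *)
Lemma poisson_comparison (U : R -> R) (a al : R) : 0 <= a <= 1/2 -> (forall t, continuous U t) ->
  (forall t, U (t + 2 * PI) = U t) -> (forall t, 0 <= U t) ->
  RInt (fun t => U (al + theta a t)) 0 (2 * PI) <= 3 * RInt U 0 (2 * PI).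
Proof.
  intros Ha HU Hp Hpos. assert (P := PI_RGT_0).
  set (dt := fun t => (1 - a * a) / (1 + 2 * a * cos t + a * a)).
  assert (Hdt : forall t, is_derive (fun t => al + theta a t) t (dt t)).
  { intros t. assert (H := is_derive_plus (V := R_NormedModule) (fun _ => al) (theta a) t _ _ (is_derive_const al t) (is_derive_theta a t Ha)).
    replace (dt t) with (plus zero ((1 - a * a) / (1 + 2 * a * cos t + a * a))). exact H.
    unfold plus, zero; simpl. unfold dt. ring. }
  assert (Hcdt : forall t, continuous dt t).
  { intros t. apply (ex_derive_continuous (K := R_AbsRing) (V := R_NormedModule) dt). unfold dt. auto_derive.
    generalize (theta_den2 a t Ha). lra. }
  assert (Hct : forall t, continuous (fun t => al + theta a t) t).
  { intros t. apply (ex_derive_continuous (K := R_AbsRing) (V := R_NormedModule) (fun t => al + theta a t)). eexists; apply Hdt. }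
  assert (Hcomp : forall t, continuous (fun t => U (al + theta a t)) t).
  { intros t. apply (continuous_comp (fun t => al + theta a t) U); auto. }
  assert (E := RInt_comp (V := R_CompleteNormedModule) U (fun t => al + theta a t) dt 0 (2*PI) (fun x _ => HU _) (fun x _ => conj (Hdt x) (Hcdt x))).
  cbv beta in E. replace (al + theta a (2*PI)) with (al + theta a 0 + 2 * PI) in E.
  2:{ unfold theta. rewrite sin_0, cos_0, sin_2PI, cos_2PI. ring. }
  rewrite periodic_integral in E; auto. rewrite <- E.
  assert (Hc3 : forall t, continuous (fun y => scal (dt y) (U (al + theta a y))) t).
  { intros t. apply (continuous_scal (V := R_NormedModule)); auto. }
  rewrite <- (RInt_scal (V := R_CompleteNormedModule)). 2: now apply ex_RInt_cont.
  apply RInt_le. lra. now apply ex_RInt_cont. apply (ex_RInt_scal (V := R_NormedModule)). now apply ex_RInt_cont.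
  intros t _. unfold scal; simpl; unfold mult; simpl.
  assert (1/3 <= dt t).
  { unfold dt. generalize (theta_den2 a t Ha). intros H. apply Rmult_le_reg_r with (1 + 2 * a * cos t + a * a); auto.
    replace ((1 - a * a) / (1 + 2 * a * cos t + a * a) * (1 + 2 * a * cos t + a * a)) with (1 - a * a) by (field; lra).
    assert (Hcos := COS_bound t). assert (a * cos t <= a * 1) by (apply Rmult_le_compat_l; lra). nra. }
  specialize (Hpos (al + theta a t)). nra.
Qed.

(** An automorphism of the unit disc sending 0 to [a], followed by a rotation and a dilation by [r].
    For [0 < a <= 1/2] its pole [-1/a] has modulus at least 2, so it is holomorphic on the disc of
    radius 2. *)
Definition moebius (r al a : R) (w : C) : C :=
  (RtoC r * cis al * ((w + RtoC a) * / (1 + RtoC a * w)))%C.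

Lemma moebius_Cder r al a w : 0 <= a <= 1/2 -> Cmod w < 2 -> exists l, Cder (moebius r al a) w l.
Proof.
  intros Ha Hw. eexists. unfold moebius. apply Cder_scal. apply Cder_mult.
  - apply Cder_plus. apply Cder_id. apply Cder_const.
  - apply (Cder_comp Cinv (fun w => 1 + RtoC a * w)%C).
    + apply Cder_plus. apply Cder_const. apply Cder_scal. apply Cder_id.
    + apply Cder_inv. intros E.
      assert (H : (RtoC a * w)%C = RtoC (-1)). { replace (RtoC a * w)%C with ((1 + RtoC a * w) - 1)%C by ring. rewrite E. ring. }
      apply (f_equal Cmod) in H. rewrite Cmod_mult, !Cmod_R, (Rabs_pos_eq a), (Rabs_left (-1)) in H by lra.
      generalize (Cmod_ge_0 w). nra.
Qed.

Lemma moebius_0 r al a : moebius r al a 0 = (RtoC (r * a) * cis al)%C.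
Proof.
  unfold moebius. replace (1 + RtoC a * 0)%C with (RtoC 1) by ring. rewrite RtoC_mult.
  field.
Qed.

Lemma moebius_cis r al a t : 0 <= a <= 1/2 -> moebius r al a (cis t) = (RtoC r * cis (al + theta a t))%C.
Proof. intros Ha. rewrite cis_plus, <- cis_theta by auto. unfold moebius, Cdiv. ring. Qed.

Lemma polar_half z r : 0 < r -> Cmod z <= r / 2 -> exists al a, 0 <= a <= 1/2 /\ z = (RtoC (r * a) * cis al)%C.
Proof.
  intros Hr Hz. destruct (Ceq_dec z 0) as [->|N].
  - exists 0, 0. split. lra. rewrite Rmult_0_r. ring.
  - destruct (argument_exists z N) as [t Ht]. exists t, (Cmod z / r). split.
    + split. apply Rmult_le_pos. apply Cmod_ge_0. left; now apply Rinv_0_lt_compat.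
      apply Rmult_le_reg_r with r; auto. unfold Rdiv at 1. rewrite Rmult_assoc, Rinv_l; lra.
    + replace (r * (Cmod z / r)) with (Cmod z) by (field; lra). auto.
Qed.

Lemma Entire_comp_moebius_Cder F r al a w : Entire F -> 0 <= a <= 1/2 -> Cmod w < 2 ->
  exists l, Cder (fun w => F (moebius r al a w)) w l.
Proof.
  intros [F' HF] Ha Hw. destruct (moebius_Cder r al a w Ha Hw) as [l Hl].
  eexists. apply (Cder_comp F (moebius r al a)); eauto.
Qed.

(** Composition with [moebius] moves [z] to the centre, where [circle_max] applies; [a <= 1/2]
    corresponds to [|z| <= r / 2]. *)
Lemma max_modulus F r M z : Entire F -> 0 < r -> (forall t, Cmod (F (RtoC r * cis t)%C) <= M) ->
  Cmod z <= r / 2 -> Cmod (F z) <= M.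
Proof.
  intros HF Hr HM Hz. destruct (polar_half z r Hr Hz) as [al [a [Ha ->]]].
  destruct (circle_max (fun w => F (moebius r al a w))) as [t [_ K]].
  - intros w Hw. now apply Entire_comp_moebius_Cder.
  - rewrite moebius_0, moebius_cis in K by auto. eapply Rle_trans. exact K. apply HM.
Qed.

Lemma proximity_alt F r : proximity F r = RInt (fun t => log_plus (Cmod (F (RtoC r * cis t)%C))) 0 (2 * PI) / (2 * PI).
Proof.
  unfold proximity, Rdiv. rewrite Rmult_comm. f_equal. apply RInt_ext. intros t _. do 3 f_equal.
  unfold cis, Cmult, RtoC; simpl. f_equal; ring.
Qed.

(** Jensen's inequality at the centre for [F] composed with [moebius], after which
    [poisson_comparison] undoes the change of parameter on the circle. *)
Lemma log_plus_le_proximity F r z : Entire F -> 0 < r -> Cmod z <= r / 2 ->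
  log_plus (Cmod (F z)) <= 3 * proximity F r.
Proof.
  intros HF Hr Hz. destruct (polar_half z r Hr Hz) as [al [a [Ha ->]]]. assert (P := PI_RGT_0).
  assert (J := jensen_log_plus (fun w => F (moebius r al a w)) (fun w Hw => Entire_comp_moebius_Cder F r al a w HF Ha Hw)).
  simpl in J. rewrite moebius_0 in J. eapply Rle_trans. exact J. rewrite proximity_alt.
  rewrite (RInt_ext _ (fun t => (fun s => log_plus (Cmod (F (RtoC r * cis s)%C))) (al + theta a t))).
  2:{ intros t _. now rewrite moebius_cis. }
  replace (3 * (RInt (fun t => log_plus (Cmod (F (RtoC r * cis t)%C))) 0 (2 * PI) / (2 * PI))) with
    (3 * RInt (fun t => log_plus (Cmod (F (RtoC r * cis t)%C))) 0 (2 * PI) / (2 * PI)) by (field; lra).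
  apply Rmult_le_compat_r. left; apply Rinv_0_lt_compat; lra.
  apply (poisson_comparison (fun s => log_plus (Cmod (F (RtoC r * cis s)%C)))); auto.
  - intros t. apply continuous_log_plus. apply (cts_comp F (fun t => RtoC r * cis t)%C). now apply Entire_cont.
    apply cts_mult. apply cts_const. apply cts_cis.
  - intros t. now rewrite cis_2PI.
  - intros t. apply log_plus_ge_0.
Qed.

(** Pointwise [max(1, |E|) |G| <= e^B], because [E G = F]. Multiplied over rotated roots of unity,
    with the product of [|G|] bounded below by [|G 0| ^ N], this gives the estimate without dividing
    by values of [G] on the circle. *)
Lemma proximity_quotient (E F G : C -> C) r B : Entire E -> Entire G -> 0 < r ->
  (forall z, F z = (E z * G z)%C) -> G 0 <> RtoC 0 ->
  (forall t, Cmod (F (RtoC r * cis t)%C) <= exp B) -> (forall t, Cmod (G (RtoC r * cis t)%C) <= exp B) ->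
  proximity E r <= B - ln (Cmod (G 0)).
Proof.
  intros HE HG Hr HF HG0 BF BG. assert (P := PI_RGT_0).
  set (u := fun t => log_plus (Cmod (E (RtoC r * cis t)%C))).
  assert (Hu : forall t, continuous u t).
  { intros t. apply continuous_log_plus. apply (cts_comp E (fun t => RtoC r * cis t)%C). now apply Entire_cont.
    apply cts_mult. apply cts_const. apply cts_cis. }
  assert (Hp : forall t, u (t + 2 * PI) = u t) by (intros t; unfold u; now rewrite cis_2PI).
  rewrite proximity_alt. fold u. apply le_epsilon. intros eps He.
  destruct (riemann_sum_periodic u eps He Hu Hp) as [N [HN K]].
  destruct (roots_of_unity_max (fun w => G (RtoC r * w)%C) N) as [t [Ht Q]].
  { intros w _. destruct HG as [G' HG]. eexists. apply (Cder_comp G (fun w => RtoC r * w)%C).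
    apply Cder_scal. apply Cder_id. apply HG. }
  rewrite Cmult_0_r in Q.
  specialize (K t Ht). apply Rabs_le_between in K.
  assert (HN' : 0 < INR N) by now apply lt_0_INR.
  assert (G0 : 0 < Cmod (G 0)) by now apply Cmod_gt_0.
  assert (W : forall n, exp (Rsum (fun k => u (t + INR k * (2 * PI / INR N))) n) *
     Cmod (Cprod (fun k => G (RtoC r * cis (t + INR k * (2 * PI / INR N)))%C) n) <= exp (INR n * B)).
  { induction n.
    - simpl. rewrite Rmult_0_l, exp_0, Cmod_1. lra.
    - rewrite S_INR. simpl Rsum. simpl Cprod. set (x := t + INR n * (2 * PI / INR N)) in *.
      rewrite Rmult_plus_distr_r, Rmult_1_l, !exp_plus, Cmod_mult.
      match goal with |- ?a * ?b * (?c * ?d) <= _ => replace (a * b * (c * d)) with ((a * c) * (b * d)) by ring end.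
      apply Rmult_le_compat; auto.
      + apply Rmult_le_pos. left; apply exp_pos. apply Cmod_ge_0.
      + apply Rmult_le_pos. left; apply exp_pos. apply Cmod_ge_0.
      + unfold u. rewrite exp_log_plus. unfold Rmax. destruct Rle_dec.
        * rewrite <- Cmod_mult, <- HF. apply BF.
        * rewrite Rmult_1_l. apply BG. }
  specialize (W N). set (s := Rsum (fun k => u (t + INR k * (2 * PI / INR N))) N) in *.
  assert (W2 : exp s * Cmod (G 0) ^ N <= exp (INR N * B)).
  { eapply Rle_trans. 2: exact W. apply Rmult_le_compat_l. left; apply exp_pos. exact Q. }
  assert (W3 : s + INR N * ln (Cmod (G 0)) <= INR N * B).
  { rewrite <- (ln_exp (INR N * B)), <- (ln_exp s) at 1. rewrite <- ln_pow by auto.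
    rewrite <- ln_mult. apply ln_le; auto. apply Rmult_lt_0_compat. apply exp_pos. now apply pow_lt.
    apply exp_pos. now apply pow_lt. }
  assert (s / INR N <= B - ln (Cmod (G 0))).
  { apply Rmult_le_reg_r with (INR N); auto. unfold Rdiv. rewrite Rmult_assoc, Rinv_l by lra. lra. }
  lra.
Qed.

(** * Growth, and logarithms of zero-free functions of finite order *)

(** Finite order in terms of the maximum modulus. Using [1 + Cmod z] lets the bound hold at every
    point, which makes shifts and differences easy to handle. *)
Definition exp_growth (F : C -> C) : Prop :=
  exists K M, 0 <= K /\ forall z, Cmod (F z) <= exp (K * (1 + Cmod z) ^ M).

Lemma exp_le x y : x <= y -> exp x <= exp y.
Proof. intros [H| ->]. left. now apply exp_increasing. lra. Qed.

Lemma exp_le_inv x y : exp x <= exp y -> x <= y.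
Proof. intros [H|H]. left. now apply exp_lt_inv. right. now apply exp_inv. Qed.

Lemma one_le_pow_Cmod z M : 1 <= (1 + Cmod z) ^ M.
Proof. apply pow_R1_Rle. generalize (Cmod_ge_0 z). lra. Qed.

Lemma pow_scale_le x y c M : 0 <= x -> x <= c * y -> x ^ M <= c ^ M * y ^ M.
Proof. intros Hx H. rewrite <- Rpow_mult_distr. apply pow_incr. lra. Qed.

Lemma exp_growth_common F G : exp_growth F -> exp_growth G -> exists K M, 0 <= K /\
  forall z, Cmod (F z) <= exp (K * (1 + Cmod z) ^ M) /\ Cmod (G z) <= exp (K * (1 + Cmod z) ^ M).
Proof.
  intros [K1 [M1 [H1 B1]]] [K2 [M2 [H2 B2]]].
  exists (K1 + K2), (M1 + M2)%nat. split. lra. intros z.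
  assert (P1 := one_le_pow_Cmod z M1). assert (P2 := one_le_pow_Cmod z M2).
  rewrite pow_add. set (x := (1 + Cmod z) ^ M1) in *. set (y := (1 + Cmod z) ^ M2) in *.
  split; [eapply Rle_trans; [apply B1|]|eapply Rle_trans; [apply B2|]]; apply exp_le; fold x y.
  - assert (x <= x * y) by nra. assert (0 <= K2 * (x * y)) by (apply Rmult_le_pos; nra). nra.
  - assert (y <= x * y) by nra. assert (0 <= K1 * (x * y)) by (apply Rmult_le_pos; nra). nra.
Qed.

Lemma exp_growth_shift F a : exp_growth F -> exp_growth (fun z => F (z + a)%C).
Proof.
  intros [K [M [HK B]]]. exists (K * (1 + Cmod a) ^ M), M. split.
  { apply Rmult_le_pos; auto. apply pow_le. generalize (Cmod_ge_0 a). lra. }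
  intros z. eapply Rle_trans. apply B. apply exp_le. rewrite Rmult_assoc. apply Rmult_le_compat_l; auto.
  assert (0 <= Cmod z) by apply Cmod_ge_0. assert (0 <= Cmod a) by apply Cmod_ge_0.
  apply pow_scale_le. generalize (Cmod_ge_0 (z + a)); lra.
  generalize (Cmod_triangle z a). nra.
Qed.

Lemma exp_growth_minus F G : exp_growth F -> exp_growth G -> exp_growth (fun z => F z - G z)%C.
Proof.
  intros HF HG. destruct (exp_growth_common F G HF HG) as [K [M [HK B]]].
  exists (K + 1), M. split. lra. intros z. destruct (B z) as [B1 B2].
  assert (P := one_le_pow_Cmod z M). set (x := (1 + Cmod z) ^ M) in *.
  eapply Rle_trans. apply Cmod_triangle_minus. rewrite Rmult_plus_distr_r, Rmult_1_l, exp_plus.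
  assert (0 < exp (K * x)) by apply exp_pos.
  assert (1 + x <= exp x). { left. apply exp_ineq1. lra. } nra.
Qed.

Lemma exp_growth_quotient_0 (E F G : C -> C) : Entire E -> Entire G -> (forall z, F z = (E z * G z)%C) ->
  G 0 <> RtoC 0 -> exp_growth F -> exp_growth G -> exp_growth E.
Proof.
  intros HE HG HF HG0 GF GG. destruct (exp_growth_common F G GF GG) as [K [M [HK B]]].
  set (l := Rabs (ln (Cmod (G 0)))). assert (Hl : 0 <= l) by apply Rabs_pos.
  exists (3 * (K * 2 ^ M + l)), M.
  assert (P2 : 0 <= 2 ^ M) by (apply pow_le; lra).
  assert (PK : 0 <= K * 2 ^ M) by nra.
  split. lra.
  intros z. assert (P := one_le_pow_Cmod z M). assert (Hz := Cmod_ge_0 z).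
  apply log_plus_le_iff. apply Rmult_le_pos; lra.
  (* Puts [z] in the inner half of the disc of radius [r], where [log_plus_le_proximity] applies. *)
  set (r := 2 * Cmod z + 1).
  assert (Hr : 0 < r) by (unfold r; lra).
  eapply Rle_trans. apply (log_plus_le_proximity E r z); auto. unfold r; lra.
  rewrite Rmult_assoc. apply Rmult_le_compat_l. lra.
  assert (Em : forall t, Cmod (RtoC r * cis t) = r).
  { intros t. rewrite Cmod_mult, Cmod_cis, Cmod_R, Rabs_pos_eq; lra. }
  eapply Rle_trans. apply (proximity_quotient E F G r (K * (1 + r) ^ M)); auto.
  - intros t. rewrite <- (Em t) at 2. apply B.
  - intros t. rewrite <- (Em t) at 2. apply B.
  - assert (- ln (Cmod (G 0)) <= l). { unfold l. rewrite <- Rabs_Ropp. apply Rle_abs. }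
    assert ((1 + r) ^ M <= 2 ^ M * (1 + Cmod z) ^ M) by (apply pow_scale_le; unfold r; lra).
    assert (K * (1 + r) ^ M <= K * (2 ^ M * (1 + Cmod z) ^ M)) by now apply Rmult_le_compat_l.
    nra.
Qed.

(** A translation takes a point where [G] is nonzero to the origin, and growth is insensitive to
    translations. *)
Lemma exp_growth_quotient (E F G : C -> C) : Entire E -> Entire G -> (forall z, F z = (E z * G z)%C) ->
  (exists a, G a <> RtoC 0) -> exp_growth F -> exp_growth G -> exp_growth E.
Proof.
  intros HE HG HF [a Ha] GF GG.
  assert (H : exp_growth (fun z => E (z + a)%C)).
  { apply exp_growth_quotient_0 with (fun z => F (z + a)%C) (fun z => G (z + a)%C).
    now apply Entire_shift. now apply Entire_shift. auto. now rewrite Cplus_0_l.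
    now apply exp_growth_shift. now apply exp_growth_shift. }
  apply (exp_growth_shift _ (- a)%C) in H. destruct H as [K [M [HK B]]]. exists K, M. split; auto.
  intros z. specialize (B z). replace (z + - a + a)%C with z in B by ring. auto.
Qed.

(** If no tail were bounded above, every supremum in the definition of the limsup would be
    [p_infty], and so would their infimum. *)
Lemma finite_order_bound f : finite_order f -> exists r0 K, forall r, r0 < r ->
  log_plus (nevanlinna_T f r) / ln r <= K.
Proof.
  intros H. unfold finite_order, order_of_growth, LimSup_p_infty in H.
  set (h := fun r => log_plus (nevanlinna_T f r) / ln r) in *.
  apply NNPP. intros N.
  set (S := fun y : Rbar => exists r0 : R, y = Lub_Rbar (fun x : R => exists r : R, r0 < r /\ x = h r)) in *.
  assert (HS : forall y, S y -> y = p_infty).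
  { intros y [r0 ->]. set (L := Lub_Rbar _). destruct (Lub_Rbar_correct (fun x : R => exists r : R, r0 < r /\ x = h r)) as [Hub _].
    fold L in Hub. destruct L as [K| |]; auto; exfalso.
    - apply N. exists r0, K. intros r Hr. apply (Hub (h r)). now exists r.
    (* The supremum is not [m_infty] because the tail is nonempty. *)
    - apply (Hub (h (r0 + 1))). exists (r0 + 1). split; auto. lra. }
  change (Rbar_lt (Rbar_glb S) p_infty) in H.
  rewrite (Rbar_is_glb_unique S p_infty) in H. exact H.
  split.
  - intros y Hy. rewrite (HS y Hy). simpl. auto.
  - intros b _. destruct b; simpl; auto.
Qed.

Lemma exp_growth_of_finite_order f : Entire f -> finite_order f -> exp_growth f.
Proof.
  intros Hf Ho. destruct (finite_order_bound f Ho) as [r0 [K HK]].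
  destruct (nfloor_ex (Rmax 0 K)) as [m Hm]. apply Rmax_l.
  set (N := S m). assert (HN : K <= INR N). { unfold N. rewrite S_INR. generalize (Rmax_r 0 K). lra. }
  (* Beyond [r0] for the order bound, and beyond 1 to make [ln r] positive. *)
  set (r1 := Rmax r0 1 + 1). assert (Hr1 : r0 < r1 /\ 1 < r1). { unfold r1. generalize (Rmax_l r0 1) (Rmax_r r0 1). lra. }
  exists (3 * (r1 + 2) ^ N), N. split. apply Rmult_le_pos. lra. apply pow_le. lra.
  intros z. assert (Hz := Cmod_ge_0 z). set (r := 2 * Cmod z + r1).
  assert (P : 0 <= (r1 + 2) ^ N * (1 + Cmod z) ^ N) by (apply Rmult_le_pos; apply pow_le; lra).
  apply log_plus_le_iff. lra.
  eapply Rle_trans. apply (log_plus_le_proximity f r z); auto; unfold r; lra.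
  rewrite Rmult_assoc. apply Rmult_le_compat_l. lra.
  apply Rle_trans with (r ^ N).
  2:{ apply pow_scale_le; unfold r; nra. }
  assert (Hr : 1 < r) by (unfold r; lra).
  assert (Hl : 0 < ln r). { rewrite <- ln_1. apply ln_increasing; lra. }
  specialize (HK r ltac:(unfold r; lra)).
  assert (H : log_plus (proximity f r) <= INR N * ln r).
  { apply Rle_trans with (K * ln r). 2: apply Rmult_le_compat_r; lra.
    apply Rmult_le_reg_r with (/ ln r). now apply Rinv_0_lt_compat.
    rewrite Rmult_assoc, Rinv_r, Rmult_1_r by lra. exact HK. }
  apply log_plus_le_iff in H. 2: apply Rmult_le_pos; [apply pos_INR|lra].
  rewrite <- ln_pow in H by lra. rewrite exp_ln in H. auto. apply pow_lt. lra.
Qed.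

(** * Polynomials characterised by growth, and polynomial logarithms *)

Fixpoint Csum (u : nat -> C) (n : nat) : C :=
  match n with O => RtoC 0 | S m => (Csum u m + u m)%C end.

Lemma Csum_ext u v n : (forall k, (k < n)%nat -> u k = v k) -> Csum u n = Csum v n.
Proof. intros H. induction n; simpl; auto. rewrite IHn, H; auto. Qed.

Lemma Csum_scal a u n : Csum (fun k => a * u k)%C n = (a * Csum u n)%C.
Proof. induction n; simpl. ring. rewrite IHn. ring. Qed.

Lemma Csum_shift u n : Csum u (S n) = (u O + Csum (fun k => u (S k)) n)%C.
Proof. induction n. simpl. ring. simpl in *. rewrite IHn. ring. Qed.

(** Liouville's theorem is the case [M = 0]. Dividing [F - F 0] by [z] lowers the exponent by one
    outside the unit disc; inside it the quotient is bounded by compactness. *)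
Lemma polynomial_growth_polynomial M : forall F K, Entire F ->
  (forall z, Cmod (F z) <= K * (1 + Cmod z) ^ M) ->
  exists a, forall z, F z = Csum (fun k => a k * z ^ k)%C (S M).
Proof.
  induction M; intros F K HF HB.
  - destruct HF as [F' HD]. exists (fun _ => F 0). intros z. simpl.
    replace (0 + F 0 * 1)%C with (F 0) by ring. apply zero_deriv_const.
    intros w. apply Cder_eq with (1 := HD w). apply Cmod_eq_0. apply Rle_antisym. 2: apply Cmod_ge_0.
    apply le_epsilon. intros eps He. rewrite Rplus_0_l.
    set (K' := Rmax K 1). assert (HK' : 1 <= K') by apply Rmax_r. assert (K <= K') by apply Rmax_l.
    simpl in HB.
    assert (C1 := cauchy_estimate F F' w (2 * K' / eps) (2 * K') HD).
    assert (Hr : 0 < 2 * K' / eps) by (apply Rdiv_lt_0_compat; lra).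
    specialize (C1 Hr). apply Rmult_le_reg_l with (2 * K' / eps); auto.
    replace (2 * K' / eps * eps) with (2 * K') by (field; lra). apply C1.
    intros t. eapply Rle_trans. apply Cmod_triangle_minus.
    generalize (HB (w + RtoC (2 * K' / eps) * cis t)%C) (HB w). lra.
  - destruct (Entire_division (fun z => F z - F 0)%C 0) as [F1 [H1 E1]].
    { apply Entire_minus; auto. apply Entire_const. } { ring. }
    destruct (Entire_bounded_disc F1 1 H1) as [B [HB0 HB1]].
    set (K' := Rmax K 1). assert (HK' : 1 <= K') by apply Rmax_r. assert (HKK : K <= K') by apply Rmax_l.
    destruct (IHM F1 (4 * K' + B) H1) as [a Ha].
    { intros z. assert (P := one_le_pow_Cmod z M). destruct (Rle_dec (Cmod z) 1) as [L|L].
      - specialize (HB1 z L). nra.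
      - apply Rmult_le_reg_l with (Cmod z). lra. rewrite <- Cmod_mult.
        replace (z * F1 z)%C with (F z - F 0)%C by (rewrite E1; ring).
        eapply Rle_trans. apply Cmod_triangle_minus.
        assert (B1 := HB z). assert (B2 := HB 0). simpl in B1, B2. rewrite Cmod_0, Rplus_0_r, pow1, Rmult_1_r in B2.
        set (x := (1 + Cmod z) ^ M) in *.
        apply Rle_trans with (K' * ((1 + Cmod z) * x) + K').
        { apply Rplus_le_compat. eapply Rle_trans. apply B1. apply Rmult_le_compat_r. nra. lra. lra. }
        assert (K' <= K' * x) by nra.
        assert (T1 : (1 + Cmod z) * x <= 2 * Cmod z * x) by nra.
        assert (T2 : K' * ((1 + Cmod z) * x) <= K' * (2 * Cmod z * x)) by (apply Rmult_le_compat_l; lra).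
        assert (T3 : 0 <= Cmod z * (B * x)) by (apply Rmult_le_pos; nra).
        assert (T4 : K' * x <= K' * (Cmod z * x)) by (apply Rmult_le_compat_l; nra).
        nra. }
    exists (fun k => match k with O => F 0 | S k => a k end). intros z.
    rewrite Csum_shift. rewrite (Csum_ext _ (fun k => z * (a k * z ^ k))%C).
    2:{ intros k _. simpl. ring. }
    rewrite Csum_scal, <- Ha. simpl. transitivity (F 0 + (F z - F 0))%C. ring. rewrite E1. ring.
Qed.

Lemma CInt_conj k a b : (forall t, cts k t) -> CInt (fun t => Cconj (k t)) a b = Cconj (CInt k a b).
Proof.
  intros Hk. destruct (cts_ex k a b Hk). unfold CInt, Cconj. simpl. f_equal.
  now apply (RInt_opp (V := R_CompleteNormedModule)).
Qed.

(* The circle average of [conj Q * e^{-it}] vanishes when [Q] is holomorphic and [Q = 0] at the centre, so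
   [F'] is controlled by the real part of [F] alone. *)
Lemma deriv_bound_by_real_part F F' z M : derivative_of F F' ->
  (forall t, Rabs (fst (F (z + cis t)%C) - fst (F z)) <= M) -> Cmod (F' z) <= 2 * M.
Proof.
  intros HD HM. assert (P := PI_RGT_0). assert (HF : Entire F) by now exists F'.
  set (Q := fun t => (F (z + RtoC 1 * cis t) - F z)%C).
  assert (HQ : forall t, cts Q t).
  { intros t. apply cts_minus. apply cts_circle. intros; now apply Entire_cont. apply cts_const. }
  assert (E1 := circle_derivative F F' z 1 HD ltac:(lra)). fold Q in E1.
  assert (E2 : CInt (fun t => Q t * cis t)%C 0 (2 * PI) = RtoC 0).
  { transitivity (CInt (fun t => (fun w => (F w - F z) * (w - z)) (z + RtoC 1 * cis t))%C 0 (2 * PI)).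
    - apply CInt_ext. intros t. unfold Q. ring.
    - rewrite (circle_mean_at (fun w => (F w - F z) * (w - z))%C z 1). ring. 2: lra.
      apply Entire_mult; apply Entire_minus; auto; try apply Entire_const; apply Entire_id. }
  assert (E3 : CInt (fun t => Cconj (Q t * cis t))%C 0 (2 * PI) = RtoC 0).
  { rewrite CInt_conj, E2. unfold Cconj, RtoC; simpl. f_equal; ring.
    intros t. apply cts_mult; auto. apply cts_cis. }
  assert (B : Cmod (CInt (fun t => Q t * cis (- t) + Cconj (Q t * cis t))%C 0 (2 * PI)) <= (2 * M) * (2 * PI - 0)).
  { apply CInt_bound_le.
    - intros t. apply cts_plus. apply cts_mult; auto. apply cts_cis_opp.
      apply (cts_conj (fun t => Q t * cis t)%C). apply cts_mult; auto. apply cts_cis.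
    - lra.
    - intros t _. replace (Q t * cis (- t) + Cconj (Q t * cis t))%C with (RtoC (2 * fst (Q t)) * cis (- t))%C.
      + rewrite Cmod_mult, Cmod_cis, Cmod_R, Rabs_mult, (Rabs_pos_eq 2), Rmult_1_r by lra.
        apply Rmult_le_compat_l. lra. unfold Q. rewrite Cmult_1_l. apply HM.
      + unfold cis, Cconj, Cmult, Cplus, RtoC; simpl. rewrite cos_neg, sin_neg. f_equal; ring. }
  rewrite CInt_plus, E3 in B.
  2: intros t; apply cts_mult; auto; apply cts_cis_opp.
  2: intros t; apply (cts_conj (fun t => Q t * cis t)%C); apply cts_mult; auto; apply cts_cis.
  unfold Q in B. rewrite (circle_derivative F F') in B by (auto; lra).
  rewrite Cplus_0_r, Cmult_1_l, Cmod_mult, Cmod_R, Rabs_pos_eq in B by lra. nra.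
Qed.

(** Unit circles turn the bound on the real part of [P] into polynomial growth of [P']. So [P'] is a
    polynomial, and [P] is its termwise primitive. *)
Lemma real_part_growth_polynomial P K M : Entire P -> 0 <= K ->
  (forall z, Rabs (fst (P z)) <= K * (1 + Cmod z) ^ M) ->
  exists a n, forall z, P z = Csum (fun k => a k * z ^ k)%C n.
Proof.
  intros HP HK HB. destruct (HP) as [P' HD].
  assert (HB' : forall z, Cmod (P' z) <= (2 * (K * 2 ^ M + K)) * (1 + Cmod z) ^ M).
  { intros z. rewrite Rmult_assoc. apply (deriv_bound_by_real_part P P'); auto. intros t.
    unfold Rminus. eapply Rle_trans. apply Rabs_triang. rewrite Rabs_Ropp, Rmult_plus_distr_r.
    apply Rplus_le_compat; auto. eapply Rle_trans. apply HB. rewrite Rmult_assoc. apply Rmult_le_compat_l; auto.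
    assert (Hz := Cmod_ge_0 z). assert (T := Cmod_triangle z (cis t)). rewrite Cmod_cis in T.
    apply pow_scale_le; generalize (Cmod_ge_0 (z + cis t)); lra. }
  destruct (polynomial_growth_polynomial M P' _ (deriv_Entire _ _ HD) HB') as [b Hb].
  set (a := fun k => match k with O => P 0 | S k => (b k / RtoC (INR (S k)))%C end).
  exists a, (S (S M)).
  assert (HA : forall n z, Cder (fun z => Csum (fun k => a k * z ^ k)%C (S n)) z (Csum (fun k => b k * z ^ k)%C n)).
  { induction n; intros z.
    - simpl. apply Cder_ext with (fun _ => P 0). intros w. ring. apply Cder_const.
    - change (Cder (fun z => Csum (fun k => a k * z ^ k)%C (S n) + a (S n) * z ^ (S n))%C z
        (Csum (fun k => b k * z ^ k)%C n + b n * z ^ n)%C).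
      apply Cder_plus; auto.
      assert (Hpow : forall m, Cder (fun z => z ^ m)%C z (RtoC (INR m) * z ^ (pred m))%C).
      { induction m. simpl. apply Cder_eq with (1 := Cder_const 1 z). ring.
        rewrite S_INR, RtoC_plus. apply Cder_eq with (1 := Cder_mult _ _ _ _ _ (Cder_id z) IHm).
        destruct m. simpl. ring. simpl. ring. }
      apply Cder_eq with (1 := Cder_scal _ _ _ _ (Hpow (S n))). unfold a. rewrite Nat.pred_succ.
      assert (RtoC (INR (S n)) <> RtoC 0). { intros E. apply RtoC_inj in E. rewrite S_INR in E. generalize (pos_INR n). lra. }
      field. auto. }
  assert (HZ : derivative_of (fun z => P z - Csum (fun k => a k * z ^ k)%C (S (S M)))%C (fun _ => RtoC 0)).
  { intros z. apply Cder_eq with (1 := Cder_minus _ _ _ _ _ (HD z) (HA (S M) z)). rewrite Hb. ring. }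
  intros z. assert (H := zero_deriv_const _ HZ z 0). cbv beta in H.
  assert (E0 : Csum (fun k => a k * 0 ^ k)%C (S (S M)) = P 0).
  { rewrite Csum_shift. rewrite (Csum_ext _ (fun k => 0 * RtoC 0)%C). rewrite Csum_scal. simpl. ring. intros k _. simpl. ring. }
  rewrite E0 in H. apply Ceq_minus. rewrite H. ring.
Qed.

(** Growth of [E] bounds the real part of its logarithm from above, growth of [1 / E] from below. *)
Lemma entire_log_polynomial E : Entire E -> (forall z, E z <> RtoC 0) ->
  exp_growth E -> exp_growth (fun z => / E z)%C ->
  exists a n, forall z, E z = Cexp (Csum (fun k => a k * z ^ k)%C n).
Proof.
  intros HE HN G1 G2. destruct (entire_log E HE HN) as [P [HP EP]].
  destruct (exp_growth_common _ _ G1 G2) as [K [M [HK B]]].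
  destruct (real_part_growth_polynomial P K M HP HK) as [a [n Ha]].
  - intros z. destruct (B z) as [B1 B2]. rewrite Cmod_inv in B2 by auto.
    rewrite EP, Cmod_Cexp in B1, B2. rewrite <- exp_Ropp in B2.
    apply exp_le_inv in B1. apply exp_le_inv in B2. apply Rabs_le. lra.
  - exists a, n. intros z. now rewrite EP, Ha.
Qed.

(** * Multiplicities of zeros of entire functions *)

Lemma infinite_order_zero F a : Entire F ->
  (forall k : nat, exists g, Entire g /\ forall z, F z = ((z - a) ^ k * g z)%C) -> forall z, F z = RtoC 0.
Proof.
  intros HF H z. set (r := 2 * Cmod (z - a) + 1). assert (Hz := Cmod_ge_0 (z - a)).
  assert (Hr : 0 < r) by (unfold r; lra).
  set (F0 := fun w => F (w + a)%C). assert (HF0 : Entire F0) by now apply Entire_shift.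
  destruct (Entire_bounded_disc F0 r HF0) as [M [HM HB]].
  (* On the circle of radius [r] about [a] the cofactor is at most [M / r^k]. The maximum principle
     carries this to [z], and [r >= 2 |z - a|] leaves [M / 2^k]. *)
  assert (K : forall k, Cmod (F z) <= M * (/2) ^ k).
  { intros k. destruct (H k) as [g [Hg Eg]].
    assert (G1 : Cmod (g z) <= M / r ^ k).
    { replace z with (z - a + a)%C at 1 by ring.
      apply (max_modulus (fun w => g (w + a)%C) r); auto. now apply Entire_shift. 2: unfold r; lra.
      intros t. assert (Em : Cmod (RtoC r * cis t) = r).
      { rewrite Cmod_mult, Cmod_cis, Cmod_R, Rabs_pos_eq; lra. }
      assert (Hrk : 0 < r ^ k) by now apply pow_lt.
      apply Rmult_le_reg_l with (r ^ k); auto. replace (r ^ k * (M / r ^ k)) with M by (field; lra).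
      rewrite <- Em at 1. rewrite <- Cmod_pow, <- Cmod_mult.
      replace ((r * cis t) ^ k * g (r * cis t + a))%C with (F0 (RtoC r * cis t)%C).
      apply HB. lra. unfold F0. rewrite Eg. f_equal. f_equal. ring. }
    rewrite Eg, Cmod_mult, Cmod_pow.
    apply Rle_trans with (Cmod (z - a) ^ k * (M / r ^ k)).
    { apply Rmult_le_compat_l; auto. now apply pow_le. }
    replace (Cmod (z - a) ^ k * (M / r ^ k)) with (M * (Cmod (z - a) / r) ^ k).
    2:{ unfold Rdiv. rewrite Rpow_mult_distr, pow_inv. ring. }
    apply Rmult_le_compat_l. lra. apply pow_incr. split.
    apply Rmult_le_pos; auto. left; now apply Rinv_0_lt_compat.
    apply Rmult_le_reg_r with r; auto. unfold Rdiv. rewrite Rmult_assoc, Rinv_l by lra. unfold r. lra. }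
  apply Cmod_eq_0. apply Rle_antisym. 2: apply Cmod_ge_0. apply le_epsilon. intros eps He.
  destruct (pow_half_small M eps He) as [n Hn]. specialize (K n). lra.
Qed.

Lemma finite_multiplicity F a : Entire F -> (exists z, F z <> RtoC 0) ->
  exists (k : nat) g, Entire g /\ g a <> RtoC 0 /\ forall z, F z = ((z - a) ^ k * g z)%C.
Proof.
  intros HF [z0 Hz0]. apply NNPP. intros N. apply Hz0. apply (infinite_order_zero F a HF).
  induction k. exists F. split; auto. intros z; simpl; ring.
  destruct IHk as [g [Hg Eg]]. destruct (Ceq_dec (g a) 0) as [E|E].
  - destruct (Entire_division g a Hg E) as [g1 [H1 E1]]. exists g1. split; auto.
    intros z. rewrite Eg, E1. simpl. ring.
  - elim N. now exists k, g.
Qed.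

(** * Quotients of functions sharing 0 CM, and the difference identity *)

Lemma locally_Cmod (a : C) (Q : C -> Prop) : locally a Q <->
  exists d, 0 < d /\ forall z, Cmod (z - a) < d -> Q z.
Proof.
  split.
  - intros H. apply locally_C in H. destruct H as [d Hd]. exists d. split. apply cond_pos.
    intros z Hz. apply Hd. exact Hz.
  - intros [d [Hd K]]. apply locally_C. exists (mkposreal d Hd). intros z Hz. apply K. exact Hz.
Qed.

Lemma entire_iff_Entire f : entire f <-> Entire f.
Proof.
  split.
  - intros H. apply Entire_pointwise. intros z. apply ex_derive_Cder. apply H.
  - intros [f' H] z. apply ex_derive_Cder. exists (f' z). apply H.
Qed.

Lemma nonzero_near g a : Ccont g a -> g a <> RtoC 0 ->
  exists d, 0 < d /\ forall z, Cmod (z - a) < d -> g z <> RtoC 0.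
Proof.
  intros Hg Ha. destruct (Hg (Cmod (g a))) as [d [Hd K]]. now apply Cmod_gt_0.
  exists d. split; auto. intros z Hz E. specialize (K z Hz). rewrite E, Cmod_minus_sym in K.
  replace (g a - 0)%C with (g a) in K by ring. lra.
Qed.

(** Near each point both functions are the same power of [z - a] times nonvanishing holomorphic
    factors; the ratio of these factors is the local form of [E]. *)
Lemma share_CM_quotient F G : Entire F -> Entire G -> (exists z, F z <> RtoC 0) -> share_0_CM F G ->
  exists E, Entire E /\ (forall z, E z <> RtoC 0) /\ forall z, G z = (E z * F z)%C.
Proof.
  intros HF HG HNz HS.
  (* At a zero of [F] the equation [G = E F] leaves the value open, so the relation also ties [v] to
     a holomorphic germ [e]. Near [a], where [F] is nonzero, division by [F] forces the chosen [E]
     to coincide with [e]. *)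
  destruct (choose_fun (fun a v => v <> RtoC 0 /\ G a = (v * F a)%C /\ exists e l d, 0 < d /\ Cder e a l /\ e a = v /\
    forall z, Cmod (z - a) < d -> z <> a -> F z <> RtoC 0 /\ G z = (e z * F z)%C)) as [E HE].
  - intros a. destruct (finite_multiplicity F a HF HNz) as [k [g [Hg [Hga Eg]]]].
    assert (ZF : zero_mult F a k).
    { exists g. split; [|split]; auto.
      - apply locally_Cmod. exists 1. split. lra. intros z _. apply entire_iff_Entire. auto.
      - apply locally_Cmod. exists 1. split. lra. auto. }
    destruct (proj1 (proj2 (HS a) k) ZF) as [g2 [D2 [N2 E2]]].
    apply locally_Cmod in D2. destruct D2 as [d1 [Hd1 K1]].
    apply locally_Cmod in E2. destruct E2 as [d2 [Hd2 K2]].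
    destruct (nonzero_near g a (Entire_cont g a Hg) Hga) as [d3 [Hd3 K3]].
    exists (g2 a / g a)%C. split; [|split].
    + unfold Cdiv. apply Cmult_neq_0; auto. intros E. assert (K := Cinv_r _ Hga). rewrite E, Cmult_0_r in K.
      apply RtoC_inj in K. lra.
    + rewrite (K2 a). 2: now rewrite Cmod_self. rewrite (Eg a). field. auto.
    + destruct (proj1 (ex_derive_Cder g2 a) (K1 a ltac:(now rewrite Cmod_self))) as [l2 Hl2].
      destruct Hg as [g' Hg'].
      exists (fun z => g2 z * / g z)%C. eexists. exists (Rmin d2 d3).
      split; [now apply Rmin_glb_lt|]. split; [|split].
      * apply Cder_mult. exact Hl2. apply (Cder_comp Cinv g). apply Hg'. now apply Cder_inv.
      * reflexivity.
      * intros z Hz Na. assert (H2 := Rlt_le_trans _ _ _ Hz (Rmin_l _ _)). assert (H3 := Rlt_le_trans _ _ _ Hz (Rmin_r _ _)).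
        specialize (K3 z H3). split.
        { rewrite Eg. apply Cmult_neq_0; auto. apply Cpow_nz. now apply Cminus_eq_contra. }
        rewrite (K2 z H2), Eg. field. auto.
  - exists E. split; [|split].
    + apply Entire_pointwise. intros a. destruct (HE a) as [Na [Ea [e [l [d [Hd [He [Eea K]]]]]]]].
      exists l. apply Cder_ext_loc with e; auto. exists d. split; auto. intros z Hz.
      destruct (Ceq_dec z a) as [->|N]; auto. destruct (K z Hz N) as [NF EG].
      destruct (HE z) as [_ [Ez _]]. rewrite Ez in EG.
      transitivity (e z * F z * / F z)%C. field; auto. rewrite <- EG. field; auto.
    + intros z. apply (HE z).
    + intros z. apply (HE z).
Qed.

Lemma Entire_Delta_n c n : forall f, Entire f -> Entire (Delta_n c n f).
Proof.
  induction n; intros f Hf; simpl; auto. apply IHn. unfold Delta. apply Entire_minus; auto. now apply Entire_shift.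
Qed.

Lemma exp_growth_Delta_n c n : forall f, exp_growth f -> exp_growth (Delta_n c n f).
Proof.
  induction n; intros f Hf; simpl; auto. apply IHn. unfold Delta. apply exp_growth_minus; auto. now apply exp_growth_shift.
Qed.

(** The recursion peels off the innermost difference; here the outermost one is exposed, which turns
    the relation with [e^h] into a rule for the shift by [c]. *)
Lemma Delta_n_succ c n : forall f z, Delta_n c (n + 1) f z = (Delta_n c n f (z + c) - Delta_n c n f z)%C.
Proof. induction n; intros f z; simpl; auto. Qed.

Lemma Csum_minus u v n : Csum (fun k => u k - v k)%C n = (Csum u n - Csum v n)%C.
Proof. induction n; simpl. ring. rewrite IHn. ring. Qed.

(** The coefficients are [(-1)^(n-j) C(n,j)]. Those at [n] and 0 belong to the dominant terms along
    rays; the one at 1 is used when the exponents are linear. *)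
Lemma Delta_n_expansion c n : exists cf : nat -> C,
  cf n = RtoC 1 /\ cf O <> RtoC 0 /\ ((1 <= n)%nat -> cf 1%nat <> RtoC 0) /\
  forall f z, Delta_n c n f z = Csum (fun j => cf j * f (z + RtoC (INR j) * c))%C (S n).
Proof.
  (* Coefficients vanish beyond [n], so that Pascal's rule also holds at the last index. *)
  assert (H : exists cf : nat -> C, (forall k, (n < k)%nat -> cf k = RtoC 0) /\
    cf n = RtoC 1 /\ cf O = (RtoC (-1) ^ n)%C /\ cf 1%nat = (- (RtoC (-1) ^ n) * RtoC (INR n))%C /\
    forall f z, Delta_n c n f z = Csum (fun j => cf j * f (z + RtoC (INR j) * c))%C (S n)).
  { induction n.
    - exists (fun j => match j with O => RtoC 1 | _ => RtoC 0 end). repeat split; simpl; auto.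
      + intros k Hk. destruct k; auto. lia.
      + ring.
      + intros f z. replace (z + 0 * c)%C with z by ring. ring.
    - destruct IHn as [cf [H0 [H1 [H2 [H3 H4]]]]].
      exists (fun j => match j with O => RtoC 0 | S i => cf i end - cf j)%C. split; [|split; [|split; [|split]]].
      + intros k Hk. destruct k. lia. rewrite !H0 by lia. ring.
      + rewrite H1, H0 by lia. ring.
      + rewrite H2. simpl. ring.
      + rewrite H2, H3, S_INR, RtoC_plus. simpl. ring.
      + intros f z. rewrite <- Nat.add_1_r at 1. rewrite Delta_n_succ, !H4. symmetry.
        rewrite (Csum_ext _ (fun j => match j with O => RtoC 0 | S i => cf i end * f (z + RtoC (INR j) * c)
           - cf j * f (z + RtoC (INR j) * c))%C) by (intros; ring).
        rewrite Csum_minus. f_equal.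
        * rewrite (Csum_shift _ (S n)). rewrite Cmult_0_l, Cplus_0_l. apply Csum_ext. intros k _.
          rewrite S_INR, RtoC_plus. do 2 f_equal. ring.
        * change (Csum (fun j => cf j * f (z + RtoC (INR j) * c)) (S n) + cf (S n) * f (z + RtoC (INR (S n)) * c) =
            Csum (fun j => cf j * f (z + RtoC (INR j) * c)) (S n))%C.
          rewrite H0 by lia. ring. }
  assert (Nm : forall m, (RtoC (-1) ^ m)%C <> RtoC 0).
  { intros m. apply Cpow_nz. intros E. apply RtoC_inj in E. lra. }
  destruct H as [cf [H0 [H1 [H2 [H3 H4]]]]]. exists cf. repeat split; auto.
  - rewrite H2. apply Nm.
  - intros Hn. rewrite H3. apply Cmult_neq_0.
    + intros E. apply (Nm n). replace (RtoC (-1) ^ n)%C with (- - (RtoC (-1) ^ n))%C by ring. rewrite E. ring.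
    + intros E. apply RtoC_inj in E. apply (lt_0_INR n) in Hn. lra.
Qed.

(** If [T a] were nonzero, then [T] would be nonzero around [a], while [g] is a power of [z - a]
    times a factor nonzero near [a]; the product would be nonzero at a point just beside [a]. *)
Lemma zero_product T g : (forall z, Ccont T z) -> Entire g -> (exists z, g z <> RtoC 0) ->
  (forall z, (T z * g z)%C = RtoC 0) -> forall z, T z = RtoC 0.
Proof.
  intros HT Hg HN HP a. destruct (finite_multiplicity g a Hg HN) as [k [g1 [H1 [N1 E1]]]].
  destruct (Ceq_dec (T a) 0) as [|N]; auto. exfalso.
  destruct (nonzero_near T a (HT a) N) as [d [Hd K]].
  destruct (nonzero_near g1 a (Entire_cont _ a H1) N1) as [d1 [Hd1 K1]].
  assert (Hm : 0 < Rmin d d1) by now apply Rmin_glb_lt.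
  set (h := Rmin d d1 / 2). set (z := (a + RtoC h)%C).
  assert (Ez : (z - a)%C = RtoC h) by (unfold z; ring).
  assert (Hz : Cmod (z - a) = h). { rewrite Ez, Cmod_R, Rabs_pos_eq; unfold h; lra. }
  assert (M1 := Rmin_l d d1). assert (M2 := Rmin_r d d1).
  specialize (HP z). rewrite E1 in HP. revert HP. apply Cmult_neq_0.
  - apply K. rewrite Hz. unfold h. lra.
  - apply Cmult_neq_0. apply Cpow_nz. rewrite Ez. intros E. apply RtoC_inj in E. unfold h in E. lra.
    apply K1. rewrite Hz. unfold h. lra.
Qed.

Lemma Entire_Cprod (h : nat -> C -> C) n : (forall k, Entire (h k)) -> Entire (fun z => Cprod (fun k => h k z) n).
Proof. intros H. induction n; simpl. apply Entire_const. now apply Entire_mult. Qed.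

Lemma Entire_Csum (h : nat -> C -> C) n : (forall k, Entire (h k)) -> Entire (fun z => Csum (fun k => h k z) n).
Proof. intros H. induction n; simpl. apply Entire_const. now apply Entire_plus. Qed.

Lemma Cexp_neg z : Cexp (- z) = (/ Cexp z)%C.
Proof.
  assert (H1 := Cexp_opp z). assert (H2 := Cexp_neq_0 z).
  transitivity (Cexp (- z) * Cexp z * / Cexp z)%C. field; auto. rewrite H1. ring.
Qed.

(** The identity is first obtained multiplied by [g z]; [zero_product] cancels this factor, also at
    its zeros. *)
Lemma difference_identity c n f P h (cf : nat -> C) : Entire f -> Entire P -> Entire h -> (exists z, f z <> RtoC 0) ->
  (forall z, Delta_n c n f z = Cexp (P z) * f z)%C ->
  (forall z, Delta_n c (n + 1) f z = Cexp (h z) * Delta_n c n f z)%C ->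
  (forall f z, Delta_n c n f z = Csum (fun j => cf j * f (z + RtoC (INR j) * c))%C (S n)) ->
  forall z, Csum (fun j => cf j * (Cprod (fun i => 1 + Cexp (h (z + RtoC (INR i) * c))) j *
     Cexp (- P (z + RtoC (INR j) * c))))%C (S n) = RtoC 1.
Proof.
  intros Hf HP Hh [z0 Hz0] E1 E2 Hcf.
  set (g := Delta_n c n f) in *. assert (Hg : Entire g) by now apply Entire_Delta_n.
  assert (Eg : forall z, g (z + c)%C = ((1 + Cexp (h z)) * g z)%C).
  { intros z. generalize (E2 z). rewrite Delta_n_succ. fold g. intros E. transitivity ((g (z + c) - g z) + g z)%C. ring. rewrite E. ring. }
  assert (Egj : forall j z, g (z + RtoC (INR j) * c)%C = (Cprod (fun i => 1 + Cexp (h (z + RtoC (INR i) * c))) j * g z)%C).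
  { induction j; intros z.
    - simpl. replace (z + 0 * c)%C with z by ring. ring.
    - rewrite S_INR, RtoC_plus. replace (z + (RtoC (INR j) + 1) * c)%C with (z + RtoC (INR j) * c + c)%C by ring.
      rewrite Eg, IHj. simpl. ring. }
  set (T := fun z => Csum (fun j => cf j * (Cprod (fun i => 1 + Cexp (h (z + RtoC (INR i) * c))) j *
     Cexp (- P (z + RtoC (INR j) * c))))%C (S n)).
  assert (HT : Entire T).
  { apply (Entire_Csum (fun j z => cf j * (Cprod (fun i => 1 + Cexp (h (z + RtoC (INR i) * c))) j *
     Cexp (- P (z + RtoC (INR j) * c))))%C). intros j. apply Entire_mult. apply Entire_const. apply Entire_mult.
    - apply (Entire_Cprod (fun i z => 1 + Cexp (h (z + RtoC (INR i) * c)))%C). intros i. apply Entire_plus. apply Entire_const.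
      apply Entire_exp. now apply (Entire_shift h).
    - apply Entire_exp. apply Entire_opp. now apply (Entire_shift P). }
  intros z. change (T z = RtoC 1). apply Ceq_minus. revert z.
  apply (zero_product (fun z => T z - 1)%C g); auto.
  - intros z. apply Entire_cont. apply Entire_minus; auto. apply Entire_const.
  - exists z0. rewrite E1. apply Cmult_neq_0; auto. apply Cexp_neq_0.
  - intros z. assert (E : (T z * g z)%C = g z).
    { unfold g at 2. rewrite Hcf. unfold T. rewrite Cmult_comm, <- Csum_scal. apply Csum_ext. intros j _.
      assert (Ef : forall w, f w = (Cexp (- P w) * g w)%C).
      { intros w. rewrite E1, Cexp_neg. field. apply Cexp_neq_0. }
      rewrite Ef, Egj. ring. }
    replace ((T z - 1) * g z)%C with (T z * g z - g z)%C by ring. rewrite E. ring.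
Qed.

(** * Asymptotics along rays *)

(** The coefficient [q] may be 0, so a single [d] serves [P] and [h] even when their degrees
    differ. *)
Definition asymp (G : C -> C) (q : C) (d : nat) : Prop :=
  forall eps, 0 < eps -> exists R0, 0 < R0 /\ forall z, R0 < Cmod z ->
    Cmod (G z - q * z ^ d) <= eps * Cmod z ^ d.

Lemma asymp_ext F G q d : (forall z, F z = G z) -> asymp F q d -> asymp G q d.
Proof. intros E. replace G with F; auto. now apply functional_extensionality. Qed.

Lemma asymp_const a : asymp (fun _ => a) a 0.
Proof.
  intros eps He. exists 1. split. lra. intros z _. simpl.
  replace (a - a * 1)%C with (RtoC 0) by ring. rewrite Cmod_0. lra.
Qed.

Lemma asymp_plus F G p q d : asymp F p d -> asymp G q d -> asymp (fun z => F z + G z)%C (p + q)%C d.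
Proof.
  intros HF HG eps He. destruct (HF (eps/2)) as [R1 [P1 K1]]. lra. destruct (HG (eps/2)) as [R2 [P2 K2]]. lra.
  exists (Rmax R1 R2). split. generalize (Rmax_l R1 R2); lra. intros z Hz.
  specialize (K1 z ltac:(generalize (Rmax_l R1 R2); lra)). specialize (K2 z ltac:(generalize (Rmax_r R1 R2); lra)).
  replace (F z + G z - (p + q) * z ^ d)%C with ((F z - p * z ^ d) + (G z - q * z ^ d))%C by ring.
  eapply Rle_trans. apply Cmod_triangle. lra.
Qed.

Lemma asymp_scal a F p d : asymp F p d -> asymp (fun z => a * F z)%C (a * p)%C d.
Proof.
  intros HF eps He. set (A := Cmod a + 1). assert (HA : 1 <= A) by (unfold A; generalize (Cmod_ge_0 a); lra).
  destruct (HF (eps / A)) as [R1 [P1 K1]]. apply Rdiv_lt_0_compat; lra.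
  exists R1. split; auto. intros z Hz. specialize (K1 z Hz).
  replace (a * F z - a * p * z ^ d)%C with (a * (F z - p * z ^ d))%C by ring.
  rewrite Cmod_mult. apply Rle_trans with (A * (eps / A * Cmod z ^ d)).
  - apply Rmult_le_compat; auto; try apply Cmod_ge_0. unfold A; lra.
  - right. field. lra.
Qed.

Lemma asymp_minus F G p q d : asymp F p d -> asymp G q d -> asymp (fun z => F z - G z)%C (p - q)%C d.
Proof.
  intros HF HG. apply (asymp_scal (RtoC (-1))) in HG. assert (H := asymp_plus _ _ _ _ _ HF HG).
  replace (p - q)%C with (p + RtoC (-1) * q)%C by ring. revert H. apply asymp_ext. intros z. ring.
Qed.

Lemma asymp_opp G q d : asymp G q d -> asymp (fun z => - G z)%C (- q)%C d.
Proof.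
  intros HG. apply (asymp_scal (RtoC (-1))) in HG.
  replace (- q)%C with (RtoC (-1) * q)%C by ring. revert HG. apply asymp_ext. intros z. ring.
Qed.

Lemma asymp_lower F p d : asymp F p d -> asymp F 0 (S d).
Proof.
  intros HF eps He. destruct (HF 1) as [R1 [P1 K1]]. lra.
  set (B := (1 + Cmod p) / eps). assert (Hp := Cmod_ge_0 p).
  assert (HB : 0 < B) by (apply Rdiv_lt_0_compat; lra).
  exists (Rmax R1 B). split. generalize (Rmax_l R1 B); lra. intros z Hz.
  specialize (K1 z ltac:(generalize (Rmax_l R1 B); lra)).
  assert (Hz' : B < Cmod z) by (generalize (Rmax_r R1 B); lra).
  replace (F z - 0 * z ^ S d)%C with ((F z - p * z ^ d) + p * z ^ d)%C by ring.
  eapply Rle_trans. apply Cmod_triangle. rewrite Cmod_mult, Cmod_pow.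
  assert (Hd : 0 <= Cmod z ^ d) by (apply pow_le; lra).
  apply Rle_trans with ((1 + Cmod p) * Cmod z ^ d). lra.
  simpl. rewrite <- Rmult_assoc. apply Rmult_le_compat_r; auto.
  replace (1 + Cmod p) with (eps * B) by (unfold B; field; lra). apply Rmult_le_compat_l; lra.
Qed.

Lemma asymp_mult_affine F q d w : asymp F q d -> asymp (fun z => (z + w) * F z)%C q (S d).
Proof.
  intros HF.
  assert (H1 : asymp (fun z => z * F z)%C q (S d)).
  { intros eps He. destruct (HF eps He) as [R1 [P1 K1]]. exists R1. split; auto. intros z Hz. specialize (K1 z Hz).
    replace (z * F z - q * z ^ S d)%C with (z * (F z - q * z ^ d))%C by (simpl; ring).
    rewrite Cmod_mult. simpl. generalize (Cmod_ge_0 z). nra. }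
  assert (H2 := asymp_plus _ _ _ _ _ H1 (asymp_lower _ _ _ (asymp_scal w _ _ _ HF))).
  rewrite Cplus_0_r in H2. revert H2. apply asymp_ext. intros z. ring.
Qed.

Lemma asymp_shift_pow w k : asymp (fun z => (z + w) ^ k)%C 1 k.
Proof.
  induction k. apply (asymp_const 1). apply (asymp_mult_affine _ _ _ w IHk).
Qed.

Lemma asymp_diff_pow w k : asymp (fun z => (z + w) ^ S k - z ^ S k)%C (RtoC (INR (S k)) * w)%C k.
Proof.
  induction k.
  - simpl. replace (1 * w)%C with w by ring. apply asymp_ext with (fun _ => w). intros z. ring. apply asymp_const.
  - assert (H := asymp_plus _ _ _ _ _ (asymp_mult_affine _ _ _ w IHk) (asymp_scal w _ _ _ (asymp_shift_pow 0 (S k)))).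
    replace (RtoC (INR (S (S k))) * w)%C with (RtoC (INR (S k)) * w + w * 1)%C.
    2:{ rewrite (S_INR (S k)), RtoC_plus. ring. }
    revert H. apply asymp_ext. intros z. replace (z + 0)%C with z by ring. simpl. ring.
Qed.

Lemma asymp_polynomial a w D : asymp (fun z => Csum (fun k => a k * (z + w) ^ k) (S D))%C (a D) D.
Proof.
  induction D.
  - simpl. apply asymp_ext with (fun _ => a O). intros z. ring. apply asymp_const.
  - assert (H := asymp_plus _ _ _ _ _ (asymp_lower _ _ _ IHD) (asymp_scal (a (S D)) _ _ _ (asymp_shift_pow w (S D)))).
    replace (0 + a (S D) * 1)%C with (a (S D)) in H by ring. exact H.
Qed.

(** The discrete derivative: one degree is lost, and the new leading coefficient is a multiple of
    the shift. This separates the exponentials when the degree is at least 2. *)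
Lemma asymp_polynomial_diff a w D :
  asymp (fun z => Csum (fun k => a k * (z + w) ^ k) (S (S D)) - Csum (fun k => a k * z ^ k) (S (S D)))%C
    (a (S D) * (RtoC (INR (S D)) * w))%C D.
Proof.
  induction D.
  - assert (H := asymp_scal (a 1%nat) _ _ _ (asymp_diff_pow w 0)). revert H. apply asymp_ext. intros z. simpl. ring.
  - assert (H := asymp_plus _ _ _ _ _ (asymp_lower _ _ _ IHD) (asymp_scal (a (S (S D))) _ _ _ (asymp_diff_pow w (S D)))).
    rewrite Cplus_0_l in H. revert H. apply asymp_ext. intros z. cbn [Csum]. ring.
Qed.

(** * Limits along rays *)

Definition vanish (T : R -> C) : Prop :=
  forall eps, 0 < eps -> exists r0, forall r, r0 < r -> Cmod (T r) < eps.

Lemma vanish_ext S T : (forall r, S r = T r) -> vanish S -> vanish T.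
Proof. intros E. replace T with S; auto. now apply functional_extensionality. Qed.

Lemma vanish_0 : vanish (fun _ => RtoC 0).
Proof. intros eps He. exists 0. intros r _. now rewrite Cmod_0. Qed.

Lemma vanish_const a : vanish (fun _ => a) -> a = RtoC 0.
Proof.
  intros H. apply Cmod_eq_0. apply Rle_antisym. 2: apply Cmod_ge_0. apply le_epsilon. intros eps He.
  destruct (H eps He) as [r0 K]. specialize (K (r0 + 1) ltac:(lra)). lra.
Qed.

Lemma vanish_plus S T : vanish S -> vanish T -> vanish (fun r => S r + T r)%C.
Proof.
  intros HS HT eps He. destruct (HS (eps/2)) as [r1 K1]. lra. destruct (HT (eps/2)) as [r2 K2]. lra.
  exists (Rmax r1 r2). intros r Hr. specialize (K1 r ltac:(generalize (Rmax_l r1 r2); lra)).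
  specialize (K2 r ltac:(generalize (Rmax_r r1 r2); lra)).
  eapply Rle_lt_trans. apply Cmod_triangle. lra.
Qed.

Lemma vanish_scal a T : vanish T -> vanish (fun r => a * T r)%C.
Proof.
  intros HT eps He. set (A := Cmod a + 1). assert (HA : 1 <= A) by (unfold A; generalize (Cmod_ge_0 a); lra).
  destruct (HT (eps / A)) as [r1 K1]. apply Rdiv_lt_0_compat; lra. exists r1. intros r Hr. specialize (K1 r Hr).
  rewrite Cmod_mult. apply Rle_lt_trans with (A * Cmod (T r)).
  apply Rmult_le_compat_r. apply Cmod_ge_0. unfold A; lra.
  replace eps with (A * (eps / A)) by (field; lra). apply Rmult_lt_compat_l; lra.
Qed.

Lemma vanish_minus S T : vanish S -> vanish T -> vanish (fun r => S r - T r)%C.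
Proof.
  intros HS HT. assert (H := vanish_plus _ _ HS (vanish_scal (RtoC (-1)) _ HT)). revert H.
  apply vanish_ext. intros r. ring.
Qed.

Lemma vanish_mult S T : vanish S -> vanish T -> vanish (fun r => S r * T r)%C.
Proof.
  intros HS HT eps He. destruct (HS 1) as [r1 K1]. lra. destruct (HT eps He) as [r2 K2].
  exists (Rmax r1 r2). intros r Hr. specialize (K1 r ltac:(generalize (Rmax_l r1 r2); lra)).
  specialize (K2 r ltac:(generalize (Rmax_r r1 r2); lra)). rewrite Cmod_mult.
  generalize (Cmod_ge_0 (S r)) (Cmod_ge_0 (T r)). nra.
Qed.

Lemma vanish_Csum (u : nat -> R -> C) n : (forall k, (k < n)%nat -> vanish (u k)) ->
  vanish (fun r => Csum (fun k => u k r) n).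
Proof. induction n; intros H; simpl. apply vanish_0. apply vanish_plus; auto. Qed.

Lemma exp_asymp_vanish G q d e : Cmod e = 1 -> asymp G q (S d) -> fst (q * e ^ S d)%C < 0 ->
  vanish (fun r => Cexp (G (RtoC r * e)%C)).
Proof.
  intros He HG Hq eps Heps. set (x := fst (q * e ^ S d)%C) in *.
  destruct (HG (- x / 2)) as [R0 [HR0 K]]. lra.
  exists (Rmax (Rmax R0 1) (- ln eps * 2 / - x)). intros r Hr.
  assert (H1 := Rmax_l (Rmax R0 1) (- ln eps * 2 / - x)). assert (H2 := Rmax_r (Rmax R0 1) (- ln eps * 2 / - x)).
  assert (H3 := Rmax_l R0 1). assert (H4 := Rmax_r R0 1).
  assert (Em : Cmod (RtoC r * e) = r). { rewrite Cmod_mult, He, Cmod_R, Rabs_pos_eq; lra. }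
  specialize (K (RtoC r * e)%C). rewrite Em in K. specialize (K ltac:(lra)).
  rewrite Cmod_Cexp. rewrite <- (exp_ln eps) by auto. apply exp_increasing.
  assert (B := re_le_mod (G (RtoC r * e) - q * (RtoC r * e) ^ S d)%C).
  assert (E : fst (q * (RtoC r * e) ^ S d)%C = r ^ S d * x).
  { unfold x. rewrite Cpow_mult_l, <- RtoC_pow.
    replace (q * (RtoC (r ^ S d) * e ^ S d))%C with (RtoC (r ^ S d) * (q * e ^ S d))%C by ring.
    apply re_scal_l. }
  replace (fst (G (RtoC r * e) - q * (RtoC r * e) ^ S d)%C) with (fst (G (RtoC r * e)%C) - r ^ S d * x) in B.
  2:{ rewrite <- E. simpl. ring. }
  assert (Hrd : r <= r ^ S d). { simpl. assert (1 <= r ^ d) by (apply pow_R1_Rle; lra). nra. }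
  assert (B' := Rle_trans _ _ _ (Rle_abs _) (Rle_trans _ _ _ B K)).
  assert (Hl : - ln eps < r * (- x) / 2).
  { assert (H5 : - ln eps * 2 / - x < r) by lra.
    apply Rmult_lt_compat_r with (r := - x) in H5. 2: lra.
    replace (- ln eps * 2 / - x * - x) with (- ln eps * 2) in H5 by (field; lra). lra. }
  nra.
Qed.

(** The expanded product consists of exponentials with leading coefficients [q + m b], 0 <= m <= j.
    Real parts are affine in m, so negativity at both ends controls all of them. The induction
    multiplies out one factor, absorbing its exponential into [G]. *)
Lemma prod_exp_vanish (h : nat -> C -> C) b d e : Cmod e = 1 -> (forall i, asymp (h i) b (S d)) ->
  forall j G q, asymp G q (S d) -> fst (q * e ^ S d)%C < 0 ->
   fst (q * e ^ S d)%C + INR j * fst (b * e ^ S d)%C < 0 ->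
  vanish (fun r => Cprod (fun i => 1 + Cexp (h i (RtoC r * e))) j * Cexp (G (RtoC r * e)))%C.
Proof.
  intros He Hh. induction j; intros G q HG Hq Hj.
  - simpl. assert (H := exp_asymp_vanish G q d e He HG Hq). revert H. apply vanish_ext. intros r. ring.
  - rewrite S_INR in Hj. set (x := fst (b * e ^ S d)%C) in *. assert (Hpj := pos_INR j).
    assert (Ex : fst ((q + b) * e ^ S d)%C = fst (q * e ^ S d)%C + x).
    { rewrite Cmult_plus_distr_r. reflexivity. }
    set (y := fst (q * e ^ S d)%C) in *.
    assert (V1 := IHj G q HG Hq). fold y in V1. specialize (V1 ltac:(nra)).
    assert (V2 := IHj _ _ (asymp_plus _ _ _ _ _ HG (Hh j))). rewrite Ex in V2.
    specialize (V2 ltac:(nra) ltac:(lra)).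
    assert (V := vanish_plus _ _ V1 V2). revert V. apply vanish_ext. intros r. simpl. rewrite Cexp_plus. ring.
Qed.

(** Passing from j to j + 1 adds the product times [e^(h j)], which vanishes by
    [prod_exp_vanish]. *)
Lemma prod_exp_to_1 (h : nat -> C -> C) b d e : Cmod e = 1 -> (forall i, asymp (h i) b (S d)) ->
  fst (b * e ^ S d)%C < 0 -> forall j,
  vanish (fun r => Cprod (fun i => 1 + Cexp (h i (RtoC r * e))) j - 1)%C.
Proof.
  intros He Hh Hb. induction j; simpl.
  - apply vanish_ext with (2 := vanish_0). intros r. ring.
  - assert (V : vanish (fun r => Cprod (fun i => 1 + Cexp (h i (RtoC r * e))) j * Cexp (h j (RtoC r * e)))%C).
    { apply (prod_exp_vanish h b d e He Hh j (h j) b); auto. generalize (pos_INR j). nra. }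
    assert (W := vanish_plus _ _ IHj V). revert W. apply vanish_ext. intros r. ring.
Qed.

(** * Choice of rays and isolation of a dominant term *)

Lemma cis_pow t n : (cis t ^ n)%C = cis (INR n * t).
Proof.
  induction n. simpl. rewrite Rmult_0_l, cis_0. auto.
  rewrite S_INR. simpl. rewrite IHn, <- cis_plus. f_equal. ring.
Qed.

Lemma unit_root v D : v <> RtoC 0 -> exists t, v = (RtoC (Cmod v) * cis t ^ S D)%C.
Proof.
  intros Hv. destruct (argument_exists v Hv) as [t Ht]. exists (t / INR (S D)). rewrite cis_pow.
  replace (INR (S D) * (t / INR (S D))) with t; auto. field. apply not_0_INR. lia.
Qed.

Lemma fst_scal_pos (s : R) (z w v : C) : w = (RtoC s * v)%C -> fst (z * w)%C = s * fst (z * v)%C.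
Proof. intros ->. replace (z * (RtoC s * v))%C with (RtoC s * (z * v))%C by ring. apply re_scal_l. Qed.

(** Here [w] is the direction of the leading power. In the first alternative every term of the
    difference identity vanishes although their sum is 1; in the second the last term outgrows the
    others and the 1. *)
Lemma direction_choice (al p : C) (n : nat) : (1 <= n)%nat -> ~ (al = RtoC 0 /\ p = RtoC 0) -> p <> (RtoC (INR n) * al)%C ->
  exists w, w <> RtoC 0 /\
   ((0 < fst (p * w)%C /\ INR n * fst (al * w)%C < fst (p * w)%C) \/
    (0 < fst (al * w)%C /\ fst (p * w)%C < INR n * fst (al * w)%C)).
Proof.
  intros Hn N Hp. assert (HN : 1 <= INR n) by now apply (le_INR 1).
  destruct (Ceq_dec al 0) as [E|Ha].
  - assert (Np : p <> RtoC 0) by tauto. exists (Cconj p).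
    assert (Ec : fst (p * Cconj p)%C = Cmod p ^ 2). { rewrite Cmod2_alt. unfold Re, Im. simpl. ring. }
    assert (Hm : 0 < Cmod p) by now apply Cmod_gt_0. split.
    + apply Cmod_gt_0. now rewrite Cmod_conj.
    + left. rewrite Ec, E. replace (fst (0 * Cconj p)%C) with 0 by (simpl; ring). nra.
  (* Directions of the form [Cconj al * v] reduce the question to [al = 1] and the ratio [q]. *)
  - set (q := (p / al)%C). assert (Eq : p = (al * q)%C) by (unfold q; field; auto). clearbody q.
    assert (Hm : 0 < Cmod al) by now apply Cmod_gt_0.
    assert (Ha1 : forall v, (al * (Cconj al * v))%C = (RtoC (Cmod al ^ 2) * v)%C).
    { intros v. rewrite Cmod2_conj. ring. }
    assert (Hm2 : 0 < Cmod al ^ 2) by nra.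
    assert (Nc : Cconj al <> RtoC 0). { apply Cmod_gt_0. now rewrite Cmod_conj. }
    assert (F1 : forall v, fst (al * (Cconj al * v))%C = Cmod al ^ 2 * fst v).
    { intros v. rewrite Ha1. apply re_scal_l. }
    assert (F2 : forall v, fst (p * (Cconj al * v))%C = Cmod al ^ 2 * fst (q * v)%C).
    { intros v. rewrite Eq. replace (al * q * (Cconj al * v))%C with (al * (Cconj al * (q * v)))%C by ring. apply F1. }
    destruct (Req_dec (snd q) 0) as [Z|NZ].
    + exists (Cconj al * 1)%C. split. { now rewrite Cmult_1_r. } rewrite F1, F2.
      replace (fst (q * 1)%C) with (fst q) by (simpl; ring). change (fst (RtoC 1)) with 1.
      assert (Nq : fst q <> INR n).
      { intros E. apply Hp. rewrite Eq. rewrite Cmult_comm. f_equal. destruct q; simpl in *. rewrite E, Z. reflexivity. }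
      destruct (Rlt_le_dec (fst q) (INR n)) as [L|L].
      * right. split; nra.
      * left. split; nra.
    (* For a ratio off the real axis, [Re (q v)] can be prescribed while [Re v = 1]; the value taken
       is [n - 1], which lies below [n]. *)
    + set (v := (1, (fst q - INR n + 1) / snd q) : C). exists (Cconj al * v)%C. split.
      { apply Cmult_neq_0; auto. unfold v, RtoC. intros E. injection E. lra. }
      rewrite F1, F2. right.
      replace (fst (q * v)%C) with (INR n - 1). 2: (simpl; field; auto). simpl fst. split; nra.
Qed.

(** Start from the angle that makes the first term negative. If the second is then purely imaginary,
    turning by [s] rotates the first by pi/4, which keeps its real part negative, and the second by
    a positive angle of at most pi/4, which takes it off the axis. *)
Lemma direction_choice_2 (al u : C) (d : nat) : al <> RtoC 0 -> u <> RtoC 0 ->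
  exists t, fst (al * cis t ^ S (S d))%C < 0 /\ fst (u * cis t ^ S d)%C <> 0.
Proof.
  intros Ha Hu. assert (Hm : 0 < Cmod al) by now apply Cmod_gt_0.
  assert (Nc : (- Cconj al)%C <> RtoC 0). { apply Cmod_gt_0. now rewrite Cmod_opp, Cmod_conj. }
  destruct (unit_root (- Cconj al)%C (S d) Nc) as [t Ht]. rewrite Cmod_opp, Cmod_conj in Ht.
  assert (E : (al * cis t ^ S (S d))%C = RtoC (- Cmod al)).
  { assert (N : RtoC (Cmod al) <> RtoC 0). { intros E. apply RtoC_inj in E. lra. }
    transitivity (al * (RtoC (Cmod al) * cis t ^ S (S d)) / RtoC (Cmod al))%C. field; auto.
    rewrite <- Ht. replace (al * - Cconj al)%C with (- (al * Cconj al))%C by ring. rewrite <- Cmod2_conj.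
    rewrite RtoC_opp, RtoC_pow. field. auto. }
  destruct (Req_dec (fst (u * cis t ^ S d)%C) 0) as [Z|NZ].
  2:{ exists t. split; auto. rewrite E. simpl. lra. }
  set (D := INR (S (S d))). assert (HD : 0 < D) by (apply lt_0_INR; lia).
  set (s := PI / 4 / D). exists (t + s). assert (P := PI_RGT_0).
  rewrite cis_plus, !Cpow_mult_l, !(cis_pow s). fold D.
  replace (D * s) with (PI / 4) by (unfold s; field; lra). rewrite !Cmult_assoc, E. split.
  - simpl. assert (0 < cos (PI/4)) by (apply cos_gt_0; lra). nra.
  - set (y := (u * cis t ^ S d)%C) in *.
    assert (Ny : y <> RtoC 0). { apply Cmult_neq_0; auto. apply Cpow_nz. apply Cmod_gt_0. rewrite Cmod_cis. lra. }
    clearbody y. assert (Ns : snd y <> 0). { intros Z2. apply Ny. destruct y; simpl in *. now rewrite Z, Z2. }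
    replace (fst (y * cis (INR (S d) * s))%C) with (- (snd y * sin (INR (S d) * s))) by (simpl; rewrite Z; ring).
    assert (0 < sin (INR (S d) * s)).
    { assert (0 < INR (S d)) by (apply lt_0_INR; lia). assert (Hs : 0 < s) by (unfold s; repeat apply Rdiv_lt_0_compat; lra).
      apply sin_gt_0. apply Rmult_lt_0_compat; lra.
      assert (INR (S d) * s <= D * s). { apply Rmult_le_compat_r. lra. unfold D. apply le_INR. lia. }
      replace (D * s) with (PI/4) in * by (unfold s; field; lra). lra. }
    intros E0. assert (snd y * sin (INR (S d) * s) = 0) by lra. apply Rmult_integral in H0. destruct H0; lra.
Qed.

Lemma Csum_pad a n N : (n <= N)%nat -> exists b, forall z, Csum (fun k => a k * z ^ k)%C n = Csum (fun k => b k * z ^ k)%C N.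
Proof.
  intros H. exists (fun k => if Nat.ltb k n then a k else RtoC 0). intros z. induction H.
  - apply Csum_ext. intros k Hk. apply Nat.ltb_lt in Hk. now rewrite Hk.
  - simpl. rewrite <- IHle. replace (Nat.ltb m n) with false. ring. symmetry. apply Nat.ltb_ge. lia.
Qed.

(** [S D] is the largest degree with a nonzero coefficient in either polynomial, at least 1 because
    [h] is not constant; sums of length [S (S D)] run over degrees 0 to [S D]. *)
Lemma common_degree (P h : C -> C) a b n m :
  (forall z, P z = Csum (fun k => a k * z ^ k)%C n) -> (forall z, h z = Csum (fun k => b k * z ^ k)%C m) ->
  ~ (forall z, h z = h 0) -> exists D a b,
   (forall z, P z = Csum (fun k => a k * z ^ k)%C (S (S D))) /\ (forall z, h z = Csum (fun k => b k * z ^ k)%C (S (S D))) /\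
   ~ (b (S D) = RtoC 0 /\ a (S D) = RtoC 0).
Proof.
  intros HP Hh Hc.
  destruct (Csum_pad a n (S (n + m))) as [a' Ha]. lia. destruct (Csum_pad b m (S (n + m))) as [b' Hb]. lia.
  assert (HP' : forall z, P z = Csum (fun k => a' k * z ^ k)%C (S (n + m))) by (intros; now rewrite HP, Ha).
  assert (Hh' : forall z, h z = Csum (fun k => b' k * z ^ k)%C (S (n + m))) by (intros; now rewrite Hh, Hb).
  revert HP' Hh'. generalize (n + m)%nat. clear HP Hh Ha Hb. induction n0; intros HP Hh.
  - elim Hc. intros z. rewrite !Hh. simpl. ring.
  - destruct (classic (b' (S n0) = RtoC 0 /\ a' (S n0) = RtoC 0)) as [[E1 E2]|N].
    + apply IHn0; intros z.
      * rewrite HP. cbn [Csum]. rewrite E2. ring.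
      * rewrite Hh. cbn [Csum]. rewrite E1. ring.
    + exists n0, a', b'. auto.
Qed.

(** With [l] subtracted from the k-th term all summands vanish, so [l] is a difference of two
    vanishing quantities. *)
Lemma isolated_term_limit (X : nat -> R -> C) (Y : R -> C) (l : C) n k : (k <= n)%nat ->
  (forall r, Csum (fun j => X j r) (S n) = Y r) ->
  (forall j, (j <= n)%nat -> j <> k -> vanish (X j)) -> vanish (fun r => X k r - l)%C -> vanish Y -> l = RtoC 0.
Proof.
  intros Hk HS HX HK HY. apply vanish_const.
  assert (V : vanish (fun r => Csum (fun j => X j r - (if Nat.eqb j k then l else RtoC 0)) (S n))%C).
  { apply (vanish_Csum (fun j r => X j r - (if Nat.eqb j k then l else RtoC 0))%C). intros j Hj. destruct (Nat.eqb_spec j k) as [->|N]; auto.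
    apply vanish_ext with (X j). intros r. ring. apply HX; auto. lia. }
  assert (W := vanish_minus _ _ HY V). revert W. apply vanish_ext. intros r. rewrite Csum_minus, HS.
  assert (E : forall m, Csum (fun j => if Nat.eqb j k then l else RtoC 0) m = if Nat.ltb k m then l else RtoC 0).
  { induction m. reflexivity. simpl Csum. rewrite IHm.
    destruct (Nat.eqb_spec m k); destruct (Nat.ltb_spec k m); destruct (Nat.ltb_spec k (S m)); try lia; ring. }
  rewrite E. destruct (Nat.ltb_spec k (S n)). ring. lia.
Qed.

(** * The leading coefficients of the exponents *)

Lemma asymp_Csum (h : nat -> C -> C) q d n : (forall i, asymp (h i) q (S d)) ->
  asymp (fun z => Csum (fun i => h i z) n) (RtoC (INR n) * q)%C (S d).
Proof.
  intros H. induction n.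
  - simpl. rewrite Cmult_0_l. clear H. induction d; apply asymp_lower with (RtoC 0); auto. apply asymp_const.
  - rewrite S_INR, RtoC_plus. replace ((INR n + 1) * q)%C with (INR n * q + q)%C by ring.
    simpl. now apply asymp_plus.
Qed.

(** Factor by factor [(1 + e^u) e^(-u) = 1 + e^(-u)]. This normalises a product of growing factors
    so that it tends to 1. *)
Lemma Cprod_exp_reflect (u : nat -> C) n :
  (Cprod (fun i => 1 + Cexp (u i)) n * Cexp (- Csum u n))%C = Cprod (fun i => 1 + Cexp (- u i))%C n.
Proof.
  induction n; simpl.
  - replace (- 0)%C with (RtoC 0) by ring. rewrite Cexp_0. ring.
  - rewrite <- IHn. replace (- (Csum u n + u n))%C with (- Csum u n + - u n)%C by ring.
    rewrite Cexp_plus. set (A := Cprod (fun i : nat => (1 + Cexp (u i))%C) n). set (B := Cexp (- Csum u n)).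
    replace (A * (1 + Cexp (u n)) * (B * Cexp (- u n)))%C with (A * B * (Cexp (- u n) + Cexp (- u n) * Cexp (u n)))%C by ring.
    rewrite Cexp_opp. ring.
Qed.

Lemma Cprod_zero_factor (u : nat -> C) n k : (k < n)%nat -> u k = RtoC 0 -> Cprod u n = RtoC 0.
Proof.
  intros Hk Hu. induction Hk; simpl. rewrite Hu. ring. rewrite IHHk. ring.
Qed.

Lemma Csum_zero u n : (forall k, (k < n)%nat -> u k = RtoC 0) -> Csum u n = RtoC 0.
Proof. intros H. induction n; simpl; auto. rewrite IHn, H; auto. ring. Qed.

Definition ray (t r : R) : C := (RtoC r * cis t)%C.

(* [cf j] is the coefficient of [f(z + jc)] in the n-th difference. *)
Definition difference_relation (c : C) (n : nat) (P h : C -> C) (cf : nat -> C) : Prop :=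
  forall z, Csum (fun j => cf j * (Cprod (fun i => 1 + Cexp (h (z + RtoC (INR i) * c))) j *
     Cexp (- P (z + RtoC (INR j) * c))))%C (S n) = RtoC 1.

Lemma leading_coefficient_relation c n (P h : C -> C) cf D p al : (1 <= n)%nat -> cf n = RtoC 1 ->
  difference_relation c n P h cf ->
  (forall w, asymp (fun z => P (z + w))%C p (S D)) -> (forall w, asymp (fun z => h (z + w))%C al (S D)) ->
  ~ (al = RtoC 0 /\ p = RtoC 0) -> p = (RtoC (INR n) * al)%C.
Proof.
  intros Hn Hcf HR HP Hh N. apply NNPP. intros Np.
  destruct (direction_choice al p n Hn N Np) as [w [Nw Hw]].
  destruct (unit_root w D Nw) as [t Ht]. assert (Hm : 0 < Cmod w) by now apply Cmod_gt_0.
  rewrite (fst_scal_pos _ al w _ Ht), (fst_scal_pos _ p w _ Ht) in Hw.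
  set (x := fst (al * cis t ^ S D)%C) in *. set (y := fst (p * cis t ^ S D)%C) in *.
  assert (He := Cmod_cis t).
  assert (Hhi : forall i, asymp (fun z => h (z + RtoC (INR i) * c))%C al (S D)) by (intros; apply Hh).
  assert (HPj : forall j, asymp (fun z => - P (z + RtoC (INR j) * c))%C (- p)%C (S D)) by (intros; apply asymp_opp, HP).
  assert (Eopp : forall v : C, fst (- v)%C = - fst v) by reflexivity.
  destruct Hw as [[H1 H2]|[H1 H2]].
  - assert (Hy : 0 < y) by nra. assert (Hxy : INR n * x < y) by nra.
    apply C1_nz. apply vanish_const.
    apply vanish_ext with (fun r => Csum (fun j => cf j * (Cprod (fun i => 1 + Cexp (h (ray t r + RtoC (INR i) * c))) j *
       Cexp (- P (ray t r + RtoC (INR j) * c))))%C (S n)).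
    { intros r. apply HR. }
    apply (vanish_Csum (fun j r => cf j * (Cprod (fun i => 1 + Cexp (h (ray t r + RtoC (INR i) * c))) j *
       Cexp (- P (ray t r + RtoC (INR j) * c))))%C).
    intros j Hj. apply vanish_scal.
    apply (prod_exp_vanish (fun i z => h (z + RtoC (INR i) * c)%C) al D (cis t) He Hhi j
      (fun z => - P (z + RtoC (INR j) * c))%C (- p)%C); auto.
    + replace (- p * cis t ^ S D)%C with (- (p * cis t ^ S D))%C by ring. rewrite Eopp. fold y. lra.
    + replace (- p * cis t ^ S D)%C with (- (p * cis t ^ S D))%C by ring. rewrite Eopp. fold x y.
      assert (INR j <= INR n) by (apply le_INR; lia). assert (Hj0 := pos_INR j).
      destruct (Rle_dec x 0); nra.
  - assert (Hx : 0 < x) by nra. assert (Hxy : y < INR n * x) by nra.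
    (* [- B] is the dominant exponent of the last term. Multiplying the identity by [e^B] makes that
       term tend to 1, while the right-hand side becomes [e^B] and vanishes. *)
    set (B := fun z => (P (z + RtoC (INR n) * c) - Csum (fun i => h (z + RtoC (INR i) * c)) n)%C).
    assert (HB : asymp B (p - RtoC (INR n) * al)%C (S D)).
    { apply asymp_minus. apply HP. apply (asymp_Csum (fun i z => h (z + RtoC (INR i) * c)%C)). auto. }
    assert (HBv : fst ((p - RtoC (INR n) * al) * cis t ^ S D)%C = y - INR n * x).
    { replace ((p - RtoC (INR n) * al) * cis t ^ S D)%C with (p * cis t ^ S D - RtoC (INR n) * (al * cis t ^ S D))%C by ring.
      unfold x, y. generalize (p * cis t ^ S D)%C (al * cis t ^ S D)%C. intros u v. simpl. ring. }
    assert (Z : RtoC 1 = RtoC 0); [|now apply C1_nz].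
    apply (isolated_term_limit (fun j r => cf j * (Cprod (fun i => 1 + Cexp (h (ray t r + RtoC (INR i) * c))) j *
       Cexp (- P (ray t r + RtoC (INR j) * c) + B (ray t r))))%C (fun r => Cexp (B (ray t r))) 1 n n); auto.
    + intros r. assert (E := f_equal (Cmult (Cexp (B (ray t r)))) (HR (ray t r))).
      rewrite <- Csum_scal, Cmult_1_r in E. etransitivity; [|exact E]. apply Csum_ext. intros j _.
      rewrite Cexp_plus. ring.
    + intros j Hj Nj. apply vanish_scal.
      apply (prod_exp_vanish (fun i z => h (z + RtoC (INR i) * c)%C) al D (cis t) He Hhi j
        (fun z => - P (z + RtoC (INR j) * c) + B z)%C (- p + (p - RtoC (INR n) * al))%C).
      * now apply asymp_plus.
      * replace ((- p + (p - RtoC (INR n) * al)) * cis t ^ S D)%C with (RtoC (- INR n) * (al * cis t ^ S D))%C by (rewrite RtoC_opp; ring).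
        change (Re (RtoC (- INR n) * (al * cis t ^ S D)) < 0)%C. rewrite re_scal_l. fold x. unfold Re. fold x.
        assert (1 <= INR n) by now apply (le_INR 1). nra.
      * replace ((- p + (p - RtoC (INR n) * al)) * cis t ^ S D)%C with (RtoC (- INR n) * (al * cis t ^ S D))%C by (rewrite RtoC_opp; ring).
        assert (E : fst (RtoC (- INR n) * (al * cis t ^ S D))%C = - INR n * x) by apply re_scal_l.
        rewrite E. fold x. assert (INR j < INR n) by (apply lt_INR; lia). nra.
    + assert (V := prod_exp_to_1 (fun i z => - h (z + RtoC (INR i) * c))%C (- al)%C D (cis t) He
         (fun i => asymp_opp _ _ _ (Hhi i))).
      assert (V' := V ltac:(replace (- al * cis t ^ S D)%C with (- (al * cis t ^ S D))%C by ring; rewrite Eopp; fold x; lra) n).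
      revert V'. apply vanish_ext. intros r. rewrite Hcf. unfold B.
      replace (- P (ray t r + RtoC (INR n) * c) + (P (ray t r + RtoC (INR n) * c) - Csum (fun i => h (ray t r + RtoC (INR i) * c)) n))%C
        with (- Csum (fun i => h (ray t r + RtoC (INR i) * c)) n)%C by ring.
      rewrite Cprod_exp_reflect. unfold ray. ring.
    + apply (exp_asymp_vanish B (p - RtoC (INR n) * al)%C D (cis t)); auto. rewrite HBv. lra.
Qed.

(** On the chosen ray all products of [1 + e^h] tend to 1, so terms are compared through the shifts
    of [P] alone, whose differences have the positive degree [S D]. *)
Lemma no_degree_at_least_two c n (P h : C -> C) cf D p al : (1 <= n)%nat -> c <> RtoC 0 -> cf n = RtoC 1 -> cf O <> RtoC 0 ->
  difference_relation c n P h cf ->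
  (forall w, asymp (fun z => P (z + w))%C p (S (S D))) -> (forall w, asymp (fun z => h (z + w))%C al (S (S D))) ->
  (forall w, asymp (fun z => P (z + w) - P z)%C (p * (RtoC (INR (S (S D))) * w))%C (S D)) ->
  p = (RtoC (INR n) * al)%C -> al <> RtoC 0 -> False.
Proof.
  intros Hn Hc Hcf Hcf0 HR HP Hh Hd Ep Na.
  assert (HN : 1 <= INR n) by now apply (le_INR 1).
  assert (NN : RtoC (INR n) <> RtoC 0) by (intros E; apply RtoC_inj in E; lra).
  set (u := (p * (RtoC (INR (S (S D))) * c))%C).
  assert (Nu : u <> RtoC 0).
  { unfold u. rewrite Ep. repeat apply Cmult_neq_0; auto. intros E. apply RtoC_inj in E. revert E. apply not_0_INR. lia. }
  destruct (direction_choice_2 al u D Na Nu) as [t [Hx Hs]].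
  set (x := fst (al * cis t ^ S (S D))%C) in *. set (s := fst (u * cis t ^ S D)%C) in *.
  assert (He := Cmod_cis t).
  assert (Hhi : forall i, asymp (fun z => h (z + RtoC (INR i) * c))%C al (S (S D))) by (intros; apply Hh).
  assert (Hprod := prod_exp_to_1 (fun i z => h (z + RtoC (INR i) * c)%C) al (S D) (cis t) He Hhi Hx).
  (* The exponents [- P(z + jc)] and [- P(z + kc)] differ by a polynomial with leading coefficient
     [(k - j) u]; the sign of [s] decides whether the first or the last term dominates. *)
  assert (K : exists k, (k <= n)%nat /\ cf k <> RtoC 0 /\ forall j, (j <= n)%nat -> j <> k -> 0 < (INR j - INR k) * s).
  { destruct (Rlt_le_dec 0 s) as [L|L].
    - exists O. split. lia. split; auto. intros j _ Nj. simpl. assert (0 < INR j) by (apply lt_0_INR; lia). nra.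
    - exists n. split. lia. split. rewrite Hcf. apply C1_nz. intros j Hj Nj.
      assert (INR j < INR n) by (apply lt_INR; lia). nra. }
  destruct K as [k [Hk [Nk Hjk]]]. apply Nk.
  (* The identity is multiplied by [e^P(z + kc)], which vanishes on the ray because [p = n al]; the
     k-th term then tends to [cf k]. *)
  apply (isolated_term_limit (fun j r => cf j * (Cprod (fun i => 1 + Cexp (h (ray t r + RtoC (INR i) * c))) j *
     Cexp (- (P (ray t r + RtoC (INR j) * c) - P (ray t r + RtoC (INR k) * c)))))%C
     (fun r => Cexp (P (ray t r + RtoC (INR k) * c)%C)) (cf k) n k); auto.
  - intros r. assert (E := f_equal (Cmult (Cexp (P (ray t r + RtoC (INR k) * c)%C))) (HR (ray t r))).
    rewrite <- Csum_scal, Cmult_1_r in E. etransitivity; [|exact E]. apply Csum_ext. intros j _.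
    replace (- (P (ray t r + RtoC (INR j) * c) - P (ray t r + RtoC (INR k) * c)))%C with
      (P (ray t r + RtoC (INR k) * c) + - P (ray t r + RtoC (INR j) * c))%C by ring.
    rewrite Cexp_plus. ring.
  - intros j Hj Nj. apply vanish_scal.
    assert (V : vanish (fun r => Cexp (- (P (ray t r + RtoC (INR j) * c) - P (ray t r + RtoC (INR k) * c)))%C)).
    { apply (exp_asymp_vanish (fun z => - (P (z + RtoC (INR j) * c) - P (z + RtoC (INR k) * c)))%C
        (- (p * (RtoC (INR (S (S D))) * (RtoC (INR j) * c)) - p * (RtoC (INR (S (S D))) * (RtoC (INR k) * c))))%C D (cis t)); auto.
      - apply asymp_opp. apply asymp_ext with (fun z => (P (z + RtoC (INR j) * c) - P z) - (P (z + RtoC (INR k) * c) - P z))%C.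
        intros z. ring. apply asymp_minus; apply Hd.
      - match goal with |- fst ?v < 0 => replace v with (RtoC (- (INR j - INR k)) * (u * cis t ^ S D))%C end.
        2:{ unfold u. rewrite RtoC_opp, RtoC_minus. ring. }
        assert (E : fst (RtoC (- (INR j - INR k)) * (u * cis t ^ S D))%C = - (INR j - INR k) * s) by apply re_scal_l.
        rewrite E. specialize (Hjk j Hj Nj). lra. }
    assert (W := vanish_plus _ _ V (vanish_mult _ _ (Hprod j) V)). revert W. apply vanish_ext. intros r. unfold ray. ring.
  - assert (V := vanish_scal (cf k) _ (Hprod k)). revert V. apply vanish_ext. intros r.
    replace (- (P (ray t r + RtoC (INR k) * c) - P (ray t r + RtoC (INR k) * c)))%C with (RtoC 0) by ring.
    rewrite Cexp_0. unfold ray. ring.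
  - apply (exp_asymp_vanish (fun z => P (z + RtoC (INR k) * c)%C) p (S D) (cis t)); auto.
    rewrite Ep. replace (RtoC (INR n) * al * cis t ^ S (S D))%C with (RtoC (INR n) * (al * cis t ^ S (S D)))%C by ring.
    assert (E : fst (RtoC (INR n) * (al * cis t ^ S (S D)))%C = INR n * x) by apply re_scal_l.
    rewrite E. nra.
Qed.

(** Multiplied by [e^P(z)], the identity tends along the ray to [T = 0]. But [T] is the n-th
    difference of [e^(-pz)] at 0, that is [(e^(-pc) - 1)^n]. *)
Lemma linear_period c n (P h : C -> C) cf p al : (1 <= n)%nat ->
  (forall f z, Delta_n c n f z = Csum (fun j => cf j * f (z + RtoC (INR j) * c))%C (S n)) ->
  difference_relation c n P h cf ->
  (forall z w, P (z + w)%C = (P z + p * w)%C) -> (forall w, asymp (fun z => P (z + w)%C) p 1) ->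
  (forall w, asymp (fun z => h (z + w))%C al 1) ->
  p = (RtoC (INR n) * al)%C -> al <> RtoC 0 -> Cexp (- (p * c)) = RtoC 1.
Proof.
  intros Hn Hexp HR HPl HP Hh Ep Na.
  assert (HN : 1 <= INR n) by now apply (le_INR 1).
  assert (Nc : (- Cconj al)%C <> RtoC 0). { apply Cmod_gt_0. rewrite Cmod_opp, Cmod_conj. now apply Cmod_gt_0. }
  destruct (unit_root (- Cconj al)%C 0 Nc) as [t Ht].
  assert (Hm : 0 < Cmod al) by now apply Cmod_gt_0.
  assert (Hx : fst (al * cis t ^ 1)%C < 0).
  { assert (E := fst_scal_pos _ al _ _ Ht). rewrite Cmod_opp, Cmod_conj in E.
    replace (al * - Cconj al)%C with (- (al * Cconj al))%C in E by ring. rewrite <- Cmod2_conj in E.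
    change (- Cmod al ^ 2 = Cmod al * fst (al * cis t ^ 1)%C) in E.
    assert (0 < Cmod al ^ 2) by nra. nra. }
  set (x := fst (al * cis t ^ 1)%C) in *. assert (He := Cmod_cis t).
  assert (Hprod := prod_exp_to_1 (fun i z => h (z + RtoC (INR i) * c)%C) al 0 (cis t) He (fun i => Hh _) Hx).
  set (T := Csum (fun j => cf j * Cexp (- (p * (RtoC (INR j) * c))))%C (S n)).
  assert (HT : T = RtoC 0).
  { apply vanish_const.
    assert (V1 : vanish (fun r => Cexp (P (ray t r)))).
    { apply (exp_asymp_vanish P p 0 (cis t)); auto.
      apply asymp_ext with (fun z => P (z + 0)%C). intros z; f_equal; ring. apply HP.
      rewrite Ep. replace (RtoC (INR n) * al * cis t ^ 1)%C with (RtoC (INR n) * (al * cis t ^ 1))%C by ring.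
      assert (E : fst (RtoC (INR n) * (al * cis t ^ 1))%C = INR n * x) by apply re_scal_l.
      rewrite E. nra. }
    assert (V2 : vanish (fun r => Csum (fun j => cf j * Cexp (- (p * (RtoC (INR j) * c))) *
       (Cprod (fun i => 1 + Cexp (h (ray t r + RtoC (INR i) * c))) j - 1))%C (S n))).
    { apply (vanish_Csum (fun j r => cf j * Cexp (- (p * (RtoC (INR j) * c))) *
       (Cprod (fun i => 1 + Cexp (h (ray t r + RtoC (INR i) * c))) j - 1))%C). intros j _. apply vanish_scal. apply Hprod. }
    assert (W := vanish_minus _ _ V1 V2). revert W. apply vanish_ext. intros r.
    assert (E := f_equal (Cmult (Cexp (P (ray t r)))) (HR (ray t r))).
    rewrite <- Csum_scal, Cmult_1_r in E. rewrite <- E, <- Csum_minus.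
    apply Csum_ext. intros j _. cbv beta. rewrite HPl.
    replace (- (P (ray t r) + p * (RtoC (INR j) * c)))%C with (- P (ray t r) + - (p * (RtoC (INR j) * c)))%C by ring.
    rewrite Cexp_plus.
    match goal with |- (Cexp ?u * (?a * (?b * (Cexp (- ?u) * ?d))) - _)%C = _ =>
      transitivity ((Cexp (- u) * Cexp u) * (a * (b * d)) - a * d * (b - 1))%C; [ring|] end.
    rewrite Cexp_opp. ring. }
  assert (HD : forall m z, Delta_n c m (fun z => Cexp (- (p * z))) z = ((Cexp (- (p * c)) - 1) ^ m * Cexp (- (p * z)))%C).
  { induction m; intros z. simpl. ring. rewrite <- Nat.add_1_r at 1. rewrite Delta_n_succ, !IHm.
    replace (- (p * (z + c)))%C with (- (p * c) + - (p * z))%C by ring. rewrite Cexp_plus. simpl. ring. }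
  assert (E := HD n 0). rewrite Hexp in E.
  replace (- (p * 0))%C with (RtoC 0) in E by ring. rewrite Cexp_0, Cmult_1_r in E.
  destruct (Ceq_dec (Cexp (- (p * c))) 1) as [|N]; auto. exfalso.
  apply (Cpow_nz (Cexp (- (p * c)) - 1)%C n). now apply Cminus_eq_contra. rewrite <- E.
  transitivity T; [|exact HT]. apply Csum_ext. intros j _. now rewrite Cplus_0_l.
Qed.

Lemma no_linear_exponents c n f (P h : C -> C) cf p al : (1 <= n)%nat -> Entire f -> Entire h ->
  (exists z, f z <> RtoC 0) -> cf 1%nat <> RtoC 0 ->
  (forall z, Delta_n c n f z = Cexp (P z) * f z)%C ->
  (forall z, Delta_n c (n + 1) f z = Cexp (h z) * Delta_n c n f z)%C ->
  difference_relation c n P h cf ->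
  (forall z w, P (z + w)%C = (P z + p * w)%C) -> (forall z w, h (z + w)%C = (h z + al * w)%C) ->
  Cexp (- (p * c)) = RtoC 1 -> al <> RtoC 0 -> False.
Proof.
  intros Hn Hf Hh [z0 Hz0] Hcf1 E1 E2 HR HPl Hhl Hpc Na.
  (* The solution of [h w = i pi], a zero of [1 + e^h]. *)
  set (w := ((Ci * RtoC PI - h 0) / al)%C).
  assert (Hw : Cexp (h w) = RtoC (-1)).
  { replace w with (0 + w)%C by ring. rewrite Hhl. replace (h 0 + al * w)%C with (Ci * RtoC PI)%C by (unfold w; field; auto).
    unfold Cexp, Ci, Cmult, RtoC; simpl. replace (0 * PI - 1 * 0) with 0 by ring. replace (0 * 0 + 1 * PI) with PI by ring.
    rewrite exp_0, cos_PI, sin_PI. f_equal; ring. }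
  (* At [w] the factor of index 0 is zero, so only the empty product, j = 0, survives. *)
  assert (R1 := HR w). rewrite Csum_shift in R1. rewrite (Csum_zero (fun k => _)) in R1.
  2:{ intros k _. rewrite (Cprod_zero_factor _ (S k) 0); [ring|lia|].
      replace (w + RtoC (INR 0) * c)%C with w by (simpl; ring). rewrite Hw. ring. }
  (* At [w - c] the factor of index 1 is zero, so j = 0 and j = 1 survive. The j = 0 terms of [R1]
     and [R2] agree by the period of [e^P], which leaves the j = 1 term equal to 0. *)
  assert (R2 := HR (w - c)%C). destruct n as [|m]; [lia|]. rewrite Csum_shift, Csum_shift in R2.
  rewrite (Csum_zero (fun k => _)) in R2.
  2:{ intros k _. rewrite (Cprod_zero_factor _ (S (S k)) 1); [ring|lia|].
      replace (w - c + RtoC (INR 1) * c)%C with w by (simpl; ring). rewrite Hw. ring. }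
  cbn [Cprod INR] in R1, R2.
  replace (w + RtoC 0 * c)%C with w in R1 by ring.
  replace (w - c + RtoC 0 * c)%C with (w - c)%C in R2 by ring.
  replace (w - c + RtoC 1 * c)%C with w in R2 by ring.
  assert (EP : Cexp (- P (w - c)%C) = Cexp (- P w)%C).
  { replace (w - c)%C with (w + - c)%C by ring. rewrite HPl.
    transitivity (Cexp (- P w) * Cexp (- - (p * c)))%C. rewrite <- Cexp_plus. f_equal. ring.
    rewrite (Cexp_neg (- (p * c))%C), Hpc. field. }
  rewrite EP in R2.
  assert (R3 : (cf 1%nat * ((1 + Cexp (h (w - c))) * Cexp (- P w)))%C = RtoC 0).
  { transitivity ((cf 0%nat * (1 * Cexp (- P w)) + (cf 1%nat * (1 * (1 + Cexp (h (w - c))) * Cexp (- P w)) + 0)) -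
       (cf 0%nat * (1 * Cexp (- P w)) + 0))%C. ring. rewrite R1, R2. ring. }
  assert (Hwc : (1 + Cexp (h (w - c)%C))%C = RtoC 0).
  { destruct (Ceq_dec (1 + Cexp (h (w - c)%C))%C 0) as [|N]; auto. exfalso.
    revert R3. apply Cmult_neq_0; auto. apply Cmult_neq_0; auto. apply Cexp_neq_0. }
  assert (Hac : Cexp (al * c) = RtoC 1).
  { assert (E : Cexp (h w) = (Cexp (h (w - c)) * Cexp (al * c))%C).
    { rewrite <- Cexp_plus, <- Hhl. do 2 f_equal. ring. }
    replace (Cexp (h (w - c)%C)) with (RtoC (-1)) in E. 2:{ transitivity ((1 + Cexp (h (w - c)%C)) - 1)%C. rewrite Hwc. ring. ring. }
    rewrite Hw in E. transitivity (- (RtoC (-1) * Cexp (al * c)))%C. ring. rewrite <- E. ring. }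
  set (N := S m) in *.
  assert (Hper : forall z, Cexp (h (z + c)%C) = Cexp (h z)). { intros z. rewrite Hhl, Cexp_plus, Hac. ring. }
  assert (HPper : forall z, Cexp (P (z + c)%C) = Cexp (P z)).
  { intros z. rewrite HPl, Cexp_plus. assert (E := Cexp_opp (p * c)%C). rewrite Hpc, Cmult_1_l in E. rewrite E. ring. }
  (* Periodicity of [e^P] lets it cancel, and the relation between the two differences becomes a
     first-order equation for [f] itself. *)
  assert (Hfc : forall z, f (z + c)%C = ((1 + Cexp (h z)) * f z)%C).
  { intros z. assert (G := E2 z). rewrite Delta_n_succ, !E1, HPper in G.
    assert (NP := Cexp_neq_0 (P z)).
    transitivity ((Cexp (P z) * f (z + c) - Cexp (P z) * f z) / Cexp (P z) + f z)%C. field; auto. rewrite G. field. auto. }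
  (* Since [e^h] has period [c], iterating produces a power of one and the same factor, and that
     factor is zero at [w]. *)
  assert (Hk : forall k z, f z = ((1 + Cexp (h z)) ^ k * f (z - RtoC (INR k) * c))%C).
  { induction k; intros z.
    - simpl. replace (z - 0 * c)%C with z by ring. ring.
    - rewrite IHk. rewrite S_INR, RtoC_plus.
      assert (Hsh : forall j v, Cexp (h (v - RtoC (INR j) * c)%C) = Cexp (h v)).
      { induction j; intros v. simpl. do 2 f_equal; ring. rewrite <- (IHj v), S_INR, RtoC_plus.
        rewrite <- (Hper (v - (RtoC (INR j) + 1) * c)%C). do 2 f_equal. ring. }
      replace (z - RtoC (INR k) * c)%C with (z - (RtoC (INR k) + 1) * c + c)%C by ring. rewrite Hfc.
      replace (z - (RtoC (INR k) + 1) * c)%C with (z - RtoC (INR (S k)) * c)%C by (rewrite S_INR, RtoC_plus; ring).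
      rewrite Hsh. simpl. ring. }
  apply Hz0. apply (infinite_order_zero f w Hf). intros k.
  destruct (Entire_division (fun z => 1 + Cexp (h z))%C w) as [q [Hq Eq]].
  { apply Entire_plus. apply Entire_const. now apply Entire_exp. } { rewrite Hw. ring. }
  exists (fun z => q z ^ k * f (z - RtoC (INR k) * c))%C. split.
  - apply Entire_mult.
    + clear - Hq. induction k; simpl. apply Entire_const. now apply Entire_mult.
    + apply (Entire_shift f (- (RtoC (INR k) * c))%C Hf).
  - intros z. rewrite (Hk k z), Eq, Cpow_mult_l. ring.
Qed.

Theorem theorem1p3 (c : C) (n : nat) (f : C -> C) :
  (1 <= n)%nat ->
  entire f ->
  nonconstant f ->
  finite_order f ->
  share_0_CM3 f (Delta_n c n f) (Delta_n c (n + 1) f) ->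
  exists A : C, A <> RtoC 0 /\
    forall z : C, Delta_n c (n + 1) f z = (A * Delta_n c n f z)%C.
Proof.
  intros Hn Hent Hnc Hfo [S1 [_ S3]].
  assert (Hf := proj1 (entire_iff_Entire f) Hent).
  assert (Hf0 : exists z, f z <> RtoC 0).
  { apply not_all_not_ex. intros H. apply Hnc. exists (RtoC 0). intros z. apply NNPP. apply H. }
  set (g := Delta_n c n f) in *. set (g1 := Delta_n c (n + 1) f) in *.
  assert (Hg : Entire g) by now apply Entire_Delta_n. assert (Hg1 : Entire g1) by now apply Entire_Delta_n.
  destruct (share_CM_quotient f g Hf Hg Hf0 S1) as [E1 [HE1 [N1 Eg]]].
  assert (Hg0 : exists z, g z <> RtoC 0).
  { destruct Hf0 as [z Hz]. exists z. rewrite Eg. now apply Cmult_neq_0. }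
  destruct (share_CM_quotient g g1 Hg Hg1 Hg0 S3) as [E2 [HE2 [N2 Eg1]]].
  assert (Hg10 : exists z, g1 z <> RtoC 0).
  { destruct Hg0 as [z Hz]. exists z. rewrite Eg1. now apply Cmult_neq_0. }
  assert (Gf := exp_growth_of_finite_order f Hf Hfo).
  assert (Gg : exp_growth g) by now apply exp_growth_Delta_n.
  assert (Gg1 : exp_growth g1) by now apply exp_growth_Delta_n.
  destruct (entire_log_polynomial E1) as [a [N HP]]; auto.
  { apply (exp_growth_quotient E1 g f); auto. }
  (* The reciprocal is a quotient of the same two functions with their roles exchanged. *)
  { apply (exp_growth_quotient (fun z => / E1 z)%C f g); auto. now apply Entire_inv. intros z. rewrite Eg. field. auto. }
  destruct (entire_log_polynomial E2) as [b [M Hh]]; auto.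
  { apply (exp_growth_quotient E2 g1 g); auto. }
  { apply (exp_growth_quotient (fun z => / E2 z)%C g g1); auto. now apply Entire_inv. intros z. rewrite Eg1. field. auto. }
  set (P := fun z => Csum (fun k => a k * z ^ k)%C N) in *. set (h := fun z => Csum (fun k => b k * z ^ k)%C M) in *.
  destruct (classic (forall z, h z = h 0)) as [Hc|Hc].
  { exists (Cexp (h 0)). split. apply Cexp_neq_0. intros z. fold (g1 z) (g z). rewrite Eg1, Hh. fold (h z). now rewrite Hc. }
  exfalso.
  destruct (common_degree P h a b N M (fun z => eq_refl) (fun z => eq_refl) Hc) as [D [a' [b' [HaP [Hbh Nab]]]]].
  destruct (Delta_n_expansion c n) as [cf [Hcfn [Hcf0 [Hcf1 Hexp]]]].
  assert (Epow : forall k, Entire (fun z => z ^ k)%C).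
  { intros k. apply Entire_ext with (fun z => (z - 0) ^ k)%C. intros z; f_equal; ring. apply Entire_pow. }
  assert (EntP : Entire P). { apply (Entire_Csum (fun k z => a k * z ^ k)%C). intros k. apply Entire_mult; auto. apply Entire_const. }
  assert (Enth : Entire h). { apply (Entire_Csum (fun k z => b k * z ^ k)%C). intros k. apply Entire_mult; auto. apply Entire_const. }
  assert (EgP : forall z, Delta_n c n f z = (Cexp (P z) * f z)%C). { intros z. fold (g z). now rewrite Eg, HP. }
  assert (Egh : forall z, Delta_n c (n + 1) f z = (Cexp (h z) * Delta_n c n f z)%C). { intros z. fold (g z) (g1 z). now rewrite Eg1, Hh. }
  assert (HR : difference_relation c n P h cf).
  { intros z. now apply (difference_identity c n f). }
  assert (AP : forall w, asymp (fun z => P (z + w)%C) (a' (S D)) (S D)).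
  { intros w. apply asymp_ext with (2 := asymp_polynomial a' w (S D)). intros z. now rewrite HaP. }
  assert (Ah : forall w, asymp (fun z => h (z + w)%C) (b' (S D)) (S D)).
  { intros w. apply asymp_ext with (2 := asymp_polynomial b' w (S D)). intros z. now rewrite Hbh. }
  assert (Ep := leading_coefficient_relation c n P h cf D _ _ Hn Hcfn HR AP Ah Nab).
  assert (Na : b' (S D) <> RtoC 0). { intros E. apply Nab. split; auto. rewrite Ep, E. ring. }
  (* For [c = 0] every difference of order at least 1 is zero, whereas [g] is not identically
     zero. *)
  assert (Nc : c <> RtoC 0).
  { intros E. destruct Hg0 as [z Hz]. apply Hz. unfold g. destruct n as [|m]; [lia|].
    rewrite <- Nat.add_1_r, Delta_n_succ, E, Cplus_0_r. ring. }
  (* The common degree is [S D]: the first case is that of exponents of degree at most 1. *)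
  destruct D as [|D].
  - assert (HPl : forall z w, P (z + w)%C = (P z + a' 1%nat * w)%C) by (intros z w; rewrite !HaP; simpl; ring).
    assert (Hhl : forall z w, h (z + w)%C = (h z + b' 1%nat * w)%C) by (intros z w; rewrite !Hbh; simpl; ring).
    apply (no_linear_exponents c n f P h cf (a' 1%nat) (b' 1%nat)); auto.
    apply (linear_period c n P h cf (a' 1%nat) (b' 1%nat)); auto.
  - apply (no_degree_at_least_two c n P h cf D (a' (S (S D))) (b' (S (S D)))); auto.
    intros w. apply asymp_ext with (2 := asymp_polynomial_diff a' w (S D)). intros z. now rewrite !HaP.
Qed.
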